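(* For every integer $n\ge0$ and all complex $z,\alpha$ with $\operatorname{Re}(z)>0$ and $\operatorname{Re}(\alpha)>-\operatorname{Re}(z)$, the $n$-th derivative of Binet's function $\mu(z)$ is $$\frac{d^n\mu(z)}{dz^n}=(-1)^n\sum_{m=n}^{\infty}\frac{\frac{d^nb_m(\alpha)}{d\alpha^n}}{\prod_{k=0}^{m-1}(z+\alpha+k)} .$$
   Context: Binet's function is $\mu(z)=\log\Gamma(z)-\left(z-\frac12\right)\log z+z-\frac12\log(2\pi)$ for $\operatorname{Re}(z)>0$ (principal branches). $S_m^{(k)}$ denotes the (signed) Stirling number of the first kind, defined by $\prod_{k=0}^{m-1}(x-k)=\sum_{k=0}^{m}S_m^{(k)}x^k$. For $m\ge1$ the Binet polynomial is $$b_m(\alpha)=\frac1m\sum_{k=1}^{m}\left\{\frac{\alpha^{k+2}-(\alpha-1)^{k+2}}{k+2}+\frac{\left(\frac12-\alpha\right)\left(\alpha^{k+1}-(\alpha-1)^{k+1}\right)}{k+1}\right\}(-1)^{k-m}S_m^{(k)},$$ equivalently $b_m(\alpha)=\frac1m\int_{\alpha-1}^{\alpha}\left(x+\frac12-\alpha\right)\prod_{k=0}^{m-1}(k+x)\,dx$; by convention $b_0(\alpha)=0$. Empty products equal $1$. *)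

(* Defs.v *)
From Stdlib Require Import Reals Lra Lia ZArith ClassicalEpsilon.
From Coquelicot Require Import Coquelicot.
Open Scope R_scope.

Definition Cexp (z : C) : C := (exp (Re z) * cos (Im z), exp (Re z) * sin (Im z)).

(* The principal logarithm, on the right half-plane only: there
   Arg z = atan (Im z / Re z), in (- PI / 2, PI / 2). *)
Definition Clog (z : C) : C := (ln (Cmod z), atan (Im z / Re z)).

(* t^(z-1) e^(-t) for t > 0, with t^(z-1) = exp ((z - 1) ln t). *)
Definition Gamma_integrand (z : C) (t : R) : C :=
  (Cexp ((z - 1) * ln t) * exp (- t))%C.

(* Euler's integral over (0, +oo), an improper Riemann integral taken
   componentwise; it converges for Re z > 0, the only range of interest. *)
Definition CGamma (z : C) : C :=
  (RInt_gen (fun t => Re (Gamma_integrand z t)) (at_right 0) (Rbar_locally p_infty),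
   RInt_gen (fun t => Im (Gamma_integrand z t)) (at_right 0) (Rbar_locally p_infty)).

(* Complex differentiability: both source and target are C over itself. *)
Definition ex_C_derive (f : C -> C) (z : C) : Prop :=
  @ex_derive C_AbsRing C_NormedModule f z.

(* The principal branch of log Gamma: the holomorphic logarithm of Gamma on the
   right half-plane that is real on the positive axis. It is in general not
   [Clog (CGamma z)], which may fail to be continuous. *)
Definition is_logGamma (L : C -> C) : Prop :=
  (forall z : C, 0 < Re z -> ex_C_derive L z /\ Cexp (L z) = CGamma z) /\
  (forall x : R, 0 < x -> Im (L x) = 0).

(* [is_logGamma] determines the values on the right half-plane; the choice made
   elsewhere is irrelevant. *)
Definition logGamma : C -> C := epsilon (inhabits (fun _ : C => RtoC 0)) is_logGamma.

Definition binet (z : C) : C :=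
  (logGamma z - (z - 1 / 2) * Clog z + z - 1 / 2 * ln (2 * PI))%C.

Fixpoint C_derive_n (f : C -> C) (n : nat) : C -> C :=
  match n with
  | O => f
  | S n' => C_derive (C_derive_n f n')
  end.

(* f 0 * ... * f (n - 1) *)
Fixpoint Cprod (f : nat -> C) (n : nat) : C :=
  match n with
  | O => 1%C
  | S n' => (Cprod f n' * f n')%C
  end.

(* Signed Stirling numbers of the first kind: the coefficient of x^k in
   x (x - 1) ... (x - (m - 1)), computed by multiplying the previous product
   by x - (m - 1); see [stirling1_spec]. *)
Fixpoint stirling1 (m k : nat) : Z :=
  match m, k with
  | O, O => 1%Z
  | O, S _ => 0%Z
  | S m', O => (- (Z.of_nat m' * stirling1 m' O))%Z
  | S m', S k' => (stirling1 m' k' - Z.of_nat m' * stirling1 m' (S k'))%Z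
  end.

Lemma stirling1_gt (m k : nat) : (m < k)%nat -> stirling1 m k = 0%Z.
Proof.
revert k; induction m as [|m IH]; intros [|k] H; simpl; try lia.
rewrite (IH k), (IH (S k)) by lia; lia.
Qed.

Lemma stirling1_step (m p : nat) (x : C) :
  sum_n (fun k => (IZR (stirling1 (S m) k) * x ^ k)%C) (S p) =
  (x * sum_n (fun k => (IZR (stirling1 m k) * x ^ k)%C) p
   - INR m * sum_n (fun k => (IZR (stirling1 m k) * x ^ k)%C) (S p))%C.
Proof.
induction p as [|p IHp].
- rewrite !sum_Sn, !sum_O; change plus with Cplus; cbn [stirling1 Cpow].
  rewrite minus_IZR, opp_IZR, !mult_IZR, <- !INR_IZR_INZ.
  rewrite RtoC_minus, RtoC_opp, !RtoC_mult.
  match goal with |- ?a = ?b => change (@eq C a b) end; ring.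
- rewrite sum_Sn, IHp, (sum_Sn _ (S p)), (sum_Sn _ p).
  change plus with Cplus; cbn [stirling1 Cpow].
  rewrite minus_IZR, mult_IZR, <- INR_IZR_INZ, RtoC_minus, RtoC_mult.
  match goal with |- ?a = ?b => change (@eq C a b) end; ring.
Qed.

Lemma stirling1_spec (m : nat) (x : C) :
  Cprod (fun k => (x - INR k)%C) m =
  sum_n (fun k => (IZR (stirling1 m k) * x ^ k)%C) m.
Proof.
induction m as [|m IH].
- rewrite sum_O; simpl; match goal with |- ?a = ?b => change (@eq C a b) end; ring.
- rewrite stirling1_step, sum_Sn, (stirling1_gt m (S m)) by lia.
  change plus with Cplus; rewrite <- IH; cbn [Cprod]; ring.
Qed.

(* For k <= m the sign (-1)^(k-m) is (-1)^(m-k), whose exponent is natural. *)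
Definition binet_poly (m : nat) (a : C) : C :=
  match m with
  | O => 0%C
  | S _ =>
      (1 / INR m *
       sum_n_m (fun k : nat =>
         ((a ^ (k + 2) - (a - 1) ^ (k + 2)) / INR (k + 2)
          + (1 / 2 - a) * (a ^ (k + 1) - (a - 1) ^ (k + 1)) / INR (k + 1))
         * (- (1)) ^ (m - k) * IZR (stirling1 m k)) 1 m)%C
  end.

(* Main.v *)
Require Import Defs.
From Stdlib Require Import Arith Reals Lra Lia ClassicalEpsilon FunctionalExtensionality.
From Coquelicot Require Import Coquelicot.
Open Scope R_scope.

(* Write (x)_m for the rising factorial and fix w = z + alpha. For every a with
   Re a < Re w put S_a(w) = sum_m b_m(a) / (w)_m, where
   b_m(a) = 1/m int_0^1 (1/2 - t) (a - t)_m dt. The ratios |(a - t)_m / (w)_m|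
   are dominated by products of factors 1 - d / (2k), so the series converges
   absolutely. Integrating the inverse factorial expansion
   1 / (w - x) = sum_m (x)_m / (w)_{m+1} against 1/2 - t at x = a - t gives
   S_a(w) - S_a(w + 1) = (z + 1/2) (Log (z + 1) - Log z) - 1 with z = w - a,
   and S_a(w + N) -> 0; hence S_a(w) depends only on w - a. Call it M(w - a).

   Then l(z) = (z - 1/2) Log z - z + log (2 pi) / 2 + M(z) satisfies
   l(z + 1) = l(z) + Log z; Wallis' product gives l(1) = 0, and Gauss' limit
   N^z N! / (z)_{N+1} identifies exp l with Euler's integral. So l is log Gamma
   and M is Binet's function. The formula for the n-th derivative follows by
   differentiating M(w - a) = sum_m b_m(a) / (w)_m termwise in a with w fixed;
   this is legitimate by Cauchy's estimates, needed for polynomials only. *)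

(** * Finite sums, limits and series of complex numbers *)

(** A derivative in z would act on the rising factorials in the denominators. Since M depends on w -
    a alone, it can be traded for a derivative in a at the cost of a sign, which is the origin of
    (-1)^n. The degrees of the polynomials grow with m, so every estimate used for termwise
    differentiation must have constants that depend on a sup bound only, never on the degree. For
    the same reason the majorant of the ratios has to be uniform in a over a whole disc: half of the
    gap d between the real parts is sacrificed to absorb the second-order terms and obtain this
    uniformity.

    [logGamma] is merely specified as a holomorphic logarithm of Gamma that is real on the positive
    axis. Existence and uniqueness of such a function must both be established before anything can
    be said about [binet]. The difference equation alone does not reveal the value l(1), which
    amounts to the constant in Stirling's formula; this is the reason for the detour through
    Wallis. *)

Ltac Cring := match goal with |- ?a = ?b => change (@eq C a b) end; cbv beta; ring.

Fixpoint Csum (f : nat -> C) (n : nat) : C :=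
  match n with O => 0%C | S n' => (Csum f n' + f n')%C end.

Lemma sum_n_Csum (f : nat -> C) (n : nat) : sum_n f n = Csum f (S n).
Proof.
induction n as [|n IH].
- rewrite sum_O; simpl; Cring.
- rewrite sum_Sn, IH; reflexivity.
Qed.

Lemma Csum_ext (f g : nat -> C) (n : nat) :
  (forall k, (k < n)%nat -> f k = g k) -> Csum f n = Csum g n.
Proof.
induction n as [|n IH]; intros H; simpl; [reflexivity|].
rewrite IH, (H n) by (intros; try apply H; lia); reflexivity.
Qed.

Lemma Csum_plus (f g : nat -> C) (n : nat) :
  Csum (fun k => (f k + g k)%C) n = (Csum f n + Csum g n)%C.
Proof. induction n as [|n IH]; simpl; [|rewrite IH]; Cring. Qed.

Lemma Csum_scal (c : C) (f : nat -> C) (n : nat) :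
  Csum (fun k => (c * f k)%C) n = (c * Csum f n)%C.
Proof. induction n as [|n IH]; simpl; [|rewrite IH]; Cring. Qed.

Lemma Csum_zero (n : nat) : Csum (fun _ => 0%C) n = 0%C.
Proof. induction n as [|n IH]; simpl; [|rewrite IH]; Cring. Qed.

Lemma Csum_shift (f : nat -> C) (n : nat) :
  Csum f (S n) = (f O + Csum (fun k => f (S k)) n)%C.
Proof. induction n as [|n IH]; [simpl; Cring|]. cbn [Csum] in *. rewrite IH; Cring. Qed.

Lemma Csum_app (f : nat -> C) (n m : nat) :
  Csum f (n + m) = (Csum f n + Csum (fun k => f (n + k)%nat) m)%C.
Proof.
induction m as [|m IH]; [rewrite Nat.add_0_r; simpl; Cring|].
rewrite Nat.add_succ_r; simpl; rewrite IH; Cring.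
Qed.

Lemma Csum_switch (f : nat -> nat -> C) (n m : nat) :
  Csum (fun j => Csum (f j) m) n = Csum (fun k => Csum (fun j => f j k) n) m.
Proof.
induction n as [|n IH]; simpl; [now rewrite Csum_zero|].
rewrite IH, <- Csum_plus; reflexivity.
Qed.

Lemma Csum_single (c : C) (i n : nat) : (i < n)%nat ->
  Csum (fun k => if Nat.eq_dec k i then c else 0%C) n = c.
Proof.
induction n as [|n IH]; intros H; [lia|]; simpl.
destruct (Nat.eq_dec n i) as [->|Hn].
- rewrite (Csum_ext _ (fun _ => 0%C)), Csum_zero; [Cring|].
  intros k Hk; destruct (Nat.eq_dec k i); [lia|reflexivity].
- rewrite IH by lia; Cring.
Qed.

Lemma Cmod_Csum_le (f : nat -> C) (B : nat -> R) (n : nat) :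
  (forall k, Cmod (f k) <= B k) -> Cmod (Csum f (S n)) <= sum_n B n.
Proof.
intros H; induction n as [|n IH].
- rewrite sum_O; simpl; rewrite Cplus_0_l; apply H.
- rewrite sum_Sn; change (Csum f (S (S n))) with (Csum f (S n) + f (S n))%C.
  eapply Rle_trans; [apply Cmod_triangle|].
  change plus with Rplus; apply Rplus_le_compat; [exact IH|apply H].
Qed.

Lemma Cmod_Csum_const (f : nat -> C) (B : R) (n : nat) :
  (forall k, (k < n)%nat -> Cmod (f k) <= B) -> Cmod (Csum f n) <= INR n * B.
Proof.
intros H; induction n as [|n IH].
- simpl; rewrite Cmod_0; lra.
- rewrite S_INR; simpl; eapply Rle_trans; [apply Cmod_triangle|].
  assert (H1 := IH (fun k Hk => H k (Nat.lt_lt_succ_r _ _ Hk))).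
  assert (H2 := H n (Nat.lt_succ_diag_r n)); lra.
Qed.

Lemma Re_Csum (f : nat -> C) (n : nat) :
  Re (Csum f (S n)) = sum_n (fun k => Re (f k)) n.
Proof.
induction n as [|n IH].
- rewrite sum_O; cbn [Csum]; rewrite Cplus_0_l; reflexivity.
- rewrite sum_Sn, <- IH; reflexivity.
Qed.

Lemma Im_Csum (f : nat -> C) (n : nat) :
  Im (Csum f (S n)) = sum_n (fun k => Im (f k)) n.
Proof.
induction n as [|n IH].
- rewrite sum_O; cbn [Csum]; rewrite Cplus_0_l; reflexivity.
- rewrite sum_Sn, <- IH; reflexivity.
Qed.

Lemma Cmod_le_Re_Im (z : C) : Cmod z <= Rabs (Re z) + Rabs (Im z).
Proof.
replace z with (RtoC (Re z) + Ci * RtoC (Im z))%C at 1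
  by (destruct z; unfold Ci, Cplus, Cmult, RtoC; simpl; f_equal; ring).
eapply Rle_trans; [apply Cmod_triangle|].
rewrite Cmod_mult, Cmod_Ci, !Cmod_R; lra.
Qed.

Lemma im_le_Cmod (z : C) : Rabs (Im z) <= Cmod z.
Proof.
eapply Rle_trans; [|apply Rmax_Cmod]; apply Rmax_r.
Qed.

Lemma Re_le_Cmod (z : C) : Re z <= Cmod z.
Proof. eapply Rle_trans; [apply Rle_abs|apply re_le_Cmod]. Qed.

Lemma Cmod_sub_triangle (x y z : C) : Cmod (x - z) <= Cmod (x - y) + Cmod (y - z).
Proof. replace (x - z)%C with ((x - y) + (y - z))%C by ring; apply Cmod_triangle. Qed.

Lemma Re_neq0 (z : C) : 0 < Re z -> z <> 0%C.
Proof. intros H ->; simpl in H; lra. Qed.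

(** Convergence is phrased by the real sequence of distances, so that squeezing against real
    majorants is immediate; [is_series_Clim] returns to filters. *)
Definition Clim (u : nat -> C) (l : C) : Prop :=
  is_lim_seq (fun n => Cmod (u n - l)) 0.

Lemma is_lim_seq_squeeze0 (u v : nat -> R) :
  (forall n, 0 <= u n <= v n) -> is_lim_seq v 0 -> is_lim_seq u 0.
Proof.
intros H Hv; apply is_lim_seq_le_le with (fun _ => 0) v; auto.
apply is_lim_seq_const.
Qed.

Lemma Clim_le (u : nat -> C) (l : C) (e : nat -> R) :
  (forall n, Cmod (u n - l) <= e n) -> is_lim_seq e 0 -> Clim u l.
Proof.
intros H He; apply is_lim_seq_squeeze0 with e; auto.
intros n; split; [apply Cmod_ge_0|apply H].
Qed.

Lemma Clim_ext (u v : nat -> C) (l : C) :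
  (forall n, u n = v n) -> Clim u l -> Clim v l.
Proof. intros H; apply is_lim_seq_ext; intros n; now rewrite H. Qed.

Lemma Clim_const (l : C) : Clim (fun _ => l) l.
Proof.
apply is_lim_seq_ext with (fun _ => 0); [|apply is_lim_seq_const].
intros n; replace (l - l)%C with (RtoC 0) by ring; now rewrite Cmod_0.
Qed.

Lemma Clim_plus (u v : nat -> C) (l m : C) :
  Clim u l -> Clim v m -> Clim (fun n => (u n + v n)%C) (l + m)%C.
Proof.
intros H1 H2; apply Clim_le with (fun n => Cmod (u n - l) + Cmod (v n - m)).
- intros n; replace (u n + v n - (l + m))%C with ((u n - l) + (v n - m))%C by ring.
  apply Cmod_triangle.
- replace 0 with (0 + 0) by ring; apply is_lim_seq_plus'; assumption.
Qed.

Lemma Clim_scal (c : C) (u : nat -> C) (l : C) :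
  Clim u l -> Clim (fun n => (c * u n)%C) (c * l)%C.
Proof.
intros H; apply Clim_le with (fun n => Cmod c * Cmod (u n - l)).
- intros n; replace (c * u n - c * l)%C with (c * (u n - l))%C by ring.
  rewrite Cmod_mult; lra.
- replace (Finite 0) with (Rbar_mult (Cmod c) 0) by (simpl; f_equal; ring).
  now apply is_lim_seq_scal_l.
Qed.

Lemma Clim_minus (u v : nat -> C) (l m : C) :
  Clim u l -> Clim v m -> Clim (fun n => (u n - v n)%C) (l - m)%C.
Proof.
intros H1 H2; replace (l - m)%C with (l + (- (1)) * m)%C by ring.
apply Clim_ext with (fun n => (u n + (- (1)) * v n)%C); [intros; Cring|].
apply Clim_plus; [|apply Clim_scal]; assumption.
Qed.

Lemma Clim_unique (u : nat -> C) (l m : C) : Clim u l -> Clim u m -> l = m.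
Proof.
intros H1 H2; assert (H := Clim_minus _ _ _ _ H1 H2).
assert (H0 : is_lim_seq (fun _ : nat => Cmod (l - m)) 0).
{ apply is_lim_seq_ext with (2 := H); intros n.
  replace (u n - u n - (l - m))%C with (- (l - m))%C by ring; apply Cmod_opp. }
apply is_lim_seq_unique in H0; rewrite Lim_seq_const in H0.
injection H0 as H0; apply Cmod_eq_0 in H0.
apply Ceq_minus; exact H0.
Qed.

Lemma Clim_incr_n (u : nat -> C) (l : C) (N : nat) :
  Clim (fun n => u (n + N)%nat) l <-> Clim u l.
Proof. symmetry; apply (is_lim_seq_incr_n (fun n => Cmod (u n - l)) N 0). Qed.

Lemma Clim_parts (u : nat -> C) (l : C) :
  is_lim_seq (fun n => Re (u n)) (Re l) -> is_lim_seq (fun n => Im (u n)) (Im l) ->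
  Clim u l.
Proof.
intros H1 H2.
apply Clim_le with (fun n => Rabs (Re (u n) - Re l) + Rabs (Im (u n) - Im l)).
- intros n; eapply Rle_trans; [apply Cmod_le_Re_Im|apply Req_le; reflexivity].
- replace 0 with (0 + 0) by ring.
  apply is_lim_seq_plus'; apply (is_lim_seq_abs_0 (fun n => _ - _)).
  + replace 0 with (Re l - Re l) by ring.
    apply is_lim_seq_minus'; [assumption|apply is_lim_seq_const].
  + replace 0 with (Im l - Im l) by ring.
    apply is_lim_seq_minus'; [assumption|apply is_lim_seq_const].
Qed.

Lemma is_lim_seq_of_diff (u : nat -> R) (l : R) :
  is_lim_seq (fun n => u n - l) 0 -> is_lim_seq u l.
Proof.
intros H; replace l with (0 + l) by ring.
apply is_lim_seq_ext with (fun n => (u n - l) + l); [intros; ring|].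
apply is_lim_seq_plus'; [assumption|apply is_lim_seq_const].
Qed.

Lemma Clim_Re (u : nat -> C) (l : C) : Clim u l -> is_lim_seq (fun n => Re (u n)) (Re l).
Proof.
intros H; apply is_lim_seq_of_diff, is_lim_seq_abs_0.
apply is_lim_seq_squeeze0 with (2 := H); intros n; split; [apply Rabs_pos|].
apply (re_le_Cmod (u n - l)).
Qed.

Lemma Clim_Im (u : nat -> C) (l : C) : Clim u l -> is_lim_seq (fun n => Im (u n)) (Im l).
Proof.
intros H; apply is_lim_seq_of_diff, is_lim_seq_abs_0.
apply is_lim_seq_squeeze0 with (2 := H); intros n; split; [apply Rabs_pos|].
apply (im_le_Cmod (u n - l)).
Qed.

Lemma Clim_Cexp (u : nat -> C) (l : C) : Clim u l -> Clim (fun n => Cexp (u n)) (Cexp l).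
Proof.
intros H; assert (H1 := Clim_Re _ _ H); assert (H2 := Clim_Im _ _ H).
assert (He : is_lim_seq (fun n => exp (Re (u n))) (exp (Re l))).
{ apply (is_lim_seq_continuous exp); [|assumption].
  apply derivable_continuous_pt, derivable_pt_exp. }
apply Clim_parts; unfold Cexp; simpl; apply is_lim_seq_mult'; try assumption.
- apply (is_lim_seq_continuous cos); [|assumption].
  apply derivable_continuous_pt, derivable_pt_cos.
- apply (is_lim_seq_continuous sin); [|assumption].
  apply derivable_continuous_pt, derivable_pt_sin.
Qed.

Lemma is_series_Clim (f : nat -> C) (s : C) :
  Clim (fun n => Csum f (S n)) s -> @is_series C_AbsRing C_NormedModule f s.
Proof.
intros H; unfold is_series; apply filterlim_locally; intros eps.
apply is_lim_seq_spec in H; destruct (H eps) as [N HN].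
exists N; intros n Hn; apply C_NormedModule_mixin_compat1.
specialize (HN n Hn); rewrite Rminus_0_r, Rabs_pos_eq in HN by apply Cmod_ge_0.
rewrite sum_n_Csum; exact HN.
Qed.

(** The series of the theorem begins at m = n; all earlier terms vanish, so its sum is that of the
    full series. *)
Lemma Csum_tail (f : nat -> C) (s : C) (n : nat) :
  (forall k, (k < n)%nat -> f k = 0%C) ->
  Clim (Csum f) s -> @is_series C_AbsRing C_NormedModule (fun j => f (n + j)%nat) s.
Proof.
intros Hz H; apply is_series_Clim.
(* The partial sum of index j has j + 1 terms, hence the shift by n + 1. *)
apply Clim_ext with (fun j => Csum f (j + (n + 1))).
- intros j; replace (j + (n + 1))%nat with (n + S j)%nat by lia.
  rewrite Csum_app, (Csum_ext f (fun _ => 0%C) n), Csum_zero by assumption; Cring.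
- apply Clim_incr_n; assumption.
Qed.

(** The component series are default values unless they converge; [CSeries_correct] ensures this by
    absolute domination. *)
Definition CSeries (f : nat -> C) : C :=
  (Series (fun k => Re (f k)), Series (fun k => Im (f k))).

Lemma CSeries_correct (f : nat -> C) (B : nat -> R) :
  (forall k, Cmod (f k) <= B k) -> ex_series B -> Clim (Csum f) (CSeries f).
Proof.
intros H HB; apply (Clim_incr_n _ _ 1); apply Clim_parts.
- apply is_lim_seq_ext with (sum_n (fun k => Re (f k))).
  + intros n; rewrite Nat.add_1_r, Re_Csum; reflexivity.
  + apply (Series_correct (fun k => Re (f k))).
    apply ex_series_le with (2 := HB) (a := fun k => Re (f k)).
    intros k; eapply Rle_trans; [apply (re_le_Cmod (f k))|apply H].
- apply is_lim_seq_ext with (sum_n (fun k => Im (f k))).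
  + intros n; rewrite Nat.add_1_r, Im_Csum; reflexivity.
  + apply (Series_correct (fun k => Im (f k))).
    apply ex_series_le with (2 := HB) (a := fun k => Im (f k)).
    intros k; eapply Rle_trans; [apply (im_le_Cmod (f k))|apply H].
Qed.

Lemma Clim_bound (u : nat -> C) (l : C) (M : R) :
  (forall n, Cmod (u n) <= M) -> Clim u l -> Cmod l <= M.
Proof.
intros H Hu; apply Rnot_lt_le; intros Hl.
apply is_lim_seq_spec in Hu.
assert (He : 0 < Cmod l - M) by lra.
destruct (Hu (mkposreal _ He)) as [N HN]; specialize (HN N (Nat.le_refl N)); simpl in HN.
rewrite Rminus_0_r, Rabs_pos_eq in HN by apply Cmod_ge_0.
assert (H1 := Cmod_triangle (u N) (- (u N - l))); specialize (H N).
rewrite Cmod_opp in H1; replace (u N + - (u N - l))%C with l in H1 by ring; lra.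
Qed.

Lemma Clim_Csum_bound (f : nat -> C) (B : nat -> R) (s : C) :
  (forall k, Cmod (f k) <= B k) -> ex_series B -> Clim (Csum f) s ->
  Cmod s <= Series B.
Proof.
intros H HB Hs.
apply Clim_bound with (fun n => Csum f n); [|assumption].
intros n.
assert (Hp : forall k, 0 <= B k) by (intros k; eapply Rle_trans; [apply Cmod_ge_0|apply H]).
assert (HS : forall m, sum_n B m <= Series B).
{ intros m; apply Rnot_lt_le; intros Hm.
  assert (HL : is_lim_seq (sum_n B) (Series B)) by exact (Series_correct _ HB).
  apply (Rlt_irrefl (Series B)).
  apply Rlt_le_trans with (1 := Hm).
  apply (is_lim_seq_incr_compare (sum_n B) (Series B)); [assumption|].
  intros k; rewrite sum_Sn; change plus with Rplus; specialize (Hp (S k)); lra. }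
destruct n as [|n].
- simpl; rewrite Cmod_0.
  apply Rle_trans with (sum_n B 0); [rewrite sum_O; apply Hp|apply HS].
- eapply Rle_trans; [apply Cmod_Csum_le with (1 := H)|apply HS].
Qed.

(** * Derivatives and integrals of complex-valued functions *)

(** The increment h is explicit and the inequality is not strict, so that remainder estimates apply
    directly, including at h = 0. *)
Definition Cder (f : C -> C) (z l : C) : Prop :=
  forall eps : R, 0 < eps -> exists d : R, 0 < d /\
    forall h : C, Cmod h < d -> Cmod (f (z + h) - f z - h * l)%C <= eps * Cmod h.

Lemma Cder_is_derive (f : C -> C) (z l : C) :
  Cder f z l -> @is_derive C_AbsRing C_NormedModule f z l.
Proof.
intros H; split; [apply is_linear_scal_l|].
intros x Hx eps.
assert (E : z = x) by exact (is_filter_lim_locally_unique (V := AbsRing_NormedModule C_AbsRing) _ _ Hx).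
subst x.
destruct (H eps (cond_pos eps)) as (d & Hd & HH).
assert (HH' : forall y : C, Cmod (y - z) < d ->
  Cmod (f y - f z - (y - z) * l)%C <= eps * Cmod (y - z)).
{ intros y Hy; specialize (HH _ Hy); replace (z + (y - z))%C with y in HH by ring; exact HH. }
exists (mkposreal d Hd); intros y Hy; exact (HH' y Hy).
Qed.

Lemma Cder_ex (f : C -> C) (z l : C) : Cder f z l -> ex_C_derive f z.
Proof. intros H; exists l; now apply Cder_is_derive. Qed.

Lemma Cder_unique (f : C -> C) (z l : C) : Cder f z l -> C_derive f z = l.
Proof. intros H; apply is_C_derive_unique; now apply Cder_is_derive. Qed.

Lemma Cder_of_quadratic (f : C -> C) (z l : C) (d K : R) :
  0 < d -> (forall h, Cmod h < d -> Cmod (f (z + h) - f z - h * l)%C <= K * Cmod h ^ 2) ->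
  Cder f z l.
Proof.
intros Hd H eps Heps.
(* K may be zero or negative; raising it to at least 1 permits the division eps / K'. *)
set (K' := Rmax K 1); assert (HK : 0 < K') by (unfold K'; apply Rlt_le_trans with 1; [lra|apply Rmax_r]).
assert (HK' : K <= K') by apply Rmax_l.
exists (Rmin d (eps / K')); split.
- apply Rmin_case; [assumption|]. now apply Rdiv_lt_0_compat.
- intros h Hh; eapply Rle_trans; [apply H; eapply Rlt_le_trans; [exact Hh|apply Rmin_l]|].
  assert (Hh2 : Cmod h < eps / K') by (eapply Rlt_le_trans; [exact Hh|apply Rmin_r]).
  assert (Hh3 : K' * Cmod h <= eps).
  { apply Rmult_le_reg_r with (/ K'); [now apply Rinv_0_lt_compat|].
    replace (K' * Cmod h * / K') with (Cmod h) by (field; lra).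
    apply Rlt_le; exact Hh2. }
  assert (H0 := Cmod_ge_0 h).
  assert (0 <= Cmod h ^ 2) by apply pow2_ge_0.
  nra.
Qed.

Lemma Cder_ext_loc (f g : C -> C) (z l : C) (d : R) : 0 < d ->
  (forall h, Cmod h < d -> f (z + h)%C = g (z + h)%C) -> Cder f z l -> Cder g z l.
Proof.
intros Hd E H eps Heps; destruct (H eps Heps) as (d' & Hd' & HH).
exists (Rmin d d'); split; [now apply Rmin_case|].
intros h Hh; rewrite <- E by (eapply Rlt_le_trans; [exact Hh|apply Rmin_l]).
replace (g z) with (f z); [apply HH; eapply Rlt_le_trans; [exact Hh|apply Rmin_r]|].
replace z with (z + 0)%C by ring; apply E; now rewrite Cmod_0.
Qed.

Lemma Cder_continuous (f : C -> C) (z l : C) : Cder f z l ->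
  forall eps, 0 < eps -> exists d, 0 < d /\
    forall h, Cmod h < d -> Cmod (f (z + h) - f z)%C < eps.
Proof.
intros H eps Heps; destruct (H 1 Rlt_0_1) as (d & Hd & HH).
set (K := 1 + Cmod l + 1).
assert (HK : 0 < K) by (unfold K; assert (H0 := Cmod_ge_0 l); lra).
exists (Rmin d (eps / K)); split; [apply Rmin_case; [assumption|now apply Rdiv_lt_0_compat]|].
intros h Hh.
assert (H1 := HH h (Rlt_le_trans _ _ _ Hh (Rmin_l _ _))).
assert (H2 : Cmod h < eps / K) by (eapply Rlt_le_trans; [exact Hh|apply Rmin_r]).
assert (H3 : K * Cmod h < eps).
{ apply Rmult_lt_reg_r with (/ K); [now apply Rinv_0_lt_compat|].
  replace (K * Cmod h * / K) with (Cmod h) by (field; lra); exact H2. }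
replace (f (z + h) - f z)%C with ((f (z + h) - f z - h * l) + h * l)%C by ring.
eapply Rle_lt_trans; [apply Cmod_triangle|]; rewrite Cmod_mult.
assert (H4 := Cmod_ge_0 h); unfold K in H3; nra.
Qed.

Lemma Cder_const (c z : C) : Cder (fun _ => c) z 0.
Proof.
apply Cder_of_quadratic with 1 0; [lra|]; intros h _.
replace (c - c - h * 0)%C with (RtoC 0) by ring; rewrite Cmod_0; nra.
Qed.

Lemma Cder_id (z : C) : Cder (fun x => x) z 1.
Proof.
apply Cder_of_quadratic with 1 0; [lra|]; intros h _.
replace (z + h - z - h * 1)%C with (RtoC 0) by ring; rewrite Cmod_0; nra.
Qed.

Lemma Cder_plus (f g : C -> C) (z l m : C) :
  Cder f z l -> Cder g z m -> Cder (fun x => (f x + g x)%C) z (l + m).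
Proof.
intros Hf Hg eps Heps.
destruct (Hf (eps / 2)) as (d1 & Hd1 & H1); [lra|].
destruct (Hg (eps / 2)) as (d2 & Hd2 & H2); [lra|].
exists (Rmin d1 d2); split; [now apply Rmin_case|]; intros h Hh.
replace (f (z + h) + g (z + h) - (f z + g z) - h * (l + m))%C with
  ((f (z + h) - f z - h * l) + (g (z + h) - g z - h * m))%C by ring.
eapply Rle_trans; [apply Cmod_triangle|].
specialize (H1 h (Rlt_le_trans _ _ _ Hh (Rmin_l _ _))).
specialize (H2 h (Rlt_le_trans _ _ _ Hh (Rmin_r _ _))); lra.
Qed.

Lemma Cmod_triangle4 (a b c d : C) :
  Cmod (a + b + c + d) <= Cmod a + Cmod b + Cmod c + Cmod d.
Proof.
assert (H1 := Cmod_triangle (a + b + c) d); assert (H2 := Cmod_triangle (a + b) c).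
assert (H3 := Cmod_triangle a b); lra.
Qed.

Lemma Cder_mult (f g : C -> C) (z l m : C) :
  Cder f z l -> Cder g z m -> Cder (fun x => (f x * g x)%C) z (l * g z + f z * m).
Proof.
intros Hf Hg eps Heps.
set (A := Cmod (f z)); set (B := Cmod (g z)); set (D := Cmod l).
assert (HA : 0 <= A) by apply Cmod_ge_0; assert (HB : 0 <= B) by apply Cmod_ge_0.
assert (HD : 0 <= D) by apply Cmod_ge_0.
(* The four error terms below contribute B, 1, D and A times e |h|, whence the denominator. *)
set (e := eps / (A + B + 1 + D)).
assert (He : 0 < e) by (apply Rdiv_lt_0_compat; lra).
assert (He' : e * (A + B + 1 + D) = eps) by (unfold e; field; lra).
destruct (Hf e He) as (d1 & Hd1 & H1); destruct (Hg e He) as (d2 & Hd2 & H2).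
destruct (Cder_continuous _ _ _ Hg (Rmin 1 e)) as (d3 & Hd3 & H3); [apply Rmin_case; lra|].
exists (Rmin d1 (Rmin d2 d3)); split; [repeat apply Rmin_case; assumption|]; intros h Hh.
specialize (H1 h (Rlt_le_trans _ _ _ Hh (Rmin_l _ _))).
assert (Hh' := Rlt_le_trans _ _ _ Hh (Rmin_r _ _)).
specialize (H2 h (Rlt_le_trans _ _ _ Hh' (Rmin_l _ _))).
specialize (H3 h (Rlt_le_trans _ _ _ Hh' (Rmin_r _ _))).
assert (H4 := Rlt_le_trans _ _ _ H3 (Rmin_l _ _)); assert (H5 := Rlt_le_trans _ _ _ H3 (Rmin_r _ _)).
replace (f (z + h) * g (z + h) - f z * g z - h * (l * g z + f z * m))%C with
  ((f (z + h) - f z - h * l) * g z + (f (z + h) - f z - h * l) * (g (z + h) - g z)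
   + h * l * (g (z + h) - g z) + f z * (g (z + h) - g z - h * m))%C by ring.
assert (H6 := Cmod_ge_0 h).
assert (H7 := Cmod_ge_0 (f (z + h) - f z - h * l)%C).
assert (H8 := Cmod_ge_0 (g (z + h) - g z)%C).
assert (H9 := Cmod_ge_0 (g (z + h) - g z - h * m)%C).
eapply Rle_trans; [apply Cmod_triangle4|].
rewrite !Cmod_mult; fold A B D.
set (x := Cmod (f (z + h) - f z - h * l)%C) in *; set (y := Cmod (g (z + h) - g z)%C) in *.
set (t := Cmod (g (z + h) - g z - h * m)%C) in *; set (k := Cmod h) in *.
assert (x * B <= e * k * B) by (apply Rmult_le_compat_r; assumption).
assert (x * y <= e * k * 1) by (apply Rmult_le_compat; lra).
assert (k * D * y <= k * D * e) by (apply Rmult_le_compat_l; [apply Rmult_le_pos|]; lra).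
assert (A * t <= A * (e * k)) by (apply Rmult_le_compat_l; lra).
replace (eps * k) with (e * (A + B + 1 + D) * k) by (rewrite He'; ring); lra.
Qed.

Lemma Cder_sub (c : C) (f : C -> C) (z l : C) :
  Cder f (c - z) l -> Cder (fun x => f (c - x)%C) z (- l).
Proof.
intros H eps Heps; destruct (H eps Heps) as (d & Hd & HH).
exists d; split; [assumption|]; intros h Hh.
specialize (HH (- h)%C); rewrite Cmod_opp in HH; specialize (HH Hh).
replace (c - z + - h)%C with (c - (z + h))%C in HH by ring.
replace (f (c - (z + h)) - f (c - z) - h * - l)%C with
  (f (c - (z + h)) - f (c - z) - - h * l)%C by ring; exact HH.
Qed.

(** * Derivatives of complex-valued functions of a real variable *)

Definition RCder (f : R -> C) (t : R) (l : C) : Prop :=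
  is_derive (fun s => Re (f s)) t (Re l) /\ is_derive (fun s => Im (f s)) t (Im l).

Lemma RCder_eq (f : R -> C) (t : R) (l m : C) : RCder f t l -> l = m -> RCder f t m.
Proof. now intros H <-. Qed.

Lemma RCder_ext (f g : R -> C) (t : R) (l : C) :
  (forall s, f s = g s) -> RCder f t l -> RCder g t l.
Proof.
intros E [H1 H2]; split.
- apply is_derive_ext with (2 := H1); intros; now rewrite E.
- apply is_derive_ext with (2 := H2); intros; now rewrite E.
Qed.

Lemma RCder_const (c : C) (t : R) : RCder (fun _ => c) t 0.
Proof. split; apply is_derive_Reals, derivable_pt_lim_const. Qed.

Lemma RCder_RtoC (f : R -> R) (t l : R) :
  is_derive f t l -> RCder (fun s => RtoC (f s)) t l.
Proof. intros H; split; [exact H|apply is_derive_Reals, derivable_pt_lim_const]. Qed.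

Lemma RCder_plus (f g : R -> C) (t : R) (l m : C) :
  RCder f t l -> RCder g t m -> RCder (fun s => (f s + g s)%C) t (l + m).
Proof.
intros [H1 H2] [H3 H4]; split.
- apply (is_derive_plus (fun s => Re (f s)) (fun s => Re (g s))); assumption.
- apply (is_derive_plus (fun s => Im (f s)) (fun s => Im (g s))); assumption.
Qed.

Lemma RCder_mult (f g : R -> C) (t : R) (l m : C) :
  RCder f t l -> RCder g t m -> RCder (fun s => (f s * g s)%C) t (l * g t + f t * m).
Proof.
intros [H1 H2] [H3 H4]; split.
- replace (Re (l * g t + f t * m)%C) with
    ((Re l * Re (g t) + Re (f t) * Re m) - (Im l * Im (g t) + Im (f t) * Im m))
    by (unfold Re, Im; simpl; ring).
  apply (is_derive_minus (fun s => Re (f s) * Re (g s)) (fun s => Im (f s) * Im (g s))).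
  + apply (is_derive_mult (fun s => Re (f s)) (fun s => Re (g s))); auto; intros; apply Rmult_comm.
  + apply (is_derive_mult (fun s => Im (f s)) (fun s => Im (g s))); auto; intros; apply Rmult_comm.
- replace (Im (l * g t + f t * m)%C) with
    ((Re l * Im (g t) + Re (f t) * Im m) + (Im l * Re (g t) + Im (f t) * Re m))
    by (unfold Re, Im; simpl; ring).
  apply (is_derive_plus (fun s => Re (f s) * Im (g s)) (fun s => Im (f s) * Re (g s))).
  + apply (is_derive_mult (fun s => Re (f s)) (fun s => Im (g s))); auto; intros; apply Rmult_comm.
  + apply (is_derive_mult (fun s => Im (f s)) (fun s => Re (g s))); auto; intros; apply Rmult_comm.
Qed.

Lemma RCder_scal (c : C) (f : R -> C) (t : R) (l : C) :
  RCder f t l -> RCder (fun s => (c * f s)%C) t (c * l).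
Proof.
intros H; eapply RCder_eq; [apply RCder_mult; [apply RCder_const|exact H]|]; Cring.
Qed.

Lemma RCder_minus (f g : R -> C) (t : R) (l m : C) :
  RCder f t l -> RCder g t m -> RCder (fun s => (f s - g s)%C) t (l - m).
Proof.
intros H1 H2; apply RCder_ext with (fun s => (f s + (- (1)) * g s)%C); [intros; Cring|].
eapply RCder_eq; [apply RCder_plus; [exact H1|apply RCder_scal; exact H2]|]; Cring.
Qed.

Lemma RCder_affine (a b : C) (t : R) : RCder (fun s => (a + RtoC s * b)%C) t b.
Proof.
eapply RCder_eq.
- apply RCder_plus; [apply RCder_const|apply RCder_mult; [|apply RCder_const]].
  apply (RCder_RtoC (fun s => s) t 1), (is_derive_id (K := R_AbsRing)).
- Cring.
Qed.

Lemma RCder_pow (f : R -> C) (t : R) (l : C) (n : nat) :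
  RCder f t l -> RCder (fun s => (f s ^ (S n))%C) t (RtoC (INR (S n)) * l * f t ^ n).
Proof.
intros H; induction n as [|n IH].
- apply RCder_ext with f; [intros; simpl; Cring|].
  eapply RCder_eq; [exact H|]; simpl; Cring.
- apply RCder_ext with (fun s => (f s * f s ^ S n)%C); [reflexivity|].
  eapply RCder_eq; [apply RCder_mult; [exact H|exact IH]|].
  rewrite (S_INR (S n)), RtoC_plus; cbn [Cpow]; Cring.
Qed.

Lemma is_derive_exp_cos_sin (u v : R -> R) (t du dv : R) :
  is_derive u t du -> is_derive v t dv ->
  is_derive (fun s => exp (u s) * cos (v s)) t
    (du * (exp (u t) * cos (v t)) - dv * (exp (u t) * sin (v t))) /\
  is_derive (fun s => exp (u s) * sin (v s)) t
    (du * (exp (u t) * sin (v t)) + dv * (exp (u t) * cos (v t))).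
Proof.
intros H1 H2.
assert (E1 : Derive (fun x => u x) t = du) by exact (is_derive_unique _ _ _ H1).
assert (E2 : Derive (fun x => v x) t = dv) by exact (is_derive_unique _ _ _ H2).
assert (D1 : ex_derive u t) by (eexists; exact H1).
assert (D2 : ex_derive v t) by (eexists; exact H2).
split; auto_derive; auto; rewrite E1, E2; ring.
Qed.

Lemma is_derive_inv_parts (u v : R -> R) (t du dv : R) : 0 < u t ^ 2 + v t ^ 2 ->
  is_derive u t du -> is_derive v t dv ->
  is_derive (fun s => u s / (u s ^ 2 + v s ^ 2)) t
   ((- du * (u t ^ 2 - v t ^ 2) - 2 * dv * u t * v t) / (u t ^ 2 + v t ^ 2) ^ 2) /\
  is_derive (fun s => - v s / (u s ^ 2 + v s ^ 2)) t
   ((- dv * (u t ^ 2 - v t ^ 2) + 2 * du * u t * v t) / (u t ^ 2 + v t ^ 2) ^ 2).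
Proof.
intros Hp H1 H2.
assert (E1 : Derive (fun x => u x) t = du) by exact (is_derive_unique _ _ _ H1).
assert (E2 : Derive (fun x => v x) t = dv) by exact (is_derive_unique _ _ _ H2).
assert (D1 : ex_derive u t) by (eexists; exact H1).
assert (D2 : ex_derive v t) by (eexists; exact H2).
split; (auto_derive; [repeat split; auto; simpl in Hp; lra|]; rewrite E1, E2; field;
  simpl in Hp; lra).
Qed.

Lemma RCder_inv (f : R -> C) (t : R) (l : C) :
  RCder f t l -> f t <> 0%C -> RCder (fun s => (/ f s)%C) t (- l / (f t * f t)).
Proof.
intros [H1 H2] Hn.
assert (Hp : 0 < Re (f t) ^ 2 + Im (f t) ^ 2).
{ rewrite <- Cmod2_alt; apply pow_lt, Cmod_gt_0, Hn. }
destruct (is_derive_inv_parts _ _ _ _ _ Hp H1 H2) as [H3 H4].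
apply RCder_eq with
  ((- Re l * (Re (f t) ^ 2 - Im (f t) ^ 2) - 2 * Im l * Re (f t) * Im (f t))
     / (Re (f t) ^ 2 + Im (f t) ^ 2) ^ 2,
   (- Im l * (Re (f t) ^ 2 - Im (f t) ^ 2) + 2 * Re l * Re (f t) * Im (f t))
     / (Re (f t) ^ 2 + Im (f t) ^ 2) ^ 2).
{ split; assumption. }
clear H1 H2 H3 H4 Hn.
destruct (f t) as [a b], l as [c d]; unfold Cdiv, Cinv, Cmult, Copp; simpl in *.
assert (Hs : 0 < a * a + b * b) by lra.
f_equal; field; split; try lra; intros Hz;
  apply (Rlt_irrefl 0), Rlt_le_trans with ((a * a + b * b) ^ 2);
  try (apply pow_lt; assumption); apply Req_le; rewrite <- Hz; ring.
Qed.

Lemma RCder_Cexp (f : R -> C) (t : R) (l : C) :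
  RCder f t l -> RCder (fun s => Cexp (f s)) t (l * Cexp (f t)).
Proof.
intros [H1 H2]; exact (is_derive_exp_cos_sin _ _ _ _ _ H1 H2).
Qed.

(** * Integrals of complex-valued functions *)

Definition is_CInt (f : R -> C) (a b : R) (l : C) : Prop :=
  is_RInt (fun t => Re (f t)) a b (Re l) /\ is_RInt (fun t => Im (f t)) a b (Im l).

(** Differentiability of f stands in for the continuity that integrability requires; every integrand
    below has it. *)
Lemma is_CInt_derive (F f : R -> C) (a b : R) : a <= b ->
  (forall t, a <= t <= b -> RCder F t (f t)) ->
  (forall t, a <= t <= b -> exists l, RCder f t l) ->
  is_CInt f a b (F b - F a)%C.
Proof.
intros Hab HF Hf; split.
- apply (is_RInt_derive (fun t => Re (F t)) (fun t => Re (f t)));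
    rewrite Rmin_left, Rmax_right by assumption; intros t Ht.
  + apply HF, Ht.
  + destruct (Hf t Ht) as [l [Hl _]]; apply (ex_derive_continuous (K := R_AbsRing) (V := R_NormedModule)); now exists (Re l).
- apply (is_RInt_derive (fun t => Im (F t)) (fun t => Im (f t)));
    rewrite Rmin_left, Rmax_right by assumption; intros t Ht.
  + apply HF, Ht.
  + destruct (Hf t Ht) as [l [_ Hl]]; apply (ex_derive_continuous (K := R_AbsRing) (V := R_NormedModule)); now exists (Im l).
Qed.

Lemma is_CInt_ex (f : R -> C) (a b : R) : a <= b ->
  (forall t, a <= t <= b -> exists l, RCder f t l) -> exists l, is_CInt f a b l.
Proof.
intros Hab Hf.
exists (RInt (fun t => Re (f t)) a b, RInt (fun t => Im (f t)) a b); split; apply (RInt_correct (V := R_CompleteNormedModule));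
  apply (ex_RInt_continuous (V := R_CompleteNormedModule)); rewrite Rmin_left, Rmax_right by assumption; intros t Ht;
  destruct (Hf t Ht) as [l [H1 H2]]; apply (ex_derive_continuous (K := R_AbsRing) (V := R_NormedModule)); eexists; eassumption.
Qed.

Lemma is_CInt_ext (f g : R -> C) (a b : R) (l : C) : a <= b ->
  (forall t, a <= t <= b -> f t = g t) -> is_CInt f a b l -> is_CInt g a b l.
Proof.
intros Hab E [H1 H2]; split; [apply is_RInt_ext with (2 := H1)|apply is_RInt_ext with (2 := H2)];
  rewrite Rmin_left, Rmax_right by assumption; intros t Ht; rewrite E by lra; reflexivity.
Qed.

Lemma is_CInt_unique (f : R -> C) (a b : R) (l m : C) :
  is_CInt f a b l -> is_CInt f a b m -> l = m.
Proof.
intros [H1 H2] [H3 H4]; apply (is_RInt_unique (V := R_CompleteNormedModule)) in H1, H2, H3, H4.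
rewrite (surjective_pairing l), (surjective_pairing m); unfold Re, Im in *; congruence.
Qed.

Lemma is_CInt_minus (f g : R -> C) (a b : R) (l m : C) :
  is_CInt f a b l -> is_CInt g a b m -> is_CInt (fun t => (f t - g t)%C) a b (l - m).
Proof.
intros [H1 H2] [H3 H4]; split.
- apply (is_RInt_minus (fun t => Re (f t)) (fun t => Re (g t))); assumption.
- apply (is_RInt_minus (fun t => Im (f t)) (fun t => Im (g t))); assumption.
Qed.

Lemma is_CInt_plus (f g : R -> C) (a b : R) (l m : C) :
  is_CInt f a b l -> is_CInt g a b m -> is_CInt (fun t => (f t + g t)%C) a b (l + m).
Proof.
intros [H1 H2] [H3 H4]; split.
- apply (is_RInt_plus (fun t => Re (f t)) (fun t => Re (g t))); assumption.
- apply (is_RInt_plus (fun t => Im (f t)) (fun t => Im (g t))); assumption.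
Qed.

Lemma is_CInt_scal (c : C) (f : R -> C) (a b : R) (l : C) :
  is_CInt f a b l -> is_CInt (fun t => (c * f t)%C) a b (c * l).
Proof.
intros [H1 H2]; split.
- apply (is_RInt_minus (fun t => Re c * Re (f t)) (fun t => Im c * Im (f t)));
    apply (is_RInt_scal (V := R_NormedModule)); assumption.
- apply (is_RInt_plus (fun t => Re c * Im (f t)) (fun t => Im c * Re (f t)));
    apply (is_RInt_scal (V := R_NormedModule)); assumption.
Qed.

Lemma is_CInt_const (c : C) (a b : R) : is_CInt (fun _ => c) a b (RtoC (b - a) * c).
Proof.
split; [rewrite re_scal_l|rewrite im_scal_l]; apply (is_RInt_const (V := R_NormedModule)).
Qed.

Lemma is_CInt_Csum (f : nat -> R -> C) (a b : R) (l : nat -> C) (n : nat) :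
  (forall k, is_CInt (f k) a b (l k)) ->
  is_CInt (fun t => Csum (fun k => f k t) n) a b (Csum l n).
Proof.
intros H; induction n as [|n IH]; simpl.
- assert (H0 := is_CInt_const 0 a b); rewrite Cmult_0_r in H0; exact H0.
- apply is_CInt_plus; [exact IH|apply H].
Qed.

(** Bounding the two components separately would cost a constant factor. As a vector integral in R x
    R with the Euclidean norm, which is [Cmod], the norm inequality loses nothing. *)
Lemma is_CInt_bound (f : R -> C) (g : R -> R) (a b : R) (l : C) (lg : R) : a <= b ->
  (forall t, a <= t <= b -> Cmod (f t) <= g t) ->
  is_CInt f a b l -> is_RInt g a b lg -> Cmod l <= lg.
Proof.
intros Hab H [H1 H2] Hg.
assert (E : Cmod l = @norm R_AbsRing C_R_NormedModule l).
{ unfold norm; simpl; unfold prod_norm, Cmod, norm; simpl; unfold abs; simpl.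
  f_equal; rewrite !Rmult_1_r; change (Rabs (fst l) * Rabs (fst l)) with (Rsqr (Rabs (fst l))).
  change (Rabs (snd l) * Rabs (snd l)) with (Rsqr (Rabs (snd l))).
  rewrite <- !Rsqr_abs; reflexivity. }
rewrite E.
apply (norm_RInt_le (V := C_R_NormedModule) f g a b l lg Hab); auto.
- intros t Ht; specialize (H t Ht).
  replace (norm (f t : C_R_NormedModule)) with (Cmod (f t)); [exact H|].
  unfold norm; simpl; unfold prod_norm, Cmod, norm; simpl; unfold abs; simpl.
  f_equal; rewrite !Rmult_1_r; change (Rabs (fst (f t)) * Rabs (fst (f t))) with (Rsqr (Rabs (fst (f t)))).
  change (Rabs (snd (f t)) * Rabs (snd (f t))) with (Rsqr (Rabs (snd (f t)))).
  rewrite <- !Rsqr_abs; reflexivity.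
- rewrite (surjective_pairing l); apply (is_RInt_fct_extend_pair (U := R_NormedModule) (V := R_NormedModule)); assumption.
Qed.

Lemma is_CInt_bound_const (f : R -> C) (a b : R) (l : C) (M : R) : a <= b ->
  (forall t, a <= t <= b -> Cmod (f t) <= M) -> is_CInt f a b l -> Cmod l <= (b - a) * M.
Proof.
intros Hab H Hl; apply (is_CInt_bound f (fun _ => M) a b l _ Hab H Hl).
apply (is_RInt_const (V := R_NormedModule)).
Qed.

(** * Polynomials, Cauchy's estimates and termwise differentiation *)

Lemma Cexp_plus (a b : C) : Cexp (a + b) = (Cexp a * Cexp b)%C.
Proof.
unfold Cexp, Cmult; simpl; unfold Re, Im; simpl.
rewrite exp_plus, cos_plus, sin_plus; f_equal; ring.
Qed.

Lemma Cexp_0 : Cexp 0 = RtoC 1.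
Proof. unfold Cexp, RtoC; simpl; rewrite exp_0, cos_0, sin_0; f_equal; ring. Qed.

Lemma Cmod_Cexp (z : C) : Cmod (Cexp z) = exp (Re z).
Proof.
unfold Cmod, Cexp; simpl.
replace (_ + _) with (exp (Re z) * exp (Re z) * (Rsqr (sin (Im z)) + Rsqr (cos (Im z)))) by (unfold Rsqr; ring).
rewrite sin2_cos2, Rmult_1_r; apply sqrt_square, Rlt_le, exp_pos.
Qed.

Lemma Cexp_RtoC (x : R) : Cexp (RtoC x) = RtoC (exp x).
Proof. unfold Cexp, RtoC; simpl; rewrite cos_0, sin_0; f_equal; ring. Qed.

Lemma Cexp_neq_0 (z : C) : Cexp z <> 0%C.
Proof. apply Cmod_gt_0; rewrite Cmod_Cexp; apply exp_pos. Qed.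

Lemma Cexp_opp (z : C) : Cexp (- z) = (/ Cexp z)%C.
Proof.
assert (H : (Cexp (- z) * Cexp z)%C = 1%C).
{ rewrite <- Cexp_plus; replace (- z + z)%C with (RtoC 0) by ring; apply Cexp_0. }
rewrite <- (Cmult_1_l (/ Cexp z)), <- H; field; apply Cexp_neq_0.
Qed.

Lemma Cexp_pow (z : C) (n : nat) : (Cexp z ^ n)%C = Cexp (RtoC (INR n) * z).
Proof.
induction n as [|n IH].
- simpl; rewrite Cmult_0_l; symmetry; apply Cexp_0.
- rewrite Cpow_S, IH, S_INR, RtoC_plus, <- Cexp_plus; f_equal; ring.
Qed.

(** * Roots of unity *)

Section RootsOfUnity.
Variable N : nat.
Hypothesis HN : (0 < N)%nat.

Definition unity_root : C := Cexp (0, 2 * PI / INR N).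

Lemma unity_root_pow (k : nat) :
  (unity_root ^ k)%C = Cexp (0, 2 * PI * INR k / INR N).
Proof.
unfold unity_root; rewrite Cexp_pow; f_equal; unfold Cmult, RtoC; simpl; f_equal;
  [ring|field; apply not_0_INR; lia].
Qed.

Lemma unity_root_N : (unity_root ^ N)%C = 1%C.
Proof.
rewrite unity_root_pow; replace (2 * PI * INR N / INR N) with (2 * PI) by (field; apply not_0_INR; lia).
unfold Cexp, RtoC; simpl; rewrite exp_0, cos_2PI, sin_2PI; f_equal; ring.
Qed.

Lemma unity_root_neq1 (k : nat) : (0 < k < N)%nat -> (unity_root ^ k)%C <> 1%C.
Proof.
intros Hk; rewrite unity_root_pow; unfold Cexp; simpl; rewrite exp_0; intros E.
injection E as E1 _.
assert (HN' : 0 < INR N) by (apply lt_0_INR; lia).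
assert (HkN : INR k < INR N) by (apply lt_INR; lia).
assert (Hk0 : 0 < INR k) by (apply lt_0_INR; lia).
(* Halving the angle: cos 2x = 1 - 2 sin^2 x, with x = pi q strictly between 0 and pi. *)
replace (2 * PI * INR k / INR N) with (2 * (PI * (INR k / INR N))) in E1 by (field; lra).
set (q := INR k / INR N) in *.
assert (Hq : 0 < q) by (now apply Rdiv_lt_0_compat).
assert (Hq1 : q < 1).
{ unfold q; apply Rmult_lt_reg_r with (INR N); [assumption|].
  unfold Rdiv; rewrite Rmult_assoc, Rinv_l, Rmult_1_r, Rmult_1_l; lra. }
assert (HP := PI_RGT_0).
assert (Hs : 0 < sin (PI * q)) by (apply sin_gt_0; nra).
rewrite cos_2a_sin in E1; nra.
Qed.

Lemma geom_Csum (q : C) (n : nat) :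
  ((q - 1) * Csum (fun j => q ^ j)%C n = q ^ n - 1)%C.
Proof.
induction n as [|n IH]; [simpl; Cring|].
cbn [Csum Cpow]; rewrite Cmult_plus_distr_l, IH; Cring.
Qed.

(** In the range 0 < e < 2N the only multiple of N is N itself. For any other e the power q of the
    root satisfies q^N = 1 and q <> 1, so its geometric sum is 0. *)
Lemma unity_root_sum (e : nat) : (0 < e < 2 * N)%nat ->
  Csum (fun j => (unity_root ^ e) ^ j)%C N = if Nat.eq_dec e N then RtoC (INR N) else 0%C.
Proof.
intros He; destruct (Nat.eq_dec e N) as [->|Hne].
- rewrite unity_root_N.
  assert (H : forall n, Csum (fun j => (1 ^ j)%C) n = RtoC (INR n)); [|apply H].
  induction n as [|n IH]; [reflexivity|].
  rewrite S_INR, RtoC_plus, <- IH; cbn [Csum]; now rewrite Cpow_1_l.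
- assert (Hq : (unity_root ^ e)%C <> 1%C).
  { destruct (Nat.le_gt_cases N e) as [Hl|Hl].
    - replace e with (N + (e - N))%nat by lia.
      rewrite Cpow_add_r, unity_root_N, Cmult_1_l; apply unity_root_neq1; lia.
    - apply unity_root_neq1; lia. }
  assert (H := geom_Csum (unity_root ^ e)%C N).
  rewrite <- Cpow_mult_r, (Nat.mul_comm e N), Cpow_mult_r, unity_root_N, Cpow_1_l in H.
  assert (Hq' : (unity_root ^ e - 1)%C <> 0%C) by (intros E; apply Hq, Ceq_minus, E).
  apply (f_equal (fun x => (/ (unity_root ^ e - 1) * x)%C)) in H.
  rewrite Cmult_assoc, Cinv_l, Cmult_1_l in H by assumption.
  rewrite H; Cring.
Qed.

Lemma Cmod_unity_root_pow (j : nat) : Cmod (unity_root ^ j) = 1.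
Proof. rewrite unity_root_pow, Cmod_Cexp; simpl; apply exp_0. Qed.

End RootsOfUnity.

(* Averaging over the roots of unity of order d + 1 extracts a coefficient,
   which gives Cauchy's estimate without any integral. *)
Lemma poly_coef_bound (d : nat) (c : nat -> C) (r B : R) : 0 < r ->
  (forall h, Cmod h <= r -> Cmod (Csum (fun k => c k * h ^ k)%C (S d)) <= B) ->
  forall i, (i <= d)%nat -> Cmod (c i) * r ^ i <= B.
Proof.
intros Hr H i Hi; set (N := S d); set (w := unity_root N).
assert (HN : (0 < N)%nat) by (unfold N; lia).
(* The weight w^((N - i) j) stands for w^(- i j) with a natural exponent. For k, i < N the exponent
   k + (N - i) lies strictly between 0 and 2N and equals N only for k = i. *)
assert (E : Csum (fun j => Csum (fun k => c k * (r * w ^ j) ^ k)%C N * w ^ ((N - i) * j))%C N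
  = (INR N * (c i * RtoC r ^ i))%C).
{ rewrite (Csum_ext _ (fun j => Csum (fun k => c k * RtoC r ^ k * (w ^ (k + (N - i))) ^ j)%C N)).
  - rewrite Csum_switch.
    rewrite (Csum_ext _ (fun k => if Nat.eq_dec k i then (INR N * (c i * RtoC r ^ i))%C else 0%C)).
    + apply Csum_single; unfold N; lia.
    + intros k Hk; rewrite Csum_scal; unfold w; rewrite unity_root_sum by lia.
      destruct (Nat.eq_dec (k + (N - i)) N), (Nat.eq_dec k i); try lia; subst; Cring.
  - intros j _; rewrite (Cmult_comm (Csum _ _)), <- Csum_scal; apply Csum_ext; intros k _.
    rewrite Cpow_mult_l, <- !Cpow_mult_r.
    replace ((k + (N - i)) * j)%nat with ((N - i) * j + j * k)%nat by lia.
    rewrite Cpow_add_r; Cring. }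
assert (Hb : Cmod (INR N * (c i * RtoC r ^ i))%C <= INR N * B).
{ rewrite <- E; apply Cmod_Csum_const; intros j _.
  rewrite Cmod_mult; unfold w at 2; rewrite Cmod_unity_root_pow, Rmult_1_r by assumption.
  apply H; rewrite Cmod_mult; unfold w; rewrite Cmod_unity_root_pow by assumption.
  rewrite Cmod_R, Rabs_pos_eq; lra. }
rewrite Cmod_mult, Cmod_R, Cmod_mult, Cmod_pow, Cmod_R in Hb.
assert (HNR : 0 < INR N) by (now apply lt_0_INR).
rewrite !Rabs_pos_eq in Hb by lra.
now apply Rmult_le_reg_l with (INR N).
Qed.

(** * Polynomials of bounded degree and their derivatives *)

Definition Cpoly (d : nat) (f : C -> C) : Prop :=
  exists c : nat -> C, forall x, f x = Csum (fun k => c k * x ^ k)%C (S d).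

Lemma Cpoly_ext (d : nat) (f g : C -> C) : (forall x, f x = g x) -> Cpoly d f -> Cpoly d g.
Proof. intros E [c H]; exists c; intros x; now rewrite <- E. Qed.

Lemma Cpoly_S (d : nat) (f : C -> C) : Cpoly d f -> Cpoly (S d) f.
Proof.
intros [c H]; exists (fun k => if le_dec k d then c k else 0%C); intros x; rewrite H.
set (g := fun k => ((if le_dec k d then c k else 0%C) * x ^ k)%C).
change (Csum (fun k => c k * x ^ k)%C (S d) = (Csum g (S d) + g (S d))%C).
rewrite (Csum_ext g (fun k => c k * x ^ k)%C (S d)).
- unfold g; destruct (le_dec (S d) d); [lia|]; Cring.
- intros k Hk; unfold g; destruct (le_dec k d); [reflexivity|lia].
Qed.

Lemma Cpoly_plus (d : nat) (f g : C -> C) :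
  Cpoly d f -> Cpoly d g -> Cpoly d (fun x => f x + g x)%C.
Proof.
intros [c H] [e H']; exists (fun k => c k + e k)%C; intros x; rewrite H, H', <- Csum_plus.
apply Csum_ext; intros; Cring.
Qed.

Lemma Cpoly_scal (d : nat) (a : C) (f : C -> C) : Cpoly d f -> Cpoly d (fun x => a * f x)%C.
Proof.
intros [c H]; exists (fun k => a * c k)%C; intros x; rewrite H, <- Csum_scal.
apply Csum_ext; intros; Cring.
Qed.

Lemma Cpoly_mulX (d : nat) (f : C -> C) : Cpoly d f -> Cpoly (S d) (fun x => x * f x)%C.
Proof.
intros [c H]; exists (fun k => match k with O => RtoC 0 | S j => c j end); intros x.
rewrite Csum_shift, H, <- Csum_scal, Cmult_0_l, Cplus_0_l.
apply Csum_ext; intros; cbn [Cpow]; Cring.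
Qed.

Lemma Cpoly_shift_pow (a : C) (d : nat) : Cpoly d (fun h => (a + h) ^ d)%C.
Proof.
induction d as [|d IH].
- exists (fun _ => 1%C); intros x; simpl; Cring.
- apply Cpoly_ext with (fun h => a * (a + h) ^ d + h * (a + h) ^ d)%C.
  + intros x; cbn [Cpow]; Cring.
  + apply Cpoly_plus; [apply Cpoly_S, Cpoly_scal, IH|apply Cpoly_mulX, IH].
Qed.

Lemma Cpoly_translate (d : nat) (f : C -> C) (a : C) :
  Cpoly d f -> Cpoly d (fun h => f (a + h)%C).
Proof.
intros [c H]; apply Cpoly_ext with (fun h => Csum (fun k => c k * (a + h) ^ k)%C (S d)).
{ intros x; now rewrite H. }
clear f H; induction d as [|d IH].
- exists c; intros x; simpl; Cring.
- apply Cpoly_plus; [apply Cpoly_S, IH|apply Cpoly_scal, Cpoly_shift_pow].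
Qed.

Lemma Cder_ext (f g : C -> C) (z l : C) : (forall x, f x = g x) -> Cder f z l -> Cder g z l.
Proof. intros E; apply Cder_ext_loc with 1; [lra|]; intros; apply E. Qed.

Lemma Cder_pow (n : nat) (z : C) : Cder (fun x => x ^ n)%C z (INR n * z ^ (pred n))%C.
Proof.
induction n as [|n IH].
- simpl; rewrite Cmult_0_l; apply (Cder_const 1).
- change (Cder (fun x => x * x ^ n)%C z (INR (S n) * z ^ pred (S n))%C).
  replace (INR (S n) * z ^ pred (S n))%C with (1 * z ^ n + z * (INR n * z ^ pred n))%C.
  + apply Cder_mult; [apply Cder_id|exact IH].
  + rewrite S_INR, RtoC_plus; destruct n as [|n]; [change (INR 0) with 0|]; cbn [pred Cpow]; Cring.
Qed.

Lemma Cder_scal (c : C) (f : C -> C) (z l : C) : Cder f z l -> Cder (fun x => c * f x)%C z (c * l).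
Proof.
intros H; replace (c * l)%C with (0 * f z + c * l)%C by ring.
apply Cder_mult; [apply Cder_const|exact H].
Qed.

Lemma Cpoly_Cder (c : nat -> C) (d : nat) (z : C) :
  Cder (fun x => Csum (fun k => c k * x ^ k)%C (S d)) z
    (Csum (fun k => c (S k) * INR (S k) * z ^ k)%C d).
Proof.
induction d as [|d IH].
- apply Cder_ext with (fun _ => c O); [intros x; simpl; Cring|apply Cder_const].
- apply Cder_plus; [exact IH|].
  rewrite <- Cmult_assoc; apply Cder_scal, (Cder_pow (S d)).
Qed.

Lemma Cpoly_derive (d : nat) (f : C -> C) : Cpoly d f -> Cpoly (pred d) (C_derive f).
Proof.
intros [c H].
assert (E : forall z, C_derive f z = Csum (fun k => c (S k) * INR (S k) * z ^ k)%C d).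
{ intros z; apply Cder_unique, Cder_ext with (2 := Cpoly_Cder c d z); intros x; now rewrite H. }
destruct d as [|d].
- exists (fun _ => 0%C); intros x; rewrite E; simpl; Cring.
- exists (fun k => c (S k) * INR (S k))%C; exact E.
Qed.

Lemma C_derive_n_S (f : C -> C) (n : nat) : C_derive_n f (S n) = C_derive_n (C_derive f) n.
Proof.
induction n as [|n IH]; [reflexivity|].
change (C_derive_n f (S (S n))) with (C_derive (C_derive_n f (S n))); now rewrite IH.
Qed.

Lemma Cpoly_derive_n_0 (n d : nat) (f : C -> C) (z : C) :
  Cpoly d f -> (d < n)%nat -> C_derive_n f n z = 0%C.
Proof.
assert (H0 : forall (n : nat) (f : C -> C), (forall x, f x = 0%C) -> forall z, C_derive_n f n z = 0%C).
{ induction n0 as [|n0 IH]; intros g Hg z0; [apply Hg|].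
  rewrite C_derive_n_S; apply IH; intros x; apply Cder_unique.
  apply Cder_ext with (fun _ => 0%C); [intros; now rewrite Hg|apply Cder_const]. }
revert n f z; induction d as [|d IH]; intros [|n] f z Hf Hn; try lia; rewrite C_derive_n_S.
- apply H0; intros x; destruct Hf as [c Hf]; apply Cder_unique.
  apply Cder_ext with (fun _ => c O); [intros y; rewrite Hf; simpl; Cring|apply Cder_const].
- apply (IH n); [apply (Cpoly_derive (S d)), Hf|lia].
Qed.

(** Cauchy's estimate bounds the i-th coefficient at z by B / r^i; for |h| <= r / 2 the terms of
    order at least two are dominated by a geometric series of ratio 1/2. The degree does not enter
    the constants, so the estimate can be summed over polynomials of unbounded degree. *)
Lemma poly_taylor (d : nat) (f : C -> C) (z : C) (r B : R) : 0 < r ->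
  Cpoly d f -> (forall h, Cmod h <= r -> Cmod (f (z + h)%C) <= B) ->
  exists l, Cmod l <= B / r /\
    forall h, Cmod h <= r / 2 -> Cmod (f (z + h) - f z - h * l)%C <= 2 * B / r ^ 2 * Cmod h ^ 2.
Proof.
intros Hr Hf HB.
(* The formal degree is raised to d + 1 so that the coefficient bound covers [c 1], the derivative,
   even when d = 0. *)
destruct (Cpoly_translate _ _ z (Cpoly_S _ _ Hf)) as [c Hc].
assert (Hb := poly_coef_bound (S d) c r B Hr).
assert (Hcb : forall i, (i <= S d)%nat -> Cmod (c i) <= B / r ^ i).
{ intros i Hi; assert (Hri : 0 < r ^ i) by (now apply pow_lt).
  apply Rmult_le_reg_r with (r ^ i); [assumption|].
  replace (B / r ^ i * r ^ i) with B by (field; lra).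
  apply Hb; [|assumption]; intros h Hh; rewrite <- Hc; now apply HB. }
assert (HB0 : 0 <= B).
{ eapply Rle_trans; [apply Cmod_ge_0|apply (HB 0%C)]; rewrite Cmod_0; lra. }
exists (c 1%nat); split; [rewrite <- (pow_1 r) at 1; apply Hcb; lia|].
intros h Hh.
assert (E : (f (z + h) - f z - h * c 1%nat)%C = Csum (fun k => c (S (S k)) * h ^ (S (S k)))%C d).
{ replace (f z) with (f (z + 0)%C) by (f_equal; ring).
  rewrite !Hc, !Csum_shift.
  rewrite (Csum_ext (fun k => c (S (S k)) * 0 ^ S (S k))%C (fun _ => 0%C)), Csum_zero
    by (intros; cbn [Cpow]; Cring).
  cbn [Cpow]; Cring. }
rewrite E.
set (q := Cmod h / r).
assert (Hq0 : 0 <= q) by (apply Rdiv_le_0_compat; [apply Cmod_ge_0|assumption]).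
assert (Hq : q <= 1 / 2).
{ unfold q; apply Rmult_le_reg_r with r; [assumption|]; field_simplify; lra. }
(* The bracket is the exact geometric sum of (1/2)^k over k < n, which makes the bound inductive. *)
assert (G : forall n, (n <= d)%nat ->
   Cmod (Csum (fun k => c (S (S k)) * h ^ S (S k))%C n) <= B * q ^ 2 * (2 - 2 * (1 / 2) ^ n)).
{ induction n as [|n IH]; intros Hn.
  - simpl; rewrite Cmod_0; apply Rmult_le_pos; [apply Rmult_le_pos; nra|lra].
  - cbn [Csum]; eapply Rle_trans; [apply Cmod_triangle|].
    rewrite Cmod_mult, Cmod_pow.
    assert (H1 : Cmod (c (S (S n))) * Cmod h ^ S (S n) <= B * q ^ 2 * q ^ n).
    { replace (B * q ^ 2 * q ^ n) with (B / r ^ S (S n) * Cmod h ^ S (S n)).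
      - apply Rmult_le_compat_r; [apply pow_le, Cmod_ge_0|apply Hcb; lia].
      - unfold q, Rdiv; rewrite !Rpow_mult_distr, !pow_inv; simpl; field.
        split; [apply pow_nonzero|]; lra. }
    specialize (IH ltac:(lia)).
    assert (Hqn : q ^ n <= (1 / 2) ^ n) by (now apply pow_incr).
    assert (HBq : 0 <= B * q ^ 2) by (apply Rmult_le_pos; nra).
    assert (H2 := Rmult_le_compat_l _ _ _ HBq Hqn).
    simpl ((1 / 2) ^ S n); lra. }
eapply Rle_trans; [apply G; lia|].
replace (2 * B / r ^ 2 * Cmod h ^ 2) with (B * q ^ 2 * 2) by (unfold q; field; lra).
apply Rmult_le_compat_l; [apply Rmult_le_pos; nra|].
assert (0 <= (1 / 2) ^ d) by (apply pow_le; lra); lra.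
Qed.

(** The Taylor remainder of p m is at most 2 B m / r^2 times |h|^2 and B is summable, so the
    remainder of F is quadratic as well. The bounds B m / r provide the majorant for the next
    differentiation. *)
Lemma termwise_derive (p : nat -> C -> C) (deg : nat -> nat) (B : nat -> R) (F : C -> C)
    (z : C) (r : R) : 0 < r -> ex_series B ->
  (forall m, Cpoly (deg m) (p m)) ->
  (forall m h, Cmod h <= r -> Cmod (p m (z + h)%C) <= B m) ->
  (forall h, Cmod h <= r -> Clim (Csum (fun m => p m (z + h)%C)) (F (z + h)%C)) ->
  Cder F z (C_derive F z) /\
  Clim (Csum (fun m => C_derive (p m) z)) (C_derive F z) /\
  forall m, Cmod (C_derive (p m) z) <= B m / r.
Proof.
intros Hr HB Hp Hb HF.
assert (T : forall m, Cmod (C_derive (p m) z) <= B m / r /\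
   forall h, Cmod h <= r / 2 ->
     Cmod (p m (z + h) - p m z - h * C_derive (p m) z)%C <= 2 * B m / r ^ 2 * Cmod h ^ 2).
{ intros m; destruct (poly_taylor _ _ z r (B m) Hr (Hp m) (Hb m)) as (l & Hl & H).
  rewrite (Cder_unique (p m) z l); [now split|].
  apply Cder_of_quadratic with (r / 2) (2 * B m / r ^ 2); [lra|].
  intros h Hh; apply H; lra. }
assert (HBr : ex_series (fun m => B m / r)) by (apply ex_series_scal_r with (c := / r); exact HB).
set (l := CSeries (fun m => C_derive (p m) z)).
assert (Hl : Clim (Csum (fun m => C_derive (p m) z)) l).
{ apply CSeries_correct with (2 := HBr); intros m; apply T. }
assert (HD : Cder F z l).
{ apply Cder_of_quadratic with (r / 2) (Series (fun m => 2 * B m / r ^ 2)); [lra|].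
  intros h Hh; rewrite <- Series_scal_r.
  apply Clim_Csum_bound with (fun m => (p m (z + h) - p m z - h * C_derive (p m) z)%C).
  - intros m; apply T; lra.
  - apply ex_series_scal_r with (c := Cmod h ^ 2).
    apply ex_series_ext with (fun m => (2 / r ^ 2) * B m); [intros m; match goal with |- ?a = ?b => change (@eq R a b) end; field; lra|].
    apply (ex_series_scal_l (K := R_AbsRing) (V := R_NormedModule) (2 / r ^ 2)); exact HB.
  - apply Clim_ext with (fun n => (Csum (fun m => p m (z + h)%C) n - Csum (fun m => p m z) n
       - h * Csum (fun m => C_derive (p m) z) n)%C).
    { intros n; induction n as [|n IH]; cbn [Csum]; [Cring|rewrite <- IH; Cring]. }
    apply Clim_minus; [apply Clim_minus|].
    + apply HF; lra.
    + assert (H0 := HF 0%C); rewrite Cmod_0 in H0; specialize (H0 (Rlt_le _ _ Hr)).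
      rewrite Cplus_0_r in H0; exact H0.
    + apply Clim_scal, Hl. }
rewrite (Cder_unique _ _ _ HD); split; [assumption|split; [assumption|intros m; apply T]].
Qed.

(** The induction strips the innermost derivative and passes to the disc of half radius: around each
    of its points a disc of radius r / 2 stays inside the original one, which yields the new
    majorant B m / (r / 2). *)
Lemma termwise_derive_n (n : nat) : forall (p : nat -> C -> C) (deg : nat -> nat)
    (B : nat -> R) (F : C -> C) (z : C) (r : R), 0 < r -> ex_series B ->
  (forall m, Cpoly (deg m) (p m)) ->
  (forall m h, Cmod h <= r -> Cmod (p m (z + h)%C) <= B m) ->
  (forall h, Cmod h <= r -> Clim (Csum (fun m => p m (z + h)%C)) (F (z + h)%C)) ->
  Cder (C_derive_n F n) z (C_derive_n F (S n) z) /\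
  Clim (Csum (fun m => C_derive_n (p m) n z)) (C_derive_n F n z).
Proof.
induction n as [|n IH]; intros p deg B F z r Hr HB Hp Hb HF.
- split; [apply (termwise_derive p deg B F z r Hr HB Hp Hb HF)|].
  assert (H0 := HF 0%C); rewrite Cmod_0 in H0; specialize (H0 (Rlt_le _ _ Hr)).
  rewrite Cplus_0_r in H0; exact H0.
- assert (Hstep : forall h, Cmod h <= r / 2 ->
    Clim (Csum (fun m => C_derive (p m) (z + h)%C)) (C_derive F (z + h)%C) /\
    forall m, Cmod (C_derive (p m) (z + h)%C) <= B m / (r / 2)).
  { intros h Hh; assert (Hr2 : 0 < r / 2) by lra.
    apply (termwise_derive p deg B F (z + h)%C (r / 2) Hr2 HB Hp).
    - intros m h' Hh'; rewrite <- Cplus_assoc; apply Hb.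
      eapply Rle_trans; [apply Cmod_triangle|]; lra.
    - intros h' Hh'; rewrite <- Cplus_assoc.
      apply Clim_ext with (Csum (fun m => p m (z + (h + h'))%C)).
      + intros k; apply Csum_ext; intros m _; now rewrite Cplus_assoc.
      + apply HF; eapply Rle_trans; [apply Cmod_triangle|]; lra. }
  rewrite (C_derive_n_S F n), (C_derive_n_S F (S n)).
  destruct (IH (fun m => C_derive (p m)) (fun m => pred (deg m)) (fun m => B m / (r / 2))
    (C_derive F) z (r / 2)) as [H1 H2].
  + lra.
  + apply ex_series_scal_r with (c := / (r / 2)); exact HB.
  + intros m; apply Cpoly_derive, Hp.
  + intros m h Hh; now apply Hstep.
  + intros h Hh; now apply Hstep.
  + split; [exact H1|].
    apply Clim_ext with (2 := H2); intros k; apply Csum_ext; intros m _.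
    now rewrite C_derive_n_S.
Qed.

(** * The logarithm and ratios of rising factorials *)

Lemma Cexp_Clog (z : C) : 0 < Re z -> Cexp (Clog z) = z.
Proof.
destruct z as [x y]; simpl; intros Hx.
(* This form cancels the factor 1 / sqrt (1 + (y / x)^2) in the cosine and sine of the
   arctangent. *)
assert (Hm : Cmod (x, y) = x * sqrt (1 + (y / x) ^ 2)).
{ unfold Cmod; simpl.
  rewrite <- (sqrt_square x) at 3 by lra.
  rewrite <- sqrt_mult; [|nra|assert (0 <= (y / x) ^ 2) by apply pow2_ge_0; lra].
  f_equal; field; lra. }
assert (Hs : 0 < sqrt (1 + (y / x) ^ 2)).
{ apply sqrt_lt_R0; assert (0 <= (y / x) ^ 2) by apply pow2_ge_0; lra. }
unfold Cexp, Clog; cbn [Re Im fst snd]; unfold Re, Im; simpl fst; simpl snd.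
rewrite exp_ln by (rewrite Hm; apply Rmult_lt_0_compat; lra).
rewrite cos_atan, sin_atan, Hm; replace (Rsqr (y / x)) with ((y / x) ^ 2) by (unfold Rsqr; ring).
f_equal; field; lra.
Qed.

Lemma Clog_RtoC (x : R) : 0 < x -> Clog (RtoC x) = RtoC (ln x).
Proof.
intros Hx; unfold Clog, RtoC; simpl; f_equal.
- change (x, 0) with (RtoC x); rewrite Cmod_R, Rabs_pos_eq by lra; reflexivity.
- unfold Rdiv; rewrite Rmult_0_l; apply atan_0.
Qed.

Lemma Clog_scal (a : R) (z : C) : 0 < a -> 0 < Re z -> Clog (a * z) = (ln a + Clog z)%C.
Proof.
intros Ha Hz; unfold Clog.
rewrite Cmod_mult, Cmod_R, Rabs_pos_eq, re_scal_l, im_scal_l by lra.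
assert (Hm : 0 < Cmod z) by (apply Cmod_gt_0, Re_neq0, Hz).
rewrite ln_mult by assumption.
unfold Cplus, RtoC; simpl; f_equal; rewrite Rplus_0_l; f_equal; field; lra.
Qed.

Lemma is_derive_log_parts (u v : R -> R) (t du dv : R) : 0 < u t ->
  is_derive u t du -> is_derive v t dv ->
  is_derive (fun s => ln (sqrt (u s ^ 2 + v s ^ 2))) t
    ((u t * du + v t * dv) / (u t ^ 2 + v t ^ 2)) /\
  is_derive (fun s => atan (v s / u s)) t
    ((u t * dv - v t * du) / (u t ^ 2 + v t ^ 2)).
Proof.
intros Hp H1 H2.
assert (E1 : Derive (fun x => u x) t = du) by exact (is_derive_unique _ _ _ H1).
assert (E2 : Derive (fun x => v x) t = dv) by exact (is_derive_unique _ _ _ H2).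
assert (D1 : ex_derive u t) by (eexists; exact H1).
assert (D2 : ex_derive v t) by (eexists; exact H2).
assert (Hq : 0 < u t * u t + v t * v t) by nra.
split; auto_derive.
- rewrite !Rmult_1_r; repeat first [split | assumption | now apply sqrt_lt_R0 | exact I].
- rewrite E1, E2, !Rmult_1_r.
  set (q := sqrt (u t * u t + v t * v t)).
  assert (Hqq : q * q = u t * u t + v t * v t) by (apply sqrt_sqrt; lra).
  assert (Hq0 : 0 < q) by (now apply sqrt_lt_R0).
  replace (u t ^ 2 + v t ^ 2) with (q * q) by (rewrite Hqq; ring).
  field; lra.
- repeat first [split | assumption | lra | exact I].
- rewrite E1, E2; field; repeat split; nra.
Qed.

Lemma RCder_Clog (f : R -> C) (t : R) (l : C) :
  RCder f t l -> 0 < Re (f t) -> RCder (fun s => Clog (f s)) t (l / f t).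
Proof.
intros [H1 H2] Hp.
destruct (is_derive_log_parts _ _ _ _ _ Hp H1 H2) as [H3 H4].
apply RCder_eq with
  ((Re (f t) * Re l + Im (f t) * Im l) / (Re (f t) ^ 2 + Im (f t) ^ 2),
   (Re (f t) * Im l - Im (f t) * Re l) / (Re (f t) ^ 2 + Im (f t) ^ 2)).
{ split; [|exact H4]. exact H3. }
clear H1 H2 H3 H4; destruct (f t) as [a b], l as [c d]; unfold Cdiv, Cinv, Cmult; simpl in *.
f_equal; field; nra.
Qed.

(** The remainder is the integral over t in [0, 1] of - t h^2 / (z (z + t h)), which is quadratic in
    h. *)
Lemma Cder_Clog (z : C) : 0 < Re z -> Cder Clog z (/ z).
Proof.
intros Hz; assert (Hz0 := Re_neq0 _ Hz); assert (Hm : 0 < Cmod z) by (now apply Cmod_gt_0).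
(* |h| < Re z keeps the segment from z to z + h in the right half-plane; |h| < |z| / 2 keeps it at
   distance at least |z| / 2 from 0, whence the constant 2 / |z|^2. *)
apply Cder_of_quadratic with (Rmin (Re z) (Cmod z / 2)) (2 / Cmod z ^ 2).
{ apply Rmin_case; lra. }
intros h Hh.
assert (Hh1 := Rlt_le_trans _ _ _ Hh (Rmin_l _ _)).
assert (Hh2 := Rlt_le_trans _ _ _ Hh (Rmin_r _ _)).
assert (Hre : forall t, 0 <= t <= 1 -> 0 < Re (z + RtoC t * h)).
{ intros t Ht; change (0 < Re z + Re (RtoC t * h)); rewrite re_scal_l.
  assert (H1 := re_le_Cmod h); apply Rabs_le_between in H1; nra. }
set (F := fun t : R => (Clog (z + RtoC t * h) - RtoC t * (h * / z))%C).
set (f := fun t : R => (h / (z + RtoC t * h) - h * / z)%C).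
assert (HI : is_CInt f 0 1 (F 1 - F 0)%C).
{ apply is_CInt_derive; [lra| |].
  - intros t Ht; unfold F, f; apply RCder_minus.
    + apply (RCder_Clog (fun t => (z + RtoC t * h)%C)); [apply RCder_affine|now apply Hre].
    + apply RCder_ext with (fun s => (0 + RtoC s * (h * / z))%C); [intros; Cring|apply RCder_affine].
  - intros t Ht; eexists; unfold f, Cdiv; apply RCder_minus; [|apply RCder_const].
    apply RCder_scal, RCder_inv; [apply RCder_affine|now apply Re_neq0, Hre]. }
replace (Clog (z + h) - Clog z - h * / z)%C with (F 1 - F 0)%C.
2: { unfold F; rewrite !Cmult_1_l, !Cmult_0_l, Cplus_0_r; Cring. }
eapply Rle_trans; [apply is_CInt_bound_const with (3 := HI) (M := 2 / Cmod z ^ 2 * Cmod h ^ 2); [lra|]|lra].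
intros t Ht; unfold f.
assert (Hn := Re_neq0 _ (Hre t Ht)).
replace (h / (z + RtoC t * h) - h * / z)%C with (- (RtoC t * (h * h) / (z * (z + RtoC t * h))))%C
  by (field; split; assumption).
rewrite Cmod_opp, Cmod_div, !Cmod_mult, Cmod_R, Rabs_pos_eq by (try lra; now apply Cmult_neq_0).
assert (Hb : Cmod z / 2 <= Cmod (z + RtoC t * h)).
{ assert (H1 := Cmod_triangle (z + RtoC t * h) (- (RtoC t * h))).
  rewrite Cmod_opp, Cmod_mult, Cmod_R, Rabs_pos_eq in H1 by lra.
  replace (z + RtoC t * h + - (RtoC t * h))%C with z in H1 by ring.
  assert (H2 := Cmod_ge_0 h); nra. }
assert (H0 := Cmod_ge_0 h).
apply Rmult_le_reg_r with (Cmod z * Cmod (z + RtoC t * h)); [apply Rmult_lt_0_compat; lra|].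
unfold Rdiv at 1; rewrite Rmult_assoc, Rinv_l, Rmult_1_r by (apply Rmult_integral_contrapositive_currified; lra).
apply Rle_trans with (Cmod h * Cmod h); [|].
- assert (0 <= Cmod h * Cmod h) by nra; nra.
- replace (2 / Cmod z ^ 2 * Cmod h ^ 2 * (Cmod z * Cmod (z + RtoC t * h))) with
    (Cmod h * Cmod h * (2 * Cmod (z + RtoC t * h) / Cmod z)) by (field; lra).
  rewrite <- (Rmult_1_r (Cmod h * Cmod h)) at 1; apply Rmult_le_compat_l; [nra|].
  apply Rmult_le_reg_r with (Cmod z); [assumption|].
  unfold Rdiv; rewrite Rmult_assoc, Rinv_l by lra; lra.
Qed.

(** * Rising factorials and bounds for their ratios *)

Definition rising (x : C) (m : nat) : C := Cprod (fun k => (x + INR k)%C) m.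

Lemma rising_S (x : C) (m : nat) : rising x (S m) = (rising x m * (x + INR m))%C.
Proof. reflexivity. Qed.

Lemma Re_plus_INR (w : C) (k : nat) : Re (w + INR k) = Re w + INR k.
Proof. reflexivity. Qed.

Lemma plus_INR_neq0 (w : C) (k : nat) : 0 < Re w -> (w + INR k)%C <> 0%C.
Proof. intros H; apply Re_neq0; rewrite Re_plus_INR; assert (H0 := pos_INR k); lra. Qed.

Lemma rising_neq0 (w : C) (m : nat) : 0 < Re w -> rising w m <> 0%C.
Proof.
intros H; induction m as [|m IH]; [exact C1_nz|].
rewrite rising_S; apply Cmult_neq_0; [assumption|now apply plus_INR_neq0].
Qed.

(* The series telescopes, since d u_k / k = u_k - u_{k+1}. *)
Lemma product_decay (u : nat -> R) (d : R) (k0 : nat) : 0 < d -> (0 < k0)%nat ->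
  (forall k, 0 <= u k) ->
  (forall k, (k0 <= k)%nat -> u (S k) = (1 - d / INR k) * u k) ->
  is_lim_seq u 0 /\ ex_series (fun m => u (S m) / INR (S m)).
Proof.
intros Hd Hk0 Hu Hrec.
(* Decay like k^(-d), factor by factor: 1 - d / k <= 1 - d (ln (k + 1) - ln k) <= (k / (k +
   1))^d. *)
assert (Hle : forall m, u (m + k0)%nat <= u k0 * exp (d * (ln (INR k0) - ln (INR (m + k0))))).
{ induction m as [|m IH].
  - simpl; rewrite Rminus_diag, Rmult_0_r, exp_0; lra.
  - simpl (S m + k0)%nat; rewrite Hrec by lia.
    set (k := (m + k0)%nat) in *.
    assert (Hk : 0 < INR k) by (apply lt_0_INR; unfold k; lia).
    assert (H1 : 1 - d / INR k <= exp (d * (ln (INR k) - ln (INR (S k))))).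
    { assert (H2 := exp_ineq1_le (d * (ln (INR k) - ln (INR (S k))))).
      assert (H3 : ln (INR (S k)) - ln (INR k) <= / INR k).
      { rewrite <- ln_div by (try rewrite S_INR; lra).
        replace (INR (S k) / INR k) with (1 + / INR k) by (rewrite S_INR; field; lra).
        rewrite <- (ln_exp (/ INR k)) at 2; apply ln_le; [|apply exp_ineq1_le].
        assert (0 < / INR k) by (now apply Rinv_0_lt_compat); lra. }
      unfold Rdiv; nra. }
    apply Rle_trans with (exp (d * (ln (INR k) - ln (INR (S k)))) * u k).
    + apply Rmult_le_compat_r; [apply Hu|exact H1].
    + eapply Rle_trans; [apply Rmult_le_compat_l; [apply Rlt_le, exp_pos|exact IH]|].
      apply Req_le; rewrite Rmult_comm, Rmult_assoc, <- exp_plus; do 2 f_equal; ring. }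
assert (Hlim : is_lim_seq u 0).
{ apply (is_lim_seq_incr_n _ k0).
  apply is_lim_seq_squeeze0 with (1 := fun m => conj (Hu _) (Hle m)).
  replace 0 with (u k0 * 0) by ring.
  apply (is_lim_seq_scal_l _ _ 0).
  apply (is_lim_comp_seq exp _ m_infty 0); [apply is_lim_exp_m| |].
  - exists O; intros n _; discriminate.
  - replace m_infty with (Rbar_mult d m_infty).
    2: { simpl; case Rle_dec; intros; [|lra]; case Rle_lt_or_eq_dec; intros; [reflexivity|lra]. }
    apply is_lim_seq_scal_l.
    apply (is_lim_seq_minus (fun _ => ln (INR k0)) _ (ln (INR k0)) p_infty m_infty).
    + apply is_lim_seq_const.
    + apply (is_lim_comp_seq ln _ p_infty p_infty); [apply is_lim_ln_p| |].
      * exists O; intros n _; discriminate.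
      * apply (is_lim_seq_incr_n INR k0), is_lim_seq_INR.
    + reflexivity. }
split; [assumption|].
(* The first term kept is u k0 / k0, the first one to which the recurrence applies. *)
apply (ex_series_incr_n (K := R_AbsRing) (V := R_NormedModule) _ (pred k0)).
exists (/ d * (u k0 - 0)).
cut (is_lim_seq (sum_n (fun k => u (S (pred k0 + k)) / INR (S (pred k0 + k)))) (/ d * (u k0 - 0)));
  [exact (fun H => H)|].
apply (is_lim_seq_ext (fun n => / d * (u k0 - u (S n + k0)%nat))).
- induction n as [|n IH].
  + rewrite sum_O; replace (S (pred k0 + 0)) with k0 by lia.
    simpl (1 + k0)%nat; rewrite Hrec by lia; field; split; [apply not_0_INR; lia|lra].
  + rewrite sum_Sn, <- IH; change plus with Rplus.
    replace (S (pred k0 + S n)) with (S n + k0)%nat by lia.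
    change (S (S n) + k0)%nat with (S (S n + k0)); rewrite (Hrec (S n + k0)%nat) by lia.
    field; split; [apply not_0_INR; lia|lra].
- apply (is_lim_seq_scal_l _ (/ d) (u k0 - 0)), is_lim_seq_minus'; [apply is_lim_seq_const|].
  apply (is_lim_seq_incr_n u k0) in Hlim; apply (is_lim_seq_incr_1 (fun n => u (n + k0)%nat)) in Hlim; exact Hlim.
Qed.

Fixpoint Rprod (v : nat -> R) (n : nat) : R :=
  match n with O => 1 | S n' => Rprod v n' * v n' end.

(* Once k is large, |x + k| <= (1 - d / (2k)) |w + k| uniformly in x. *)
Lemma rising_ratio_bound (w : C) (rho d : R) : 0 < Re w -> 0 < d ->
  exists u : nat -> R, (forall m, 0 <= u m) /\ is_lim_seq u 0 /\
    ex_series (fun m => u (S m) / INR (S m)) /\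
    forall x m, Cmod x <= rho -> Re x <= Re w - d -> Cmod (rising x m) <= u m * Cmod (rising w m).
Proof.
intros Hw Hd.
set (A := Cmod w); assert (HA : 0 <= A) by apply Cmod_ge_0.
(* For k >= K the term d k outweighs all lower-order terms in the comparison of squares below; the
   summand d + 1 makes 1 - d / (2k) nonnegative and k at least 1. *)
set (K := (rho ^ 2 + 2 * d * A + d * A ^ 2) / d + d + 1).
destruct (nfloor_ex (Rmax K 0)) as [k1 [_ Hk1]]; [apply Rmax_r|].
set (k0 := S k1).
assert (Hk0 : forall k, (k0 <= k)%nat -> K <= INR k).
{ intros k Hk; apply le_INR in Hk; unfold k0 in Hk; rewrite S_INR in Hk.
  assert (H := Rmax_l K 0); lra. }
assert (HK1 : d + 1 <= K).
{ unfold K; assert (0 <= (rho ^ 2 + 2 * d * A + d * A ^ 2) / d); [|lra].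
  apply Rdiv_le_0_compat; [|assumption]. assert (0 <= rho ^ 2) by apply pow2_ge_0.
  assert (0 <= A ^ 2) by apply pow2_ge_0. nra. }
(* The finitely many indices below k0 get the crude factor (rho + k) / |w + k|; the absolute value
   keeps it nonnegative before any x with |x| <= rho is given. *)
set (v := fun k => if le_dec k0 k then 1 - d / 2 / INR k else Rabs (rho + INR k) / Cmod (w + INR k)).
assert (Hv : forall k, 0 <= v k).
{ intros k; unfold v; destruct (le_dec k0 k) as [Hk|Hk].
  - specialize (Hk0 k Hk); assert (d / 2 / INR k <= 1); [|lra].
    apply Rmult_le_reg_r with (INR k); [lra|]; unfold Rdiv; rewrite Rmult_assoc, Rinv_l; lra.
  - apply Rdiv_le_0_compat; [apply Rabs_pos|]. apply Cmod_gt_0, plus_INR_neq0, Hw. }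
exists (Rprod v).
assert (Hu : forall m, 0 <= Rprod v m).
{ induction m as [|m IH]; simpl; [lra|now apply Rmult_le_pos]. }
destruct (product_decay (Rprod v) (d / 2) k0) as [H1 H2]; [lra|unfold k0; lia|assumption| |].
{ intros k Hk; simpl; unfold v at 2; destruct (le_dec k0 k); [ring|lia]. }
split; [assumption|split; [assumption|split; [assumption|]]].
intros x m Hx Hxw; induction m as [|m IH]; [change (Cmod 1 <= 1 * Cmod 1); lra|].
rewrite !rising_S, !Cmod_mult; cbn [Rprod].
replace (Rprod v m * v m * (Cmod (rising w m) * Cmod (w + INR m))) with
  ((Rprod v m * Cmod (rising w m)) * (v m * Cmod (w + INR m))) by ring.
apply Rmult_le_compat; try apply Cmod_ge_0; [exact IH|]; clear IH.
assert (Hwm : 0 < Cmod (w + INR m)) by (apply Cmod_gt_0, plus_INR_neq0, Hw).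
assert (Hm0 := pos_INR m).
assert (Hr : 0 <= rho) by (assert (H := Cmod_ge_0 x); lra).
unfold v; destruct (le_dec k0 m) as [Hm|Hm].
- specialize (Hk0 m Hm); assert (Hm1 : 0 < INR m) by lra.
  assert (Hq : 0 <= 1 - d / 2 / INR m).
  { specialize (Hv m); unfold v in Hv; destruct (le_dec k0 m); [exact Hv|lia]. }
  apply Rsqr_incr_0_var; [|now apply Rmult_le_pos, Rlt_le].
  rewrite Rsqr_mult; rewrite !Rsqr_pow2, !Cmod2_alt, !Re_plus_INR.
  replace (Im (x + INR m)) with (Im x) by (simpl; unfold Im; ring).
  replace (Im (w + INR m)) with (Im w) by (simpl; unfold Im; ring).
  assert (Hx2 : Re x ^ 2 + Im x ^ 2 <= rho ^ 2).
  { rewrite <- Cmod2_alt; apply pow_incr; split; [apply Cmod_ge_0|assumption]. }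
  assert (Hw2 : Re w ^ 2 + Im w ^ 2 = A ^ 2) by (unfold A; now rewrite Cmod2_alt).
  assert (HwA : Re w <= A) by apply Re_le_Cmod.
  set (k := INR m) in *.
  (* As Re x <= Re w - d, replacing w by x lowers |w + k|^2 by at least 2kd - rho^2. This must cover
     the loss (d / k) |w + k|^2 incurred in (1 - d / (2k))^2 |w + k|^2. *)
  assert (HQ : d / k * ((Re w + k) ^ 2 + Im w ^ 2) <= 2 * k * d - rho ^ 2).
  { apply Rmult_le_reg_r with k; [assumption|].
    replace (d / k * ((Re w + k) ^ 2 + Im w ^ 2) * k) with
      (d * (Re w ^ 2 + Im w ^ 2 + 2 * Re w * k + k ^ 2)) by (field; lra).
    rewrite Hw2.
    assert (HKd : rho ^ 2 + 2 * d * A + d * A ^ 2 <= d * k).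
    { apply Rmult_le_reg_r with (/ d); [now apply Rinv_0_lt_compat|].
      replace (d * k * / d) with k by (field; lra).
      change ((rho ^ 2 + 2 * d * A + d * A ^ 2) / d <= k). unfold K in Hk0; lra. }
    assert (Hk2 : k * (rho ^ 2 + 2 * d * A + d * A ^ 2) <= k * (d * k)) by (apply Rmult_le_compat_l; lra).
    assert (H3 : d * A ^ 2 * 1 <= d * A ^ 2 * k).
    { apply Rmult_le_compat_l; [apply Rmult_le_pos; [lra|apply pow2_ge_0]|lra]. }
    assert (H4 : d * (Re w * k) <= d * (A * k)).
    { apply Rmult_le_compat_l; [lra|apply Rmult_le_compat_r; lra]. }
    nra. }
  set (Q := (Re w + k) ^ 2 + Im w ^ 2) in *.
  assert (H5 : (Re x + k) ^ 2 + Im x ^ 2 <= Q + rho ^ 2 - 2 * k * d).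
  { unfold Q; assert (k * Re x <= k * (Re w - d)) by (apply Rmult_le_compat_l; lra).
    assert (0 <= Re w ^ 2 + Im w ^ 2) by (rewrite Hw2; apply pow2_ge_0). nra. }
  assert (H6 : (1 - d / 2 / k) ^ 2 * Q = Q - d / k * Q + (d / 2 / k) ^ 2 * Q) by (field; lra).
  assert (H7 : 0 <= (d / 2 / k) ^ 2 * Q).
  { apply Rmult_le_pos; [apply pow2_ge_0|]; unfold Q. assert (0 <= (Re w + k) ^ 2) by apply pow2_ge_0.
    assert (0 <= Im w ^ 2) by apply pow2_ge_0. lra. }
  lra.
- unfold Rdiv; rewrite Rmult_assoc, Rinv_l, Rmult_1_r by lra.
  rewrite Rabs_pos_eq by lra.
  eapply Rle_trans; [apply Cmod_triangle|]; rewrite Cmod_R, Rabs_pos_eq; lra.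
Qed.

(** * The Binet series and its difference equation *)

Ltac Cnz :=
  repeat match goal with |- _ /\ _ => split end; try assumption;
  try (let E := fresh in intros E; apply RtoC_inj in E; lra).

(** Reflecting x to -x turns the rising product into the falling one with sign (-1)^m; together with
    the (-1)^k of (-x)^k this leaves (-1)^(m - k). *)
Lemma rising_stirling (m : nat) (x : C) :
  rising x m = Csum (fun k => (- (1)) ^ (m - k) * IZR (stirling1 m k) * x ^ k)%C (S m).
Proof.
assert (H : rising x m = ((- (1)) ^ m * Cprod (fun k => (- x - INR k)%C) m)%C).
{ induction m as [|m IH]; [cbn; Cring|]. rewrite rising_S, IH; cbn [Cprod Cpow]; Cring. }
rewrite H, stirling1_spec, sum_n_Csum, <- Csum_scal; apply Csum_ext; intros k Hk.
replace (- x)%C with (- (1) * x)%C by ring; rewrite Cpow_mult_l.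
replace m with ((m - k) + k)%nat at 1 by lia; rewrite Cpow_add_r.
assert (E : ((- (1)) ^ k * (- (1)) ^ k)%C = 1%C).
{ rewrite <- Cpow_mult_l; replace (- (1) * - (1))%C with (RtoC 1) by ring; apply Cpow_1_l. }
transitivity (((- (1)) ^ k * (- (1)) ^ k) * ((- (1)) ^ (m - k) * IZR (stirling1 m k) * x ^ k))%C; [Cring|].
rewrite E; Cring.
Qed.

Lemma sum_n_m_1_Csum (f : nat -> C) (m : nat) : sum_n_m f 1 m = Csum (fun j => f (S j)) m.
Proof.
induction m as [|m IH]; [rewrite sum_n_m_zero by lia; reflexivity|].
rewrite sum_n_Sm, IH by lia; reflexivity.
Qed.

Lemma RCder_one_sub (a : C) (t : R) : RCder (fun s => (a - RtoC s)%C) t (- (1)).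
Proof.
apply RCder_ext with (fun s => (a + RtoC s * - (1))%C); [intros; Cring|apply RCder_affine].
Qed.

(** 1/2 - t = (a - t) + (1/2 - a) splits the integrand into two powers of a - t, one for each
    summand in the braces defining b_m. *)
Lemma is_CInt_shift_pow (a : C) (k : nat) :
  is_CInt (fun t => ((1 / 2 - RtoC t) * (a - RtoC t) ^ k)%C) 0 1
    ((a ^ (k + 2) - (a - 1) ^ (k + 2)) / INR (k + 2)
     + (1 / 2 - a) * (a ^ (k + 1) - (a - 1) ^ (k + 1)) / INR (k + 1))%C.
Proof.
assert (N1 : RtoC (INR (S k)) <> 0%C) by (intros E; apply RtoC_inj in E; revert E; apply not_0_INR; lia).
assert (N2 : RtoC (INR (S (S k))) <> 0%C) by (intros E; apply RtoC_inj in E; revert E; apply not_0_INR; lia).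
set (F := fun t : R => (- / INR (S (S k)) * (a - RtoC t) ^ S (S k)
   + - (1 / 2 - a) / INR (S k) * (a - RtoC t) ^ S k)%C).
replace (k + 2)%nat with (S (S k)) by lia; replace (k + 1)%nat with (S k) by lia.
match goal with |- is_CInt _ _ _ ?l => replace l with (F 1 - F 0)%C end.
2: { unfold F; replace (a - RtoC 0)%C with a by ring; generalize (a ^ S (S k))%C, (a ^ S k)%C,
       ((a - 1) ^ S (S k))%C, ((a - 1) ^ S k)%C; intros; field; Cnz. }
apply is_CInt_derive; [lra| |].
- intros t _; unfold F; eapply RCder_eq.
  + apply RCder_plus; apply RCder_scal, RCder_pow, RCder_one_sub.
  + cbn [Cpow]; field; Cnz.
- intros t _; destruct k as [|k].
  + eexists; apply RCder_mult; [apply RCder_one_sub|apply (RCder_const 1)].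
  + eexists; apply RCder_mult; [apply RCder_one_sub|apply RCder_pow, RCder_one_sub].
Qed.

Lemma stirling1_0 (m : nat) : stirling1 (S m) 0 = 0%Z.
Proof. induction m as [|m IH]; [reflexivity|]. cbn [stirling1] in *; rewrite IH; lia. Qed.

Lemma INR_C_neq0 (n : nat) : RtoC (INR (S n)) <> 0%C.
Proof. intros E; apply RtoC_inj in E; revert E; apply not_0_INR; lia. Qed.

(** The integral form of b_m under x = a - t, multiplied by m so that m = 0 is included. *)
Lemma binet_poly_int (m : nat) (a : C) :
  is_CInt (fun t => ((1 / 2 - RtoC t) * rising (a - RtoC t) m)%C) 0 1 (INR m * binet_poly m a)%C.
Proof.
set (J := fun k : nat => ((a ^ (k + 2) - (a - 1) ^ (k + 2)) / INR (k + 2)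
     + (1 / 2 - a) * (a ^ (k + 1) - (a - 1) ^ (k + 1)) / INR (k + 1))%C).
set (s := fun k : nat => ((- (1)) ^ (m - k) * IZR (stirling1 m k))%C).
assert (E : (INR m * binet_poly m a)%C = Csum (fun k => (s k * J k)%C) (S m)).
{ destruct m as [|m].
  (* For m = 0 both sides vanish: 1/2 - t has integral 0 over [0, 1], in accordance with b_0 = 0. *)
  - unfold J, s, binet_poly; cbn [INR Csum Nat.add Nat.sub Cpow stirling1].
    replace (1 + 1) with 2 by ring; field; Cnz.
  - unfold binet_poly; rewrite sum_n_m_1_Csum, (Csum_shift (fun k => (s k * J k)%C)).
    (* [binet_poly] sums from k = 1; the term k = 0 may be added since the constant coefficient of
       the product is 0. *)
    replace (s O) with (RtoC 0) by (unfold s; rewrite stirling1_0; Cring).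
    rewrite Cmult_0_l, Cplus_0_l, Cmult_assoc.
    replace (INR (S m) * (1 / INR (S m)))%C with (RtoC 1) by (field; apply INR_C_neq0).
    rewrite Cmult_1_l; apply Csum_ext; intros k _; unfold J, s; Cring. }
rewrite E.
apply is_CInt_ext with (fun t => Csum (fun k => (s k * ((1 / 2 - RtoC t) * (a - RtoC t) ^ k))%C) (S m)).
- lra.
- intros t _; rewrite rising_stirling, <- Csum_scal; apply Csum_ext; intros k _; unfold s; Cring.
- apply is_CInt_Csum; intros k; apply is_CInt_scal, is_CInt_shift_pow.
Qed.

(** The coefficients of the powers of a depend differentiably on t, so that integration over t can
    act on each of them. *)
Lemma rising_coefs (m : nat) : exists c : nat -> R -> C,
  (forall k t, exists l, RCder (c k) t l) /\
  forall (a : C) t, rising (a - RtoC t) m = Csum (fun k => c k t * a ^ k)%C (S m).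
Proof.
induction m as [|m (c & Hc & H)].
- exists (fun _ _ => 1%C); split; [intros; eexists; apply RCder_const|].
  intros; cbn; Cring.
- exists (fun k t => ((if le_dec k m then (INR m - RtoC t) * c k t else 0)
     + match k with O => 0 | S j => c j t end)%C); split.
  + intros k t.
    assert (H1 : exists l, RCder (fun t => if le_dec k m then (INR m - RtoC t) * c k t else 0)%C t l).
    { destruct (le_dec k m) as [Hk|Hk]; [|eexists; apply RCder_const].
      destruct (Hc k t) as [l Hl]; eexists; apply RCder_mult; [apply RCder_one_sub|exact Hl]. }
    assert (H2 : exists l, RCder (fun t => match k with O => RtoC 0 | S j => c j t end) t l).
    { destruct k; [eexists; apply RCder_const|apply Hc]. }
    destruct H1 as [l1 H1], H2 as [l2 H2]; eexists; exact (RCder_plus _ _ _ _ _ H1 H2).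
  + intros a t; rewrite rising_S, H.
    rewrite (Csum_ext _ (fun k => ((if le_dec k m then (INR m - RtoC t) * c k t else 0) * a ^ k)
      + (match k with O => RtoC 0 | S j => c j t end) * a ^ k)%C (S (S m)))
      by (intros; Cring).
    rewrite Csum_plus, (Csum_shift (fun k => (match k with O => RtoC 0 | S j => c j t end * a ^ k)%C)).
    rewrite (Csum_ext (fun k => (c k t * a ^ S k)%C) (fun k => (a * (c k t * a ^ k))%C))
      by (intros; cbn [Cpow]; Cring).
    rewrite Csum_scal.
    set (g := fun k => ((if le_dec k m then (INR m - RtoC t) * c k t else 0) * a ^ k)%C).
    change (Csum g (S (S m))) with (Csum g (S m) + g (S m))%C.
    replace (g (S m)) with (RtoC 0) by (unfold g; destruct (le_dec (S m) m); [lia|Cring]).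
    rewrite (Csum_ext g (fun k => ((INR m - RtoC t) * (c k t * a ^ k))%C) (S m)).
    2: { intros k Hk; unfold g; destruct (le_dec k m); [Cring|lia]. }
    rewrite Csum_scal; Cring.
Qed.

(** The defining formula contains terms of degree m + 1; in the integral form a enters only through
    a product of m factors. The sharper degree is what makes the n-th derivative of b_m vanish for m
    < n. *)
Lemma Cpoly_binet_poly (m : nat) : Cpoly m (binet_poly m).
Proof.
destruct m as [|m]; [exists (fun _ => 0%C); intros x; cbn; Cring|].
destruct (rising_coefs (S m)) as (c & Hc & H).
assert (Hl : forall k, exists l, is_CInt (fun t => ((1 / 2 - RtoC t) * c k t)%C) 0 1 l).
{ intros k; apply is_CInt_ex; [lra|]; intros t _; destruct (Hc k t) as [l Hl].
  eexists; apply RCder_mult; [apply RCder_one_sub|exact Hl]. }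
set (l := fun k => proj1_sig (constructive_indefinite_description _ (Hl k))).
assert (Hl' : forall k, is_CInt (fun t => ((1 / 2 - RtoC t) * c k t)%C) 0 1 (l k)).
{ intros k; unfold l; apply proj2_sig. }
exists (fun k => (/ INR (S m) * l k)%C); intros a.
apply eq_trans with (/ INR (S m) * (INR (S m) * binet_poly (S m) a))%C.
{ rewrite Cmult_assoc, Cinv_l, Cmult_1_l; [reflexivity|apply INR_C_neq0]. }
rewrite (is_CInt_unique _ _ _ _ (Csum (fun k => a ^ k * l k)%C (S (S m))) (binet_poly_int (S m) a)).
- rewrite <- Csum_scal; apply Csum_ext; intros; Cring.
- apply is_CInt_ext with (fun t => Csum (fun k => (a ^ k * ((1 / 2 - RtoC t) * c k t))%C) (S (S m))).
  + lra.
  + intros t _; rewrite H, <- Csum_scal; apply Csum_ext; intros; Cring.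
  + apply is_CInt_Csum; intros k; apply is_CInt_scal, Hl'.
Qed.

Lemma Cmod_half_minus (t : R) : 0 <= t <= 1 -> Cmod (1 / 2 - RtoC t) <= 1.
Proof.
intros Ht; replace (1 / 2 - RtoC t)%C with (RtoC (1 / 2 - t)).
- rewrite Cmod_R; apply Rabs_le; lra.
- rewrite RtoC_minus, RtoC_div by lra; reflexivity.
Qed.

(** The bound u m on the ratio of rising factorials tends to 0 but may fail to be summable; the
    factor 1 / m in b_m makes it so. *)
Lemma binet_poly_bound (w : C) (rho d : R) : 0 < Re w -> 0 < d ->
  exists B : nat -> R, ex_series B /\ forall a m, Cmod a <= rho -> Re a <= Re w - d ->
    Cmod (binet_poly m a / rising w m)%C <= B m.
Proof.
(* The radius is rho + 1 because |a - t| <= |a| + 1 for t in [0, 1]. *)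
intros Hw Hd; destruct (rising_ratio_bound w (rho + 1) d Hw Hd) as (u & Hu & _ & HS & H).
exists (fun m => match m with O => 0 | S _ => u m / INR m end); split.
- apply ex_series_incr_1; exact HS.
- intros a [|m] Ha Haw.
  + replace (binet_poly 0 a / rising w 0)%C with (RtoC 0); [rewrite Cmod_0; lra|].
    cbn; field; exact C1_nz.
  + assert (Hr : 0 < Cmod (rising w (S m))) by (apply Cmod_gt_0, rising_neq0, Hw).
    assert (Hm : 0 < INR (S m)) by (apply lt_0_INR; lia).
    rewrite Cmod_div by (now apply rising_neq0).
    assert (HI : Cmod (INR (S m) * binet_poly (S m) a) <= (1 - 0) * (u (S m) * Cmod (rising w (S m)))).
    { apply is_CInt_bound_const with (3 := binet_poly_int (S m) a); [lra|].
      intros t Ht; rewrite Cmod_mult.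
      assert (H1 := Cmod_half_minus t Ht); assert (H2 := Cmod_ge_0 (1 / 2 - RtoC t)).
      assert (H3 : Cmod (rising (a - RtoC t) (S m)) <= u (S m) * Cmod (rising w (S m))).
      { apply H.
        - eapply Rle_trans; [apply Cmod_triangle|]; rewrite Cmod_opp, Cmod_R, Rabs_pos_eq; lra.
        - change (Re a + - t <= Re w - d); lra. }
      assert (H4 := Cmod_ge_0 (rising (a - RtoC t) (S m))); nra. }
    rewrite Cmod_mult, Cmod_R, Rabs_pos_eq in HI by lra.
    apply Rmult_le_reg_r with (INR (S m) * Cmod (rising w (S m))); [now apply Rmult_lt_0_compat|].
    replace (u (S m) / INR (S m) * (INR (S m) * Cmod (rising w (S m)))) with
      (u (S m) * Cmod (rising w (S m))) by (field; lra).
    replace (Cmod (binet_poly (S m) a) / Cmod (rising w (S m)) * (INR (S m) * Cmod (rising w (S m))))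
      with (INR (S m) * Cmod (binet_poly (S m) a)) by (field; lra).
    lra.
Qed.

(** * Sum of the Binet series and its behaviour under w -> w + 1 *)

Definition binet_term (a w : C) (m : nat) : C := (binet_poly m a / rising w m)%C.
Definition binet_sum (a w : C) : C := CSeries (binet_term a w).

Lemma binet_term_bound (a w : C) : 0 < Re w -> Re a < Re w ->
  exists B : nat -> R, ex_series B /\ forall m, Cmod (binet_term a w m) <= B m.
Proof.
intros Hw Ha.
destruct (binet_poly_bound w (Cmod a) (Re w - Re a)) as (B & HB & H); [assumption|lra|].
exists B; split; [assumption|]; intros m; apply H; lra.
Qed.

Lemma binet_sum_correct (a w : C) : 0 < Re w -> Re a < Re w -> Clim (Csum (binet_term a w)) (binet_sum a w).
Proof.
intros Hw Ha; destruct (binet_term_bound a w Hw Ha) as (B & HB & H).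
now apply CSeries_correct with B.
Qed.

(** The inverse factorial expansion in finite form, with exact remainder; each step rests on w - x =
    (w + M) - (x + M). *)
Lemma inverse_factorial_sum (x w : C) (M : nat) : 0 < Re w -> (w - x)%C <> 0%C ->
  Csum (fun m => (rising x m / rising w (S m))%C) M =
  (/ (w - x) - rising x M / (rising w M * (w - x)))%C.
Proof.
intros Hw Hx; induction M as [|M IH].
- cbn; field; assumption.
- cbn [Csum]; rewrite IH, !rising_S.
  field; Cnz; [now apply plus_INR_neq0|now apply rising_neq0].
Qed.

Lemma rising_succ_l (w : C) (m : nat) : (w * rising (w + 1) m)%C = rising w (S m).
Proof.
induction m as [|m IH]; [cbn; Cring|].
rewrite rising_S, Cmult_assoc, IH, (rising_S w (S m)), (S_INR m), RtoC_plus; Cring.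
Qed.

(* The general term of Gudermann's series for Binet's function. *)
Definition gudermann (z : C) : C := ((z + 1 / 2) * (Clog (z + 1) - Clog z) - 1)%C.

(** (1/2 - t) / (z + t) = (z + 1/2) / (z + t) - 1. *)
Lemma gudermann_int (z : C) : 0 < Re z ->
  is_CInt (fun t => ((1 / 2 - RtoC t) / (z + RtoC t))%C) 0 1 (gudermann z).
Proof.
intros Hz.
assert (Hre : forall t, 0 <= t <= 1 -> 0 < Re (z + RtoC t)).
{ intros t Ht; change (0 < Re z + t); lra. }
set (F := fun t : R => ((z + 1 / 2) * Clog (z + RtoC t) - RtoC t)%C).
replace (gudermann z) with (F 1 - F 0)%C.
2: { unfold F, gudermann; rewrite Cplus_0_r; Cring. }
assert (Haff : forall t, RCder (fun s => (z + RtoC s)%C) t 1).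
{ intros t; apply RCder_ext with (fun s => (z + RtoC s * 1)%C); [intros; Cring|apply RCder_affine]. }
apply is_CInt_derive; [lra| |]; intros t Ht.
- unfold F; eapply RCder_eq.
  + apply RCder_minus; [apply RCder_scal, RCder_Clog; [apply Haff|now apply Hre]|].
    apply (RCder_RtoC (fun s => s) t 1), (is_derive_id (K := R_AbsRing)).
  + cbv beta; field; Cnz; now apply Re_neq0, Hre.
- eexists; apply RCder_mult; [apply RCder_one_sub|].
  apply RCder_inv; [apply Haff|now apply Re_neq0, Hre].
Qed.

(** 1 / (w)_m - 1 / (w + 1)_m = m / (w)_{m+1}, and the factor m cancels the 1 / m of b_m. The
    partial sums become integrals of partial sums of the inverse factorial expansion, whose
    remainder contributes at most u M / Re z. *)
Lemma binet_sum_diff (a w : C) : 0 < Re w -> Re a < Re w ->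
  (binet_sum a w - binet_sum a (w + 1))%C = gudermann (w - a).
Proof.
intros Hw Ha; set (z := (w - a)%C).
assert (Hz : 0 < Re z) by (change (0 < Re w + - Re a); lra).
assert (Hw1 : Re (w + 1) = Re w + 1) by reflexivity.
assert (H1 := Clim_minus _ _ _ _ (binet_sum_correct a w Hw Ha) (binet_sum_correct a (w + 1) ltac:(lra) ltac:(lra))).
apply (Clim_unique _ _ _ H1); clear H1.
destruct (rising_ratio_bound w (Cmod a + 1) (Re z) Hw Hz) as (u & Hu & Hu0 & _ & H).
apply Clim_le with (fun M => / Re z * u M).
2: { replace 0 with (/ Re z * 0) by ring; now apply (is_lim_seq_scal_l _ _ 0). }
intros M.
assert (E : (Csum (binet_term a w) M - Csum (binet_term a (w + 1)) M)%C =
  Csum (fun m => (/ rising w (S m) * (INR m * binet_poly m a))%C) M).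
{ induction M as [|M IH]; [cbn; Cring|]; cbn [Csum]; rewrite <- IH.
  unfold binet_term.
  assert (Hn0 : w <> 0%C) by (now apply Re_neq0).
  assert (Hn1 := rising_neq0 w M Hw); assert (Hn2 := plus_INR_neq0 w M Hw).
  replace (rising (w + 1) M) with (rising w (S M) / w)%C.
  2: { rewrite <- rising_succ_l; field; assumption. }
  rewrite rising_S; field; Cnz. }
rewrite E; clear E.
assert (Hzt : forall t, 0 <= t <= 1 -> Re z <= Re (z + RtoC t)).
{ intros t Ht; change (Re z <= Re z + t); lra. }
assert (HI := is_CInt_minus _ _ _ _ _ _
  (is_CInt_Csum _ 0 1 _ M (fun m => is_CInt_scal (/ rising w (S m)) _ _ _ _ (binet_poly_int m a)))
  (gudermann_int z Hz)).
replace (/ Re z * u M) with ((1 - 0) * (/ Re z * u M)) by ring.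
apply is_CInt_bound_const with (3 := HI); [lra|]; clear HI; intros t Ht; cbv beta.
assert (Hn : (w - (a - RtoC t))%C = (z + RtoC t)%C) by (unfold z; ring).
assert (Hzt0 : (z + RtoC t)%C <> 0%C) by (apply Re_neq0; specialize (Hzt t Ht); lra).
rewrite (Csum_ext _ (fun m => ((1 / 2 - RtoC t) * (rising (a - RtoC t) m / rising w (S m)))%C))
  by (intros; unfold Cdiv; Cring).
rewrite Csum_scal, inverse_factorial_sum, Hn by (try rewrite Hn; assumption).
assert (Hnw := rising_neq0 w M Hw).
replace ((1 / 2 - RtoC t) * (/ (z + RtoC t) - rising (a - RtoC t) M / (rising w M * (z + RtoC t)))
  - (1 / 2 - RtoC t) / (z + RtoC t))%C with
  (- ((1 / 2 - RtoC t) * (rising (a - RtoC t) M / rising w M) * / (z + RtoC t)))%C.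
2: { field; Cnz. }
rewrite Cmod_opp, !Cmod_mult, Cmod_inv, Cmod_div by assumption.
assert (Hr : 0 < Cmod (rising w M)) by (now apply Cmod_gt_0).
assert (H2 : Cmod (rising (a - RtoC t) M) / Cmod (rising w M) <= u M).
{ apply Rmult_le_reg_r with (Cmod (rising w M)); [assumption|].
  unfold Rdiv; rewrite Rmult_assoc, Rinv_l, Rmult_1_r by lra; apply H.
  - eapply Rle_trans; [apply Cmod_triangle|]; rewrite Cmod_opp, Cmod_R, Rabs_pos_eq; lra.
  - change (Re a + - t <= Re w - (Re w + - Re a)); lra. }
assert (H3 : / Cmod (z + RtoC t) <= / Re z).
{ apply Rinv_le_contravar; [assumption|]; eapply Rle_trans; [apply Hzt, Ht|apply Re_le_Cmod]. }
assert (H4 : 0 <= Cmod (rising (a - RtoC t) M) / Cmod (rising w M)).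
{ apply Rdiv_le_0_compat; [apply Cmod_ge_0|assumption]. }
rewrite (Rmult_comm (/ Re z)); apply Rmult_le_compat.
- apply Rmult_le_pos; [apply Cmod_ge_0|assumption].
- apply Rlt_le, Rinv_0_lt_compat, Cmod_gt_0, Hzt0.
- assert (H5 := Cmod_half_minus t Ht); assert (H6 := Cmod_ge_0 (1 / 2 - RtoC t)).
  specialize (Hu M); nra.
- exact H3.
Qed.

Lemma Cmod_plus_INR_le (w : C) (N k : nat) : 0 < Re w ->
  Cmod (w + INR k) <= Cmod (w + INR N + INR k).
Proof.
intros Hw; unfold Cmod; apply sqrt_le_1_alt; cbn [fst snd Cplus RtoC].
assert (H1 := pos_INR N); assert (H2 := pos_INR k); unfold Re in Hw; nra.
Qed.

(** Adding N decreases no factor in modulus; comparing the first one exactly gives the gain |w| / |w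
    + N| for all m at once. *)
Lemma rising_shift_le (w : C) (N m : nat) : 0 < Re w ->
  Cmod (w + INR N) * Cmod (rising w (S m)) <= Cmod w * Cmod (rising (w + INR N) (S m)).
Proof.
intros Hw; induction m as [|m IH].
- cbn; rewrite !Cmod_mult, Cplus_0_r, Cplus_0_r, Cmod_1; lra.
- rewrite (rising_S _ (S m)), (rising_S _ (S m)), !Cmod_mult, <- !Rmult_assoc.
  apply Rmult_le_compat; [|apply Cmod_ge_0|assumption|now apply Cmod_plus_INR_le].
  apply Rmult_le_pos; apply Cmod_ge_0.
Qed.

(** The shift multiplies every term with m >= 1 by at most |w| / |w + N| in modulus, so the sum of
    the majorant B shrinks by the same factor. *)
Lemma binet_sum_shift_lim (a w : C) : 0 < Re w -> Re a < Re w -> Clim (fun N => binet_sum a (w + INR N)) 0.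
Proof.
intros Hw Ha; destruct (binet_term_bound a w Hw Ha) as (B & HB & H).
apply Clim_le with (fun N => Series B * Cmod w * / (Re w + INR N)).
2: { replace 0 with (Series B * Cmod w * 0) by ring.
  apply (is_lim_seq_scal_l _ _ 0).
  apply (is_lim_seq_inv _ p_infty); [|discriminate].
  apply (is_lim_seq_plus (fun _ => Re w) INR (Re w) p_infty p_infty);
    [apply is_lim_seq_const|apply is_lim_seq_INR|reflexivity]. }
intros N; replace (binet_sum a (w + INR N) - 0)%C with (binet_sum a (w + INR N)) by ring.
assert (HN := pos_INR N).
assert (HwN : 0 < Cmod (w + INR N)) by (apply Cmod_gt_0, plus_INR_neq0, Hw).
assert (Hre : Re (w + INR N) = Re w + INR N) by reflexivity.
assert (Hwm : 0 < Cmod w) by (apply Cmod_gt_0, Re_neq0, Hw).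
apply Rle_trans with (Series B * (Cmod w / Cmod (w + INR N))).
- rewrite <- Series_scal_r.
  apply Clim_Csum_bound with (binet_term a (w + INR N)).
  + intros [|m].
    (* The term m = 0 has an empty denominator and gains nothing from the shift; it is zero because
       b_0 = 0. *)
    * replace (binet_term a (w + INR N) 0) with (RtoC 0) by (unfold binet_term; cbn; field; exact C1_nz).
      rewrite Cmod_0; apply Rmult_le_pos; [|now apply Rlt_le, Rdiv_lt_0_compat].
      eapply Rle_trans; [apply Cmod_ge_0|apply (H O)].
    * assert (Hr1 := rising_neq0 w (S m) Hw).
      assert (Hr2 : rising (w + INR N) (S m) <> 0%C) by (apply rising_neq0; lra).
      assert (Hr3 := rising_shift_le w N m Hw).
      assert (Hr4 := proj1 (Cmod_gt_0 _) Hr1); assert (Hr5 := proj1 (Cmod_gt_0 _) Hr2).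
      apply Rle_trans with (Cmod (binet_term a w (S m)) * (Cmod w / Cmod (w + INR N))).
      2: { apply Rmult_le_compat_r; [now apply Rlt_le, Rdiv_lt_0_compat|apply H]. }
      unfold binet_term; rewrite !Cmod_div by assumption.
      set (b := Cmod (binet_poly (S m) a)); assert (Hb : 0 <= b) by apply Cmod_ge_0.
      set (p := Cmod (rising w (S m))) in *; set (q := Cmod (rising (w + INR N) (S m))) in *.
      set (y := Cmod (w + INR N)) in *; set (x := Cmod w) in *.
      apply Rmult_le_reg_r with (q * (p * y)); [repeat apply Rmult_lt_0_compat; assumption|].
      replace (b / q * (q * (p * y))) with (b * (y * p)) by (field; lra).
      replace (b / p * (x / y) * (q * (p * y))) with (b * (x * q)) by (field; lra).
      now apply Rmult_le_compat_l.
  + apply ex_series_scal_r with (c := Cmod w / Cmod (w + INR N)); exact HB.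
  + apply binet_sum_correct; rewrite Hre; lra.
- unfold Rdiv; rewrite <- Rmult_assoc; apply Rmult_le_compat_l.
  + apply Rmult_le_pos; [|lra].
    eapply Rle_trans; [apply Cmod_ge_0|].
    apply (Clim_Csum_bound _ _ _ H HB (binet_sum_correct a w Hw Ha)).
  + apply Rinv_le_contravar; [lra|]; rewrite <- Hre; apply Re_le_Cmod.
Qed.

(** The parameter a = 0 is admissible on the whole right half-plane. *)
Definition binetM (z : C) : C := binet_sum 0 z.

Lemma null_constant (f : nat -> C) : (forall n, f (S n) = f n) -> Clim f 0 -> f O = 0%C.
Proof.
intros Hf H; apply (Clim_unique f); [|assumption].
apply Clim_ext with (fun _ => f O); [|apply Clim_const].
induction n as [|n IH]; [reflexivity|]; now rewrite Hf.
Qed.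

Lemma plus_INR_S (w : C) (n : nat) : (w + INR (S n))%C = (w + INR n + 1)%C.
Proof. rewrite S_INR, RtoC_plus; Cring. Qed.

(* The difference of the two sides is 1-periodic and tends to 0 along w + N. *)
Lemma binet_sum_binetM (a w : C) : 0 < Re w -> Re a < Re w -> binet_sum a w = binetM (w - a).
Proof.
intros Hw Ha; apply Ceq_minus.
assert (Hz : 0 < Re (w - a)) by (change (0 < Re w + - Re a); lra).
assert (E := null_constant (fun n => binet_sum a (w + INR n) - binetM (w - a + INR n))%C).
cbv beta in E; change (INR 0) with 0 in E; rewrite !Cplus_0_r in E; apply E; clear E.
- intros n; assert (Hn := pos_INR n).
  assert (H1 := binet_sum_diff a (w + INR n)); assert (H2 := binet_sum_diff 0 (w - a + INR n)).
  rewrite Re_plus_INR in H1, H2.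
  specialize (H1 ltac:(lra) ltac:(lra)); specialize (H2 ltac:(lra) ltac:(change (0 < Re (w - a) + INR n); lra)).
  replace (w - a + INR n - 0)%C with (w + INR n - a)%C in H2 by ring.
  rewrite <- H1 in H2; unfold binetM; rewrite !plus_INR_S.
  symmetry; apply Ceq_minus; apply Ceq_minus in H2.
  replace (binet_sum a (w + INR n) - binet_sum 0 (w - a + INR n)
    - (binet_sum a (w + INR n + 1) - binet_sum 0 (w - a + INR n + 1)))%C with
   (- (binet_sum 0 (w - a + INR n) - binet_sum 0 (w - a + INR n + 1)
      - (binet_sum a (w + INR n) - binet_sum a (w + INR n + 1))))%C by ring.
  rewrite H2; Cring.
- replace (RtoC 0) with (0 - 0)%C by ring; apply Clim_minus.
  + now apply binet_sum_shift_lim.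
  + apply binet_sum_shift_lim; [assumption|exact Hz].
Qed.

Lemma binetM_diff (z : C) : 0 < Re z -> (binetM z - binetM (z + 1))%C = gudermann z.
Proof.
intros Hz; unfold binetM; rewrite binet_sum_diff; [f_equal; ring|assumption|exact Hz].
Qed.

Lemma binetM_shift_lim (z : C) : 0 < Re z -> Clim (fun N => binetM (z + INR N)) 0.
Proof. intros Hz; apply binet_sum_shift_lim; [assumption|exact Hz]. Qed.

Lemma gudermann_real (x : R) : 0 < x -> Im (gudermann (RtoC x)) = 0.
Proof.
intros Hx; unfold gudermann.
replace (RtoC x + 1)%C with (RtoC (x + 1)) by (now rewrite RtoC_plus).
rewrite !Clog_RtoC by lra.
replace ((x + 1 / 2) * (ln (x + 1) - ln x) - 1)%C with (RtoC ((x + 1 / 2) * (ln (x + 1) - ln x) - 1)).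
- reflexivity.
- rewrite RtoC_minus, RtoC_mult, RtoC_plus, RtoC_minus, RtoC_div by lra; reflexivity.
Qed.

(** As [gudermann] is real on the positive axis, the imaginary part of M does not change along x +
    N, where it tends to 0. *)
Lemma binetM_real (x : R) : 0 < x -> Im (binetM (RtoC x)) = 0.
Proof.
intros Hx.
assert (H : RtoC (Im (binetM (RtoC x))) = 0%C).
{ assert (E := null_constant (fun n => RtoC (Im (binetM (RtoC x + INR n))))).
  cbv beta in E; change (INR 0) with 0 in E; rewrite !Cplus_0_r in E; apply E; clear E.
  - intros n; f_equal; assert (Hn := pos_INR n).
    assert (H1 := binetM_diff (RtoC x + INR n)).
    assert (H2 : Im (gudermann (RtoC x + INR n)) = 0).
    { rewrite <- RtoC_plus; apply gudermann_real; lra. }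
    rewrite <- H1 in H2 by (simpl; lra); rewrite plus_INR_S.
    change (Im (binetM (RtoC x + INR n)) + - Im (binetM (RtoC x + INR n + 1)) = 0) in H2; lra.
  - apply Clim_parts; [|apply is_lim_seq_const].
    apply is_lim_seq_ext with (fun n => Im (binetM (RtoC x + INR n))); [reflexivity|].
    apply (Clim_Im _ 0), binetM_shift_lim; exact Hx. }
apply RtoC_inj; exact H.
Qed.

Lemma Cpoly_derive_n_scal (n : nat) : forall (d : nat) (f : C -> C) (c z : C), Cpoly d f ->
  C_derive_n (fun x => c * f x)%C n z = (c * C_derive_n f n z)%C.
Proof.
induction n as [|n IH]; intros d f c z Hf; [reflexivity|].
rewrite !C_derive_n_S.
replace (C_derive (fun x => c * f x)%C) with (fun x => c * C_derive f x)%C.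
- apply (IH (pred d)), Cpoly_derive, Hf.
- apply functional_extensionality; intros x; symmetry; apply Cder_unique, Cder_scal.
  destruct Hf as [e He]; assert (H := Cder_ext _ f x _ (fun y => eq_sym (He y)) (Cpoly_Cder e d x)).
  now rewrite (Cder_unique _ _ _ H).
Qed.

(** * Derivatives in z obtained from derivatives in the parameter *)

Section Derivatives.
(** [binet] and [binetM] are known to agree only for Re z > 0, while iterated derivatives are
    functions on all of C. The section treats any G that agrees with [binetM] there, and is applied
    to both. *)
Variable G : C -> C.
Hypothesis HG : forall z, 0 < Re z -> G z = binetM z.

Lemma reflected_derivatives (n : nat) (w a : C) : 0 < Re w -> Re a < Re w ->
  Cder (C_derive_n (fun x => G (w - x)%C) n) a (C_derive_n (fun x => G (w - x)%C) (S n) a) /\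
  Clim (Csum (fun m => C_derive_n (binet_poly m) n a / rising w m)%C)
    (C_derive_n (fun x => G (w - x)%C) n a).
Proof.
(* With half of the gap as radius, the disc around a stays in Re x <= Re w - d, where a single
   majorant holds. *)
intros Hw Ha; set (d := (Re w - Re a) / 2).
assert (Hd : 0 < d) by (unfold d; lra).
destruct (binet_poly_bound w (Cmod a + d) d Hw Hd) as (B & HB & H).
destruct (termwise_derive_n n (fun m x => / rising w m * binet_poly m x)%C (fun m => m) B
  (fun x => G (w - x)%C) a d Hd HB) as [H1 H2].
- intros m; apply Cpoly_scal, Cpoly_binet_poly.
- intros m h Hh; rewrite Cmult_comm; apply H.
  + eapply Rle_trans; [apply Cmod_triangle|]; lra.
  + change (Re a + Re h <= Re w - d); assert (Hr := Re_le_Cmod h); unfold d in *; lra.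
- intros h Hh.
  assert (Hah : Re (a + h) < Re w).
  { change (Re a + Re h < Re w); assert (Hr := Re_le_Cmod h); unfold d in *; lra. }
  rewrite HG, <- binet_sum_binetM.
  + apply Clim_ext with (2 := binet_sum_correct _ _ Hw Hah); intros k; apply Csum_ext.
    intros m _; unfold binet_term, Cdiv; apply Cmult_comm.
  + assumption.
  + assumption.
  + change (0 < Re w + - Re (a + h)); lra.
- split; [exact H1|]; apply Clim_ext with (2 := H2); intros k; apply Csum_ext; intros m _.
  rewrite (Cpoly_derive_n_scal n m _ _ _ (Cpoly_binet_poly m)); unfold Cdiv; apply Cmult_comm.
Qed.

(** The chain rule for y -> w - y contributes the sign. Differentiation uses the identity on a
    neighbourhood of z, hence the hypothesis on the whole half-plane. *)
Lemma derive_n_reflect_step (n : nat) (w : C) : 0 < Re w ->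
  (forall z, 0 < Re z ->
    C_derive_n G n z = ((- (1)) ^ n * C_derive_n (fun x => G (w - x)%C) n (w - z))%C) ->
  forall z, 0 < Re z ->
    Cder (C_derive_n G n) z ((- (1)) ^ S n * C_derive_n (fun x => G (w - x)%C) (S n) (w - z))%C.
Proof.
intros Hw H z Hz.
apply Cder_ext_loc with (fun y => (- (1)) ^ n * C_derive_n (fun x => G (w - x)%C) n (w - y))%C (Re z).
- assumption.
- intros h Hh; symmetry; apply H; change (0 < Re z + Re h).
  assert (Hr := re_le_Cmod h); apply Rabs_le_between in Hr; lra.
- replace ((- (1)) ^ S n * C_derive_n (fun x => G (w - x)%C) (S n) (w - z))%C with
    ((- (1)) ^ n * - C_derive_n (fun x => G (w - x)%C) (S n) (w - z))%C by (cbn [Cpow]; Cring).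
  apply Cder_scal, Cder_sub, reflected_derivatives; [assumption|].
  change (Re w + - Re z < Re w); lra.
Qed.

Lemma derive_n_reflect (n : nat) (w : C) : 0 < Re w -> forall z, 0 < Re z ->
  C_derive_n G n z = ((- (1)) ^ n * C_derive_n (fun x => G (w - x)%C) n (w - z))%C.
Proof.
intros Hw; induction n as [|n IH]; intros z Hz.
- cbn [C_derive_n Cpow]; rewrite Cmult_1_l; f_equal; ring.
- exact (Cder_unique _ _ _ (derive_n_reflect_step n w Hw IH z Hz)).
Qed.

Lemma derive_n_Cder (n : nat) (z : C) : 0 < Re z -> Cder (C_derive_n G n) z (C_derive_n G (S n) z).
Proof.
(* Any w in the right half-plane may serve for the reflection; w = z is at hand. *)
intros Hz; assert (H := derive_n_reflect_step n z Hz (derive_n_reflect n z Hz) z Hz).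
change (C_derive_n G (S n) z) with (C_derive (C_derive_n G n) z).
now rewrite (Cder_unique _ _ _ H).
Qed.

Lemma derive_n_series (n : nat) (z a : C) : 0 < Re z -> - Re z < Re a ->
  exists s, Clim (Csum (fun m => C_derive_n (binet_poly m) n a / rising (z + a) m)%C) s /\
    C_derive_n G n z = ((- (1)) ^ n * s)%C.
Proof.
intros Hz Ha.
assert (Hw : Re (z + a) = Re z + Re a) by reflexivity.
(* With w = z + a the reflected point w - z is a. *)
exists (C_derive_n (fun x => G (z + a - x)%C) n a); split.
- apply reflected_derivatives; lra.
- rewrite (derive_n_reflect n (z + a)) by lra; do 2 f_equal; ring.
Qed.
End Derivatives.

(** * Gauss' limit for the Gamma integral *)

Lemma exp_pow (y : R) (n : nat) : exp y ^ n = exp (INR n * y).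
Proof.
induction n as [|n IH]; [simpl; rewrite Rmult_0_l, exp_0; reflexivity|].
rewrite S_INR; simpl; rewrite IH, <- exp_plus; f_equal; ring.
Qed.

Lemma bernoulli_minus (y : R) (n : nat) : 0 <= y <= 1 -> 1 - INR n * y <= (1 - y) ^ n.
Proof.
intros Hy; induction n as [|n IH]; [simpl; lra|].
rewrite S_INR; simpl; assert (H := pos_INR n).
assert ((1 - y) * (1 - INR n * y) <= (1 - y) * (1 - y) ^ n) by (apply Rmult_le_compat_l; lra).
assert (0 <= INR n * y * y) by (repeat apply Rmult_le_pos; lra); nra.
Qed.

(** With y = t / N, the quotient of (1 - y)^N by exp (- t) is (exp y (1 - y))^N. It is at least (1 -
    y^2)^N, hence at least 1 - N y^2 = 1 - t^2 / N by Bernoulli. *)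
Lemma one_minus_div_bounds (N : nat) (t : R) : (0 < N)%nat -> 0 <= t <= INR N ->
  0 <= exp (- t) - (1 - t / INR N) ^ N <= t ^ 2 / INR N * exp (- t) /\ 0 <= (1 - t / INR N) ^ N.
Proof.
intros HN Ht; assert (HN' : 0 < INR N) by (now apply lt_0_INR).
set (y := t / INR N).
assert (Hy : 0 <= y <= 1).
{ split; [now apply Rdiv_le_0_compat|]; unfold y; apply Rmult_le_reg_r with (INR N); [assumption|].
  unfold Rdiv; rewrite Rmult_assoc, Rinv_l; lra. }
assert (Et : t = INR N * y) by (unfold y; field; lra).
assert (E : exp (- t) = exp (- y) ^ N) by (rewrite exp_pow, Et; f_equal; ring).
split; [split|apply pow_le; lra].
- assert ((1 - y) ^ N <= exp (- t)); [|lra].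
  rewrite E; apply pow_incr; split; [lra|].
  assert (H := exp_ineq1_le (- y)); lra.
- assert (H1 : exp (- t) * (1 - t ^ 2 / INR N) <= (1 - y) ^ N); [|assert (H := exp_pos (- t)); nra].
  replace ((1 - y) ^ N) with (exp (- t) * ((exp y * (1 - y)) ^ N)).
  2: { rewrite E, <- Rpow_mult_distr, <- Rmult_assoc, <- exp_plus; f_equal.
       replace (- y + y) with 0 by ring; rewrite exp_0; ring. }
  apply Rmult_le_compat_l; [apply Rlt_le, exp_pos|].
  apply Rle_trans with ((1 - y ^ 2) ^ N).
  + replace (t ^ 2 / INR N) with (INR N * y ^ 2) by (rewrite Et; field; lra).
    apply bernoulli_minus; nra.
  + apply pow_incr; split; [nra|].
    assert (H := exp_ineq1_le y); nra.
Qed.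

Definition Rpow_C (z : C) (t : R) : C := Cexp (z * RtoC (ln t)).

Lemma Cmod_Rpow_C (z : C) (t : R) : Cmod (Rpow_C z t) = exp (Re z * ln t).
Proof. unfold Rpow_C; rewrite Cmod_Cexp, re_scal_r; reflexivity. Qed.

Lemma RCder_Rpow_C (z : C) (t : R) : 0 < t ->
  RCder (Rpow_C z) t (z / RtoC t * Rpow_C z t).
Proof.
intros Ht; unfold Rpow_C.
eapply RCder_eq.
- apply RCder_Cexp, RCder_scal, (RCder_RtoC ln t (/ t)), is_derive_Reals, derivable_pt_lim_ln, Ht.
- rewrite RtoC_inv by lra; unfold Cdiv; Cring.
Qed.

Lemma Rpow_C_minus1 (z : C) (t : R) : 0 < t -> Rpow_C (z - 1) t = (Rpow_C z t / RtoC t)%C.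
Proof.
intros Ht; unfold Rpow_C.
replace ((z - 1) * RtoC (ln t))%C with (z * RtoC (ln t) + RtoC (- ln t))%C by (rewrite RtoC_opp; ring).
rewrite Cexp_plus, Cexp_RtoC, exp_Ropp, exp_ln, RtoC_inv by lra; reflexivity.
Qed.

(** * Integration of t^(z-1) (1 - t/N)^N by parts *)

Section Beta.
Variables (z : C) (N : nat).
Hypotheses (Hz : 0 < Re z) (HN : (0 < N)%nat).

(** N (N - 1) ... (N - j + 1) / N^j, the numerical factor accumulated by j integrations by parts. *)
Fixpoint falling_ratio (j : nat) : R :=
  match j with O => 1 | S i => falling_ratio i * ((INR N - INR i) / INR N) end.

Lemma INR_N_pos : 0 < INR N.
Proof. now apply lt_0_INR. Qed.

Lemma falling_ratio_bound (j : nat) : (j <= S N)%nat -> 0 <= falling_ratio j <= 1.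
Proof.
assert (HN' := INR_N_pos).
induction j as [|j IH]; intros Hj; [simpl; lra|]; simpl.
assert (H1 : INR j <= INR N) by (apply le_INR; lia); assert (H2 := pos_INR j).
assert (H3 : 0 <= (INR N - INR j) / INR N <= 1).
{ split; [apply Rdiv_le_0_compat; lra|]; apply Rmult_le_reg_r with (INR N); [assumption|].
  unfold Rdiv; rewrite Rmult_assoc, Rinv_l; lra. }
specialize (IH ltac:(lia)); nra.
Qed.

Lemma falling_ratio_fact (j : nat) : (j <= N)%nat ->
  falling_ratio j * INR N ^ j * INR (fact (N - j)) = INR (fact N).
Proof.
assert (HN' := INR_N_pos).
induction j as [|j IH]; intros Hj; [simpl; rewrite Nat.sub_0_r; ring|].
rewrite <- IH by lia; replace (N - j)%nat with (S (N - S j)) by lia.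
rewrite fact_simpl, mult_INR; replace (S (N - S j)) with (N - j)%nat by lia.
rewrite minus_INR by lia; simpl; field; lra.
Qed.

Definition beta_kernel (j : nat) (t : R) : R := t ^ j * (1 - t / INR N) ^ (N - j).

(** The boundary term that leads from [beta_diff j] to [beta_diff (S j)]. *)
Definition beta_term (j : nat) (t : R) : C :=
  (RtoC (falling_ratio j) / rising z (S j) * (RtoC (beta_kernel j t) * Rpow_C z t))%C.

(** The integrand that remains after j integrations by parts; for j = 0 it is t^(z-1) (1 -
    t/N)^N. *)
Definition beta_diff (j : nat) (t : R) : C :=
  (RtoC (falling_ratio j) / rising z j * (RtoC (beta_kernel j t) * Rpow_C z t) / RtoC t)%C.

Lemma is_derive_beta_kernel (j : nat) (t : R) : 0 < t -> (j <= N)%nat ->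
  is_derive (beta_kernel j) t ((INR j * beta_kernel j t - (INR N - INR j) / INR N * beta_kernel (S j) t) / t).
Proof.
intros Ht Hj; assert (HN' := INR_N_pos); unfold beta_kernel.
auto_derive; [exact I|].
rewrite <- minus_INR by assumption.
(* For j = N the exponent is truncated to 0, harmlessly: its coefficient N - j is 0. *)
replace (N - S j)%nat with (pred (N - j)) by lia.
assert (E1 : INR j * t ^ j = t * (INR j * t ^ pred j)).
{ destruct j as [|j]; [simpl; ring|simpl pred; simpl (t ^ S j); ring]. }
change (t ^ S j) with (t * t ^ j).
replace (1 + - (t * / INR N)) with (1 - t / INR N) by (unfold Rdiv; ring).
set (q := 1 - t / INR N).
replace (INR j * (t ^ j * q ^ (N - j))) with (t * (INR j * t ^ pred j) * q ^ (N - j)) by (rewrite <- E1; ring).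
field; lra.
Qed.

Lemma RCder_beta_term (j : nat) (t : R) : 0 < t -> (j <= N)%nat ->
  RCder (beta_term j) t (beta_diff j t - beta_diff (S j) t)%C.
Proof.
intros Ht Hj; unfold beta_term, beta_diff; assert (HN' := INR_N_pos).
assert (Hn1 := rising_neq0 z j Hz); assert (Hn2 := plus_INR_neq0 z j Hz).
eapply RCder_eq.
- apply RCder_scal, RCder_mult; [apply RCder_RtoC, is_derive_beta_kernel; assumption|now apply RCder_Rpow_C].
- cbn [falling_ratio].
  assert (HtC : RtoC t <> 0%C) by (intros E; apply RtoC_inj in E; lra).
  assert (HNC : RtoC (INR N) <> 0%C) by (intros E; apply RtoC_inj in E; lra).
  rewrite RtoC_mult, !RtoC_div, !RtoC_minus, !RtoC_mult, RtoC_div, RtoC_minus, rising_S by lra.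
  field; Cnz.
Qed.

(* Repeated integration by parts gives this primitive of t^(z-1) (1 - t/N)^N:
   the derivatives of its terms telescope. *)
Definition beta_primitive (t : R) : C := Csum (fun j => beta_term j t) (S N).

Lemma RCder_beta_primitive (t : R) : 0 < t ->
  RCder beta_primitive t (Rpow_C (z - 1) t * RtoC ((1 - t / INR N) ^ N))%C.
Proof.
intros Ht; unfold beta_primitive.
assert (H : forall n, (n <= S N)%nat ->
  RCder (fun t => Csum (fun j => beta_term j t) n) t (beta_diff 0 t - beta_diff n t)%C).
{ induction n as [|n IH]; intros Hn.
  - apply RCder_eq with (RtoC 0); [apply (RCder_const (RtoC 0))|].
    generalize (beta_diff 0%nat t); intros; Cring.
  - apply RCder_eq with ((beta_diff 0 t - beta_diff n t) + (beta_diff n t - beta_diff (S n) t))%C.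
    + apply RCder_plus; [apply IH; lia|apply RCder_beta_term; [assumption|lia]].
    + generalize (beta_diff 0%nat t), (beta_diff n t), (beta_diff (S n) t); intros; Cring. }
eapply RCder_eq; [apply H; lia|].
(* The process ends after N + 1 steps: [falling_ratio (S N)] contains the factor N - N. *)
assert (E : beta_diff (S N) t = 0%C).
{ unfold beta_diff; cbn [falling_ratio]; rewrite Rminus_diag; unfold Rdiv; rewrite Rmult_0_l, Rmult_0_r.
  unfold Cdiv; Cring. }
rewrite E, Rpow_C_minus1 by assumption; unfold beta_diff, beta_kernel; cbn [falling_ratio].
rewrite Nat.sub_0_r, pow_O, Rmult_1_l; cbn [rising Cprod].
field; Cnz.
Qed.

(** At t = N the factor (1 - t/N)^(N - j) annihilates every term except j = N. *)
Lemma beta_primitive_N : beta_primitive (INR N) = (Rpow_C z (INR N) * INR (fact N) / rising z (S N))%C.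
Proof.
assert (HN' := INR_N_pos).
unfold beta_primitive; cbn [Csum]; rewrite (Csum_ext _ (fun _ => 0%C)), Csum_zero.
- unfold beta_term, beta_kernel; rewrite Nat.sub_diag, pow_O, Rmult_1_r, Cplus_0_l.
  rewrite <- (falling_ratio_fact N) by lia; rewrite Nat.sub_diag; simpl (INR (fact 0)).
  rewrite Rmult_1_r, RtoC_mult; field; now apply rising_neq0.
- intros j Hj; unfold beta_term, beta_kernel.
  replace (1 - INR N / INR N) with 0 by (field; lra).
  rewrite pow_i, Rmult_0_r by lia; Cring.
Qed.

(** The first factor has modulus at least Re z and every later one at least 1. *)
Lemma Cmod_rising_ge (j : nat) : Re z <= Cmod (rising z (S j)).
Proof.
induction j as [|j IH].
- rewrite rising_S; cbn [rising Cprod INR]; rewrite Cmult_1_l, Cplus_0_r; apply Re_le_Cmod.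
- rewrite rising_S, Cmod_mult.
  assert (H : 1 <= Cmod (z + INR (S j))).
  { eapply Rle_trans; [|apply Re_le_Cmod]; rewrite Re_plus_INR, S_INR.
    assert (H := pos_INR j); lra. }
  nra.
Qed.

(** The integrals start at a > 0, since t^z is given by ln t. The value of the primitive at a is
    thus an error term; a geometric series of ratio 1/2 bounds it uniformly in N. *)
Lemma Cmod_beta_primitive_le (a : R) : 0 < a <= 1 / 2 -> Cmod (beta_primitive a) <= 2 / Re z * exp (Re z * ln a).
Proof.
intros Ha; assert (HN' : 1 <= INR N) by (apply (le_INR 1); lia).
set (e := exp (Re z * ln a)); assert (He : 0 < e) by apply exp_pos.
assert (G : forall n, (n <= S N)%nat ->
  Cmod (Csum (fun j => beta_term j a) n) <= / Re z * e * (2 - 2 * (1 / 2) ^ n)).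
{ induction n as [|n IH]; intros Hn; [simpl; rewrite Cmod_0; nra|].
  cbn [Csum]; eapply Rle_trans; [apply Cmod_triangle|].
  specialize (IH ltac:(lia)).
  assert (Hb : Cmod (beta_term n a) <= / Re z * e * (1 / 2) ^ n).
  { unfold beta_term; rewrite !Cmod_mult, Cmod_div, !Cmod_R, Cmod_Rpow_C by (now apply rising_neq0).
    fold e.
    assert (Hf := falling_ratio_bound n (Nat.lt_le_incl _ _ Hn)); rewrite (Rabs_pos_eq (falling_ratio n)) by apply Hf.
    assert (Hq : 0 <= 1 - a / INR N <= 1).
    { assert (0 <= a / INR N) by (apply Rdiv_le_0_compat; lra).
      assert (a / INR N <= 1); [|lra].
      apply Rmult_le_reg_r with (INR N); [lra|]; unfold Rdiv; rewrite Rmult_assoc, Rinv_l; lra. }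
    assert (Hk : 0 <= beta_kernel n a <= (1 / 2) ^ n).
    { unfold beta_kernel; split; [apply Rmult_le_pos; apply pow_le; lra|].
      rewrite <- (Rmult_1_r ((1 / 2) ^ n)); apply Rmult_le_compat; try (apply pow_le; lra).
      - apply pow_incr; lra.
      - apply Rle_trans with (1 ^ (N - n)); [apply pow_incr; lra|rewrite pow1; lra]. }
    rewrite (Rabs_pos_eq (beta_kernel n a)) by apply Hk.
    assert (Hr := Cmod_rising_ge n).
    assert (Hd : 0 <= falling_ratio n / Cmod (rising z (S n)) <= / Re z).
    { split; [apply Rdiv_le_0_compat; lra|].
      unfold Rdiv; rewrite <- (Rmult_1_l (/ Re z)); apply Rmult_le_compat; try lra.
      - apply Rlt_le, Rinv_0_lt_compat; lra.
      - apply Rinv_le_contravar; lra. }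
    rewrite Rmult_assoc; apply Rmult_le_compat; try lra.
    - apply Rmult_le_pos; lra.
    - rewrite Rmult_comm; apply Rmult_le_compat_l; lra. }
  simpl ((1 / 2) ^ S n); lra. }
eapply Rle_trans; [apply (G (S N)); lia|].
assert (H0 : 0 <= (1 / 2) ^ S N) by (apply pow_le; lra).
assert (H1 : 0 < / Re z * e) by (apply Rmult_lt_0_compat; [now apply Rinv_0_lt_compat|assumption]).
replace (2 / Re z * e) with (/ Re z * e * 2) by (unfold Rdiv; ring).
apply Rmult_le_compat_l; lra.
Qed.

End Beta.

(** * Comparison with Euler's integral *)

Lemma pow_exp_bound (s : R) : 0 < s ->
  exists K, 0 < K /\ forall t, 0 < t -> exp (s * ln t) * exp (- t) <= K * exp (- t / 2).
Proof.
(* The constant is the maximum of exp (s ln t - t / 2), attained at t = 2s. *)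
intros Hs; exists (exp (s * (ln (2 * s) - 1))); split; [apply exp_pos|]; intros t Ht.
rewrite <- !exp_plus.
assert (H : s * ln t + - t <= s * (ln (2 * s) - 1) + - t / 2).
{ assert (H1 : ln t = ln (2 * s) + ln (t / (2 * s))).
  { rewrite <- ln_mult by (try apply Rdiv_lt_0_compat; lra); f_equal; field; lra. }
  assert (H2 : ln (t / (2 * s)) <= t / (2 * s) - 1).
  { assert (Hp : 0 < t / (2 * s)) by (apply Rdiv_lt_0_compat; lra).
    assert (H3 := exp_ineq1_le (ln (t / (2 * s)))); rewrite exp_ln in H3 by assumption; lra. }
  assert (H4 : s * ln (t / (2 * s)) <= s * (t / (2 * s) - 1)) by (apply Rmult_le_compat_l; lra).
  replace (s * (t / (2 * s) - 1)) with (t / 2 - s) in H4 by (field; lra).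
  rewrite H1; lra. }
destruct H as [H|H]; [left; now apply exp_increasing|right; now rewrite H].
Qed.

Lemma is_RInt_exp_half (K a b : R) :
  is_RInt (fun t => K * exp (- t / 2)) a b (2 * K * exp (- a / 2) - 2 * K * exp (- b / 2)).
Proof.
replace (2 * K * exp (- a / 2) - 2 * K * exp (- b / 2)) with
  (minus ((fun t => - 2 * K * exp (- t / 2)) b) ((fun t => - 2 * K * exp (- t / 2)) a))
  by (unfold minus, plus, opp; simpl; ring).
apply (is_RInt_derive (fun t => - 2 * K * exp (- t / 2)) (fun t => K * exp (- t / 2))); intros t _.
- auto_derive; [exact I|unfold Rdiv; field].
- apply (ex_derive_continuous (K := R_AbsRing) (V := R_NormedModule)); auto_derive; exact I.
Qed.

Lemma Gamma_integrand_eq (z : C) (t : R) :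
  Gamma_integrand z t = (Rpow_C (z - 1) t * RtoC (exp (- t)))%C.
Proof. reflexivity. Qed.

Lemma RCder_Gamma_integrand (z : C) (t : R) : 0 < t -> exists l, RCder (Gamma_integrand z) t l.
Proof.
intros Ht; eexists; unfold Gamma_integrand; apply RCder_mult.
- apply (RCder_Rpow_C (z - 1)); assumption.
- apply (RCder_RtoC (fun t => exp (- t)) t (- exp (- t))); auto_derive; [exact I|ring].
Qed.

Lemma RCder_beta_integrand (z : C) (N : nat) (t : R) : 0 < t ->
  exists l, RCder (fun t => (Rpow_C (z - 1) t * RtoC ((1 - t / INR N) ^ N))%C) t l.
Proof.
intros Ht; eexists; apply RCder_mult; [now apply RCder_Rpow_C|].
apply (RCder_RtoC (fun t => (1 - t / INR N) ^ N)); auto_derive; [exact I|reflexivity].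
Qed.

(** Three errors occur: the primitive at a, the replacement of exp (- t) by (1 - t/N)^N on [a, b],
    and the tail on [b, N]. One constant K serves the last two. *)
Lemma Gamma_integral_estimate (z : C) : 0 < Re z ->
  exists K, 0 < K /\ forall (N : nat) (a b : R) (I : C), 0 < a <= 1 / 2 -> 1 <= b -> b < INR N ->
    is_CInt (Gamma_integrand z) a b I ->
    Cmod (I - Rpow_C z (INR N) * INR (fact N) / rising z (S N))%C <=
      2 / Re z * exp (Re z * ln a) + 2 * K / INR N + 2 * K * exp (- b / 2).
Proof.
(* |t^(z-1)| t^2 = t^(Re z + 1), where t^2 comes from the bound on exp (- t) - (1 - t/N)^N. *)
intros Hz; destruct (pow_exp_bound (Re z + 1)) as (K & HK & HKb); [lra|].
exists K; split; [assumption|]; intros N a b I Ha Hb HbN HI.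
assert (HN' : 0 < INR N) by lra.
assert (HN : (0 < N)%nat) by (destruct N; [simpl in HN'; lra|lia]).
rewrite <- beta_primitive_N by assumption; set (A := beta_primitive z N).
assert (Hpow : forall t, 0 < t -> Cmod (Rpow_C (z - 1) t) * t ^ 2 = exp ((Re z + 1) * ln t)).
{ intros t Ht; rewrite Cmod_Rpow_C; change (Re (z - 1)) with (Re z + - 1).
  replace (t ^ 2) with (exp (2 * ln t)).
  - rewrite <- exp_plus; f_equal; ring.
  - replace (2 * ln t) with (ln t + ln t) by ring; rewrite exp_plus, exp_ln by assumption; ring. }
set (g := fun t => (Rpow_C (z - 1) t * RtoC ((1 - t / INR N) ^ N))%C).
assert (I1 : is_CInt g a b (A b - A a)%C).
{ apply is_CInt_derive; [lra| |]; intros t Ht.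
  - apply RCder_beta_primitive; [assumption|assumption|lra].
  - apply RCder_beta_integrand; lra. }
assert (I2 : is_CInt g b (INR N) (A (INR N) - A b)%C).
{ apply is_CInt_derive; [lra| |]; intros t Ht.
  - apply RCder_beta_primitive; [assumption|assumption|lra].
  - apply RCder_beta_integrand; lra. }
assert (B1 : Cmod (I - (A b - A a))%C <= 2 * (K / INR N) * exp (- a / 2) - 2 * (K / INR N) * exp (- b / 2)).
{ apply (is_CInt_bound _ (fun t => K / INR N * exp (- t / 2)) a b _ _) with (3 := is_CInt_minus _ _ _ _ _ _ HI I1);
    [lra| |apply is_RInt_exp_half].
  intros t Ht; rewrite Gamma_integrand_eq; unfold g.
  replace (Rpow_C (z - 1) t * RtoC (exp (- t)) - Rpow_C (z - 1) t * RtoC ((1 - t / INR N) ^ N))%C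
    with (Rpow_C (z - 1) t * RtoC (exp (- t) - (1 - t / INR N) ^ N))%C by (rewrite RtoC_minus; ring).
  destruct (one_minus_div_bounds N t HN) as [H1 _]; [lra|].
  rewrite Cmod_mult, Cmod_R, Rabs_pos_eq by apply H1.
  apply Rle_trans with (Cmod (Rpow_C (z - 1) t) * (t ^ 2 / INR N * exp (- t))).
  - apply Rmult_le_compat_l; [apply Cmod_ge_0|apply H1].
  - replace (Cmod (Rpow_C (z - 1) t) * (t ^ 2 / INR N * exp (- t))) with
      (/ INR N * (exp ((Re z + 1) * ln t) * exp (- t))) by (rewrite <- Hpow by lra; unfold Rdiv; ring).
    replace (K / INR N * exp (- t / 2)) with (/ INR N * (K * exp (- t / 2))) by (unfold Rdiv; ring).
    apply Rmult_le_compat_l; [now apply Rlt_le, Rinv_0_lt_compat|apply HKb; lra]. }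
assert (B2 : Cmod (A (INR N) - A b)%C <= 2 * K * exp (- b / 2) - 2 * K * exp (- INR N / 2)).
{ apply (is_CInt_bound _ (fun t => K * exp (- t / 2)) b (INR N) _ _) with (3 := I2);
    [lra| |apply is_RInt_exp_half].
  intros t Ht; unfold g.
  destruct (one_minus_div_bounds N t HN) as [H1 H2]; [lra|].
  rewrite Cmod_mult, Cmod_R, Rabs_pos_eq by assumption.
  eapply Rle_trans; [|apply HKb; lra]; rewrite <- Hpow by lra.
  assert (Hc := Cmod_ge_0 (Rpow_C (z - 1) t)); assert (He := exp_pos (- t)).
  (* For t >= 1 the factor t^2 may be inserted, so that the same exponential bound covers the tail;
     hence the condition 1 <= b. *)
  assert (Hq : (1 - t / INR N) ^ N <= t ^ 2 * exp (- t)).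
  { apply Rle_trans with (1 * exp (- t)); [lra|apply Rmult_le_compat_r; nra]. }
  rewrite Rmult_assoc; now apply Rmult_le_compat_l. }
assert (B3 := Cmod_beta_primitive_le z N Hz HN a Ha); fold A in B3.
replace (I - A (INR N))%C with ((I - (A b - A a)) + - (A (INR N) - A b) + - A a + 0)%C by ring.
eapply Rle_trans; [apply Cmod_triangle4|]; rewrite !Cmod_opp, Cmod_0.
assert (E1 : exp (- a / 2) <= 1).
{ rewrite <- exp_0; left; apply exp_increasing; lra. }
assert (E2 := exp_pos (- b / 2)); assert (E3 := exp_pos (- INR N / 2)).
assert (HKN : 0 < K / INR N) by (now apply Rdiv_lt_0_compat).
replace (2 * K / INR N) with (2 * (K / INR N)) by (unfold Rdiv; ring).
nra.
Qed.

(** N tends to infinity first, with a and b fixed, which leaves an estimate in a and b alone; then a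
    tends to 0 and b to infinity, as the improper integral demands. *)
Lemma CGamma_of_limit (z L : C) : 0 < Re z ->
  Clim (fun N => (Rpow_C z (INR N) * INR (fact N) / rising z (S N))%C) L -> CGamma z = L.
Proof.
intros Hz HL; destruct (Gamma_integral_estimate z Hz) as (K & HK & HE).
assert (H : forall a b I, 0 < a <= 1 / 2 -> 1 <= b -> is_CInt (Gamma_integrand z) a b I ->
  Cmod (I - L)%C <= 2 / Re z * exp (Re z * ln a) + 2 * K * exp (- b / 2)).
{ intros a b I Ha Hb HI.
  (* The estimate requires N > b, hence the shift by S N0 with N0 the integer part of b. *)
  destruct (nfloor_ex b) as [N0 [_ HN0]]; [lra|].
  assert (Hlim : is_lim_seq (fun n => 2 / Re z * exp (Re z * ln a) + 2 * K * exp (- b / 2)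
     + 2 * K * / INR (n + S N0) + Cmod (Rpow_C z (INR (n + S N0)) * INR (fact (n + S N0)) / rising z (S (n + S N0)) - L)%C)
     (2 / Re z * exp (Re z * ln a) + 2 * K * exp (- b / 2) + 2 * K * 0 + 0)).
  { apply is_lim_seq_plus'; [apply is_lim_seq_plus'; [apply is_lim_seq_const|]|].
    - apply (is_lim_seq_scal_l _ _ 0), (is_lim_seq_incr_n (fun n => / INR n)).
      apply (is_lim_seq_inv INR p_infty); [apply is_lim_seq_INR|discriminate].
    - apply (proj2 (Clim_incr_n _ _ (S N0)) HL). }
  rewrite Rmult_0_r, !Rplus_0_r in Hlim.
  apply (is_lim_seq_le (fun _ => Cmod (I - L)%C) _ (Cmod (I - L)%C) _) with (2 := is_lim_seq_const _) (3 := Hlim).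
  intros n; set (N := (n + S N0)%nat).
  assert (HN : b < INR N) by (unfold N; rewrite plus_INR, S_INR; assert (Hn := pos_INR n); lra).
  eapply Rle_trans; [apply Cmod_sub_triangle with (y := (Rpow_C z (INR N) * INR (fact N) / rising z (S N))%C)|].
  specialize (HE N a b I Ha Hb HN HI); unfold Rdiv in *; lra. }
assert (Hgen : forall eps : posreal, exists d M, 0 < d /\ forall a b, 0 < a < d -> M < b ->
  exists I, is_CInt (Gamma_integrand z) a b I /\ Cmod (I - L)%C < eps).
{ intros eps; assert (He := cond_pos eps).
  (* e1 and e2 make each of the two errors eps / 2; the thresholds below solve a^(Re z) < e1 and exp
     (- b / 2) < e2 for a and b. *)
  set (e1 := eps * Re z / 4); set (e2 := eps / 4 / K).
  assert (He1 : 0 < e1) by (unfold e1; nra).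
  assert (He2 : 0 < e2) by (unfold e2; repeat apply Rdiv_lt_0_compat; lra).
  exists (Rmin (1 / 2) (exp (ln e1 / Re z))), (Rmax 1 (- 2 * ln e2)).
  split; [apply Rmin_case; [lra|apply exp_pos]|].
  intros a b [Ha0 Ha] Hb.
  assert (Ha1 := Rlt_le_trans _ _ _ Ha (Rmin_l _ _)); assert (Ha2 := Rlt_le_trans _ _ _ Ha (Rmin_r _ _)).
  assert (Hb1 := Rle_lt_trans _ _ _ (Rmax_l _ _) Hb); assert (Hb2 := Rle_lt_trans _ _ _ (Rmax_r _ _) Hb).
  destruct (is_CInt_ex (Gamma_integrand z) a b) as [I HI]; [lra| |].
  { intros t Ht; apply RCder_Gamma_integrand; lra. }
  exists I; split; [assumption|].
  eapply Rle_lt_trans; [apply (H a b I); [split; lra|lra|exact HI]|].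
  assert (F1 : exp (Re z * ln a) < e1).
  { rewrite <- (exp_ln e1) by assumption; apply exp_increasing.
    apply ln_increasing in Ha2; [|assumption]; rewrite ln_exp in Ha2.
    apply Rmult_lt_compat_l with (r := Re z) in Ha2; [|assumption].
    replace (Re z * (ln e1 / Re z)) with (ln e1) in Ha2 by (field; lra); exact Ha2. }
  assert (F2 : exp (- b / 2) < e2).
  { rewrite <- (exp_ln e2) by assumption; apply exp_increasing; lra. }
  assert (F3 : 2 / Re z * exp (Re z * ln a) < 2 / Re z * e1).
  { apply Rmult_lt_compat_l; [apply Rdiv_lt_0_compat; lra|assumption]. }
  assert (F4 : 2 * K * exp (- b / 2) < 2 * K * e2) by (apply Rmult_lt_compat_l; lra).
  replace (2 / Re z * e1) with (eps / 2) in F3 by (unfold e1; field; lra).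
  replace (2 * K * e2) with (eps / 2) in F4 by (unfold e2; field; lra).
  lra. }
assert (Hpart : forall p : C -> R, (forall x y, Rabs (p x - p y) <= Cmod (x - y)%C) ->
  (forall a b I, is_CInt (Gamma_integrand z) a b I -> is_RInt (fun t => p (Gamma_integrand z t)) a b (p I)) ->
  RInt_gen (V := R_CompleteNormedModule) (fun t => p (Gamma_integrand z t)) (at_right 0) (Rbar_locally p_infty) = p L).
{ intros p Hp Hpi; apply is_RInt_gen_unique; intros P [eps HP].
  destruct (Hgen eps) as (d & M & Hd & HdM).
  exists (fun a => 0 < a < d) (fun b => M < b).
  - exists (mkposreal d Hd); intros a Ha Ha0; split; [assumption|].
    unfold ball in Ha; simpl in Ha; unfold AbsRing_ball, abs, minus, plus, opp in Ha; simpl in Ha.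
    apply Rabs_def2 in Ha; lra.
  - exists M; intros b Hb; exact Hb.
  - intros a b Ha Hb; destruct (HdM a b Ha Hb) as (I & HI & HIL).
    exists (p I); split; [apply Hpi, HI|]; apply HP.
    unfold ball; simpl; unfold AbsRing_ball, abs, minus, plus, opp; simpl.
    eapply Rle_lt_trans; [apply Hp|exact HIL]. }
unfold CGamma; rewrite (surjective_pairing L); f_equal.
- apply (Hpart Re); [intros x y; apply (re_le_Cmod (x - y))|intros a b I HI; apply HI].
- apply (Hpart Im); [intros x y; apply (im_le_Cmod (x - y))|intros a b I HI; apply HI].
Qed.

(** * Wallis' product and the logarithm of Gamma *)

Lemma is_RInt_antiderivative (F f : R -> R) (a b l : R) :
  (forall t, is_derive F t (f t)) -> (forall t, ex_derive f t) -> F b - F a = l ->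
  is_RInt f a b l.
Proof.
intros HF Hf <-; apply (is_RInt_derive F f); intros t _; [apply HF|].
apply (ex_derive_continuous (K := R_AbsRing) (V := R_NormedModule)), Hf.
Qed.

Definition wallis (n : nat) : R := RInt (fun t => sin t ^ n) 0 (PI / 2).

Lemma ex_RInt_sin_pow (n : nat) : ex_RInt (fun t => sin t ^ n) 0 (PI / 2).
Proof.
apply (ex_RInt_continuous (V := R_CompleteNormedModule)); intros t _.
apply (ex_derive_continuous (K := R_AbsRing) (V := R_NormedModule)); auto_derive; exact I.
Qed.

Lemma wallis_correct (n : nat) : is_RInt (fun t => sin t ^ n) 0 (PI / 2) (wallis n).
Proof. apply (RInt_correct (V := R_CompleteNormedModule)), ex_RInt_sin_pow. Qed.

Lemma wallis_0 : wallis 0 = PI / 2.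
Proof.
apply is_RInt_unique, (is_RInt_antiderivative (fun t => t)); [intros t|intros t|ring].
- auto_derive; [exact I|simpl; ring].
- auto_derive; exact I.
Qed.

Lemma wallis_1 : wallis 1 = 1.
Proof.
apply is_RInt_unique.
apply (is_RInt_antiderivative (fun t => - cos t)).
- intros t; auto_derive; [exact I|ring].
- intros t; auto_derive; exact I.
- rewrite cos_PI2, cos_0; ring.
Qed.

(** Integration by parts in the guise of the antiderivative - cos t sin^(n+1) t, which vanishes at
    both ends. *)
Lemma wallis_rec (n : nat) : INR (n + 2) * wallis (n + 2) = INR (n + 1) * wallis n.
Proof.
assert (H : is_RInt (fun t => INR (n + 2) * sin t ^ (n + 2) - INR (n + 1) * sin t ^ n) 0 (PI / 2) 0).
{ apply (is_RInt_antiderivative (fun t => - (cos t * sin t ^ (n + 1)))); [intros t|intros t|].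
  - auto_derive; [exact I|].
    replace (pred (n + 1)) with n by lia.
    assert (H2 := sin2_cos2 t); unfold Rsqr in H2.
    rewrite !plus_INR, !pow_add; simpl.
    replace (cos t * (1 * cos t * ((INR n + 1) * sin t ^ n))) with
      ((INR n + 1) * sin t ^ n * (cos t * cos t)) by ring.
    replace (cos t * cos t) with (1 - sin t * sin t) by lra; ring.
  - auto_derive; exact I.
  - rewrite cos_PI2, sin_0, pow_i by lia; ring. }
assert (H' : is_RInt (fun t => INR (n + 2) * sin t ^ (n + 2) - INR (n + 1) * sin t ^ n) 0 (PI / 2)
  (INR (n + 2) * wallis (n + 2) - INR (n + 1) * wallis n)).
{ apply (is_RInt_minus (fun t => INR (n + 2) * sin t ^ (n + 2)) (fun t => INR (n + 1) * sin t ^ n));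
    apply (is_RInt_scal (V := R_NormedModule)), wallis_correct. }
apply (is_RInt_unique (V := R_CompleteNormedModule)) in H, H'; rewrite H in H'; lra.
Qed.

Lemma wallis_decr (n : nat) : wallis (S n) <= wallis n.
Proof.
assert (HP := PI_RGT_0).
apply (is_RInt_le (fun t => sin t ^ S n) (fun t => sin t ^ n) 0 (PI / 2)); try apply wallis_correct; [lra|].
intros t Ht; assert (H0 : 0 <= sin t) by (apply sin_ge_0; lra); assert (H1 := SIN_bound t).
assert (H2 : 0 <= sin t ^ n) by (now apply pow_le); simpl; nra.
Qed.

Lemma wallis_prod (n : nat) : INR (n + 1) * (wallis (S n) * wallis n) = PI / 2.
Proof.
induction n as [|n IH]; [rewrite wallis_0, wallis_1; simpl; ring|].
assert (H := wallis_rec n); rewrite <- IH.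
replace (S n + 1)%nat with (n + 2)%nat by lia; replace (S (S n)) with (n + 2)%nat by lia.
rewrite <- Rmult_assoc, H; ring.
Qed.

(** Comparison of integrals gives a weak inequality; strictness follows because the product of
    consecutive values is nonzero. *)
Lemma wallis_pos (n : nat) : 0 < wallis n.
Proof.
assert (H : 0 <= wallis n /\ 0 <= wallis (S n)).
{ assert (HP := PI_RGT_0).
  assert (G : forall m, 0 <= wallis m); [intros m|now split].
  apply (is_RInt_le (fun _ => 0) (fun t => sin t ^ m) 0 (PI / 2)); [lra| |apply wallis_correct|].
  - apply (is_RInt_antiderivative (fun _ => 0)); [intros t|intros t|ring]; auto_derive; try exact I; ring.
  - intros t Ht; apply pow_le, sin_ge_0; lra. }
assert (H1 := wallis_prod n); assert (HP := PI_RGT_0).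
destruct (Rle_lt_or_eq_dec _ _ (proj1 H)) as [Hl|He]; [assumption|].
rewrite <- He, !Rmult_0_r in H1; lra.
Qed.

Lemma wallis_even (N : nat) :
  wallis (2 * N) = PI / 2 * INR (fact (2 * N)) / (4 ^ N * INR (fact N) ^ 2).
Proof.
induction N as [|N IH]; [simpl; rewrite wallis_0; field|].
assert (H := wallis_rec (2 * N)); rewrite IH in H.
assert (Hp := pos_INR N); assert (Hf := INR_fact_neq_0 N).
replace (2 * S N)%nat with (2 * N + 2)%nat by lia.
apply Rmult_eq_reg_l with (INR (2 * N + 2)); [|apply not_0_INR; lia]; rewrite H.
replace (fact (2 * N + 2)) with ((2 * N + 2) * ((2 * N + 1) * fact (2 * N)))%nat.
2: { replace (2 * N + 2)%nat with (S (S (2 * N))) by lia; rewrite !fact_simpl; f_equal; f_equal; lia. }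
rewrite fact_simpl, !mult_INR, !plus_INR, !mult_INR, (S_INR N); simpl (INR 2); simpl (INR 1).
simpl (4 ^ S N); field; repeat split; try assumption; [lra|apply pow_nonzero; lra].
Qed.

(** The logarithm of binomial(2N, N) 4^(-N) sqrt N, a quantity that tends to 1 / sqrt pi. *)
Definition wallis_log (N : nat) : R :=
  ln (INR (fact (2 * N))) - 2 * ln (INR (fact N)) - 2 * INR N * ln 2 + / 2 * ln (INR N).

Lemma ln_pow_nat (x : R) (n : nat) : 0 < x -> ln (x ^ n) = INR n * ln x.
Proof.
intros Hx; induction n as [|n IH]; [simpl; rewrite ln_1; ring|].
rewrite S_INR; simpl; rewrite ln_mult, IH by (try apply pow_lt; assumption); ring.
Qed.

Lemma wallis_log_eq (N : nat) : (0 < N)%nat ->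
  wallis_log N = ln (wallis (2 * N)) - ln (PI / 2) + / 2 * ln (INR N).
Proof.
intros HN; rewrite wallis_even; assert (HP := PI_RGT_0).
assert (H1 := INR_fact_lt_0 (2 * N)); assert (H2 := INR_fact_lt_0 N).
assert (H4 : 0 < 4 ^ N) by (apply pow_lt; lra).
assert (H5 : 0 < INR (fact N) ^ 2) by (now apply pow_lt).
rewrite ln_div, !ln_mult, !ln_pow_nat; try assumption; try lra;
  try (apply Rmult_lt_0_compat; lra).
replace 4 with (2 * 2) by ring; rewrite ln_mult by lra.
unfold wallis_log; simpl (INR 2); ring.
Qed.

Lemma wallis_log_bounds (N : nat) : (0 < N)%nat ->
  - / 2 * ln PI - / INR N <= wallis_log N <= - / 2 * ln PI.
Proof.
intros HN; rewrite wallis_log_eq by assumption; assert (HP := PI_RGT_0).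
assert (HN' : 0 < INR N) by (now apply lt_0_INR).
set (W := wallis (2 * N)); assert (HW : 0 < W) by apply wallis_pos.
(* By monotonicity W_{2N}^2 lies between W_{2N} W_{2N+1} and W_{2N-1} W_{2N}, both known exactly. *)
assert (B1 : PI / 2 <= (2 * INR N + 1) * (W * W)).
{ rewrite <- (wallis_prod (2 * N)), plus_INR, mult_INR; simpl (INR 2); simpl (INR 1); fold W.
  assert (H := wallis_decr (2 * N)); fold W in H.
  apply Rmult_le_compat_l; [lra|]; apply Rmult_le_compat_r; lra. }
assert (B2 : 2 * INR N * (W * W) <= PI / 2).
{ assert (H := wallis_decr (pred (2 * N))); assert (H' := wallis_prod (pred (2 * N))).
  replace (S (pred (2 * N))) with (2 * N)%nat in H, H' by lia.
  replace (pred (2 * N) + 1)%nat with (2 * N)%nat in H' by lia.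
  fold W in H, H'; rewrite <- H', mult_INR; simpl (INR 2).
  apply Rmult_le_compat_l; [lra|]; apply Rmult_le_compat_l; lra. }
assert (HWW : 0 < W * W) by nra.
apply ln_le in B1; [|lra]; apply ln_le in B2; [|apply Rmult_lt_0_compat; lra].
rewrite !ln_mult in B1 by lra; rewrite !(ln_mult _ (W * W)), !ln_mult in B2 by lra.
assert (HLP : ln (PI / 2) = ln PI - ln 2) by (apply ln_div; lra).
assert (HLN : ln (2 * INR N + 1) <= ln 2 + ln (INR N) + / INR N).
{ rewrite <- (ln_exp (/ INR N)), <- ln_mult by lra.
  rewrite <- ln_mult by (try apply exp_pos; lra).
  apply ln_le; [lra|]; assert (H := exp_ineq1_le (/ INR N)).
  apply Rle_trans with (2 * INR N * (1 + / INR N)).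
  - replace (2 * INR N * (1 + / INR N)) with (2 * INR N + 2) by (field; lra); lra.
  - apply Rmult_le_compat_l; lra. }
assert (0 < / INR N) by (now apply Rinv_0_lt_compat).
split; lra.
Qed.

Lemma wallis_log_lim : is_lim_seq wallis_log (- / 2 * ln PI).
Proof.
apply (is_lim_seq_incr_n _ 1).
apply is_lim_seq_le_le with (fun n => - / 2 * ln PI - / INR (n + 1)) (fun _ => - / 2 * ln PI).
- intros n; apply wallis_log_bounds; lia.
- cut (is_lim_seq (fun n => - / 2 * ln PI - / INR (n + 1)) (- / 2 * ln PI - 0)).
  { now rewrite Rminus_0_r. }
  apply is_lim_seq_minus'; [apply is_lim_seq_const|].
  apply (is_lim_seq_incr_n (fun n => / INR n)).
  apply (is_lim_seq_inv INR p_infty); [apply is_lim_seq_INR|discriminate].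
- apply is_lim_seq_const.
Qed.

(** * The function l and its identification with log Gamma *)

Definition lgam (z : C) : C :=
  ((z - 1 / 2) * Clog z - z + 1 / 2 * RtoC (ln (2 * PI)) + binetM z)%C.

(** The elementary part of l misses the functional equation by exactly [gudermann z], which M
    compensates. *)
Lemma lgam_succ (z : C) : 0 < Re z -> lgam (z + 1) = (lgam z + Clog z)%C.
Proof.
intros Hz; assert (H := binetM_diff z Hz); unfold gudermann in H.
unfold lgam; apply Ceq_minus.
replace (binetM z) with (binetM (z + 1) + (binetM z - binetM (z + 1)))%C by ring.
rewrite H; replace ((z + 1) - 1 / 2)%C with (z + 1 / 2)%C by (field; Cnz).
field; Cnz.
Qed.

Lemma lgam_real (x : R) : 0 < x -> Im (lgam (RtoC x)) = 0.
Proof.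
intros Hx; unfold lgam; rewrite Clog_RtoC by assumption.
replace ((x - 1 / 2) * ln x - x + 1 / 2 * RtoC (ln (2 * PI)))%C with
  (RtoC ((x - 1 / 2) * ln x - x + 1 / 2 * ln (2 * PI))).
- change (0 + Im (binetM (RtoC x)) = 0); rewrite binetM_real by assumption; ring.
- rewrite RtoC_plus, !RtoC_minus, !RtoC_mult, !RtoC_minus, RtoC_div by lra; reflexivity.
Qed.

Lemma Re_lgam (x : R) : 0 < x ->
  Re (lgam (RtoC x)) = (x - / 2) * ln x - x + / 2 * ln (2 * PI) + Re (binetM (RtoC x)).
Proof.
intros Hx; unfold lgam; rewrite Clog_RtoC by assumption.
replace ((x - 1 / 2) * ln x - x + 1 / 2 * RtoC (ln (2 * PI)))%C with
  (RtoC ((x - / 2) * ln x - x + / 2 * ln (2 * PI))).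
- reflexivity.
- rewrite RtoC_plus, !RtoC_minus, !RtoC_mult, !RtoC_minus, RtoC_inv by lra; unfold Cdiv; Cring.
Qed.

Lemma lgam_RtoC (x : R) : 0 < x -> lgam (RtoC x) = RtoC (Re (lgam (RtoC x))).
Proof.
intros Hx; rewrite (surjective_pairing (lgam (RtoC x))) at 1.
change (snd (lgam (RtoC x))) with (Im (lgam (RtoC x))); now rewrite lgam_real.
Qed.

Lemma lgam_fact (N : nat) : Re (lgam (RtoC (INR (S N)))) = ln (INR (fact N)) + Re (lgam 1).
Proof.
induction N as [|N IH]; [simpl (INR (fact 0)); rewrite ln_1; simpl (INR 1); ring|].
assert (HN : 0 < INR (S N)) by (apply lt_0_INR; lia).
rewrite (S_INR (S N)), RtoC_plus, lgam_succ, Clog_RtoC by assumption.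
change (Re (lgam (RtoC (INR (S N)))) + ln (INR (S N)) = ln (INR (fact (S N))) + Re (lgam 1)).
rewrite IH, fact_simpl, mult_INR, ln_mult; [ring|assumption|apply INR_fact_lt_0].
Qed.

Lemma Clim_binetM_INR : Clim (fun N => binetM (RtoC (INR N))) 0.
Proof.
apply (Clim_incr_n _ _ 1).
apply Clim_ext with (fun N => binetM (1 + INR N)%C).
- intros N; rewrite plus_INR, RtoC_plus, Cplus_comm; reflexivity.
- apply binetM_shift_lim; simpl; lra.
Qed.

(** Let ln n! be written as Stirling's expression plus M(n) minus the unknown l(1). Then
    [wallis_log] becomes - (ln pi) / 2 + l(1) plus terms in M that tend to 0, while its limit is
    already known. *)
Lemma lgam_1 : lgam 1 = 0%C.
Proof.
assert (HP := PI_RGT_0).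
rewrite lgam_RtoC by lra; f_equal.
(* The shift avoids N = 0, where ln N is a default value. *)
assert (E : forall N, wallis_log (N + 1) =
  - / 2 * ln PI + Re (lgam 1) + Re (binetM (RtoC (INR (2 * (N + 1))))) - 2 * Re (binetM (RtoC (INR (N + 1))))).
{ intros N0; set (N := (N0 + 1)%nat).
  assert (HN : 0 < INR N) by (apply lt_0_INR; unfold N; lia).
  assert (HS : forall n, 0 < INR n -> ln (INR (fact n)) =
    (INR n + / 2) * ln (INR n) - INR n + / 2 * ln (2 * PI) + Re (binetM (RtoC (INR n))) - Re (lgam 1)).
  { intros n Hn; assert (H := lgam_fact n).
    rewrite S_INR, RtoC_plus, lgam_succ, Clog_RtoC in H by assumption.
    change (Re (lgam (RtoC (INR n))) + ln (INR n) = ln (INR (fact n)) + Re (lgam 1)) in H.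
    rewrite Re_lgam in H by assumption; lra. }
  unfold wallis_log; rewrite (HS N), (HS (2 * N)%nat) by (rewrite ?mult_INR; simpl (INR 2); lra).
  rewrite mult_INR at 1 2 3; replace (INR 2) with 2 by (simpl; ring).
  rewrite !ln_mult by lra; field. }
assert (HL : is_lim_seq (fun N => wallis_log (N + 1)) (- / 2 * ln PI + Re (lgam 1) + 0 - 2 * 0)).
{ apply (is_lim_seq_ext _ _ _ (fun n => eq_sym (E n))).
  assert (HM := Clim_Re _ _ Clim_binetM_INR).
  apply is_lim_seq_minus'.
  - apply is_lim_seq_plus'; [apply is_lim_seq_const|].
    apply (is_lim_seq_subseq (fun n => Re (binetM (RtoC (INR n)))) 0 (fun n => (2 * (n + 1))%nat)); [|exact HM].
    apply eventually_subseq; intros n; lia.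
  - apply (is_lim_seq_scal_l _ 2 0), (is_lim_seq_incr_n (fun n => Re (binetM (RtoC (INR n))))), HM. }
assert (HL' := proj1 (is_lim_seq_incr_n _ 1 _) wallis_log_lim).
apply is_lim_seq_unique in HL, HL'; rewrite HL in HL'; apply Rbar_finite_eq in HL'; lra.
Qed.

Lemma Cexp_lgam_shift (z : C) (n : nat) : 0 < Re z ->
  Cexp (lgam (z + INR n)) = (Cexp (lgam z) * rising z n)%C.
Proof.
intros Hz; induction n as [|n IH].
- simpl (INR 0); rewrite Cplus_0_r; cbn; Cring.
- assert (Hn : 0 < Re (z + INR n)) by (rewrite Re_plus_INR; assert (H := pos_INR n); lra).
  rewrite plus_INR_S, lgam_succ, Cexp_plus, IH, Cexp_Clog, rising_S by assumption; Cring.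
Qed.

Lemma Cexp_lgam_fact (N : nat) : Cexp (lgam (RtoC (INR (S N)))) = RtoC (INR (fact N)).
Proof.
assert (HN : 0 < INR (S N)) by (apply lt_0_INR; lia).
rewrite lgam_RtoC, lgam_fact, lgam_1, Cexp_RtoC by assumption; simpl (Re 0).
rewrite Rplus_0_r, exp_ln; [reflexivity|apply INR_fact_lt_0].
Qed.

Lemma Clim_mult (u v : nat -> C) (l m : C) :
  Clim u l -> Clim v m -> Clim (fun n => (u n * v n)%C) (l * m)%C.
Proof.
intros Hu Hv; apply Clim_le with
  (fun n => Cmod (u n - l) * Cmod (v n - m) + Cmod l * Cmod (v n - m) + Cmod m * Cmod (u n - l)).
- intros n; replace (u n * v n - l * m)%C with
    ((u n - l) * (v n - m) + l * (v n - m) + m * (u n - l) + 0)%C by ring.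
  eapply Rle_trans; [apply Cmod_triangle4|]; rewrite !Cmod_mult, Cmod_0; lra.
- replace (Finite 0) with (Finite (0 * 0 + Cmod l * 0 + Cmod m * 0)) by (f_equal; ring).
  apply is_lim_seq_plus'; [apply is_lim_seq_plus'|].
  + apply is_lim_seq_mult'; assumption.
  + apply (is_lim_seq_scal_l _ _ 0), Hv.
  + apply (is_lim_seq_scal_l _ _ 0), Hu.
Qed.

Lemma Clim_RtoC (r : nat -> R) (l : R) : is_lim_seq r l -> Clim (fun n => RtoC (r n)) l.
Proof. intros H; apply Clim_parts; [exact H|apply is_lim_seq_const]. Qed.

Lemma Clim_inv_INR : Clim (fun n => RtoC (/ INR (n + 2))) 0.
Proof.
apply Clim_RtoC, (is_lim_seq_incr_n (fun n => / INR n)).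
apply (is_lim_seq_inv INR p_infty); [apply is_lim_seq_INR|discriminate].
Qed.

(** Differentiability of [Clog] at 1, with increment z / n. *)
Lemma Clim_log1p (z : C) : 0 < Re z ->
  Clim (fun k => (RtoC (INR (k + 2)) * (Clog (1 + z * RtoC (/ INR (k + 2))) - z * RtoC (/ INR (k + 2))))%C) 0.
Proof.
intros Hz; assert (Hzm : 0 < Cmod z) by (apply Cmod_gt_0, Re_neq0, Hz).
assert (HD : Cder Clog 1 (/ 1)) by (apply Cder_Clog; simpl; lra).
apply is_lim_seq_spec; intros eps; assert (He := cond_pos eps).
destruct (HD (eps / 2 / Cmod z)) as (d & Hd & H); [repeat apply Rdiv_lt_0_compat; lra|].
assert (HI := is_lim_seq_INR); apply is_lim_seq_spec in HI.
destruct (HI (Cmod z / d)) as [N HN]; exists N; intros n Hn.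
specialize (HN (n + 2)%nat ltac:(lia)); set (k := INR (n + 2)) in *.
assert (Hk : 0 < k) by (apply lt_0_INR; lia).
rewrite Rminus_0_r, Rabs_pos_eq by apply Cmod_ge_0.
assert (Hh : Cmod (z * RtoC (/ k)) = Cmod z / k).
{ rewrite Cmod_mult, Cmod_R, Rabs_pos_eq; [reflexivity|]; now apply Rlt_le, Rinv_0_lt_compat. }
assert (Hlt : Cmod (z * RtoC (/ k)) < d).
{ rewrite Hh; apply Rmult_lt_reg_r with (k / d); [now apply Rdiv_lt_0_compat|].
  replace (Cmod z / k * (k / d)) with (Cmod z / d) by (field; lra).
  replace (d * (k / d)) with k by (field; lra); exact HN. }
specialize (H _ Hlt); rewrite Hh in H.
replace (Clog (1 + z * RtoC (/ k)) - Clog 1 - z * RtoC (/ k) * / 1)%C with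
  (Clog (1 + z * RtoC (/ k)) - z * RtoC (/ k))%C in H.
2: { rewrite (Clog_RtoC 1), ln_1 by lra; field; exact C1_nz. }
match goal with |- Cmod (?x - _)%C < _ => replace (x - RtoC 0)%C with x by ring end.
rewrite Cmod_mult, Cmod_R, Rabs_pos_eq by lra.
apply Rle_lt_trans with (k * (eps / 2 / Cmod z * (Cmod z / k))).
- apply Rmult_le_compat_l; [lra|exact H].
- replace (k * (eps / 2 / Cmod z * (Cmod z / k))) with (eps / 2) by (field; lra); lra.
Qed.

(** N^z N! / (z)_{N+1} = exp (z ln N + l(N + 1) - l(z + N + 1)) exp (l(z)), so the first exponent
    has to tend to 0. *)
Lemma gauss_limit (z : C) : 0 < Re z ->
  Clim (fun N => (Rpow_C z (INR N) * INR (fact N) / rising z (S N))%C) (Cexp (lgam z)).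
Proof.
intros Hz; apply (Clim_incr_n _ _ 1).
(* Here N = k + 1, which is positive, and n k = N + 1 is the argument of l. *)
set (n := fun k : nat => INR (k + 2)).
assert (Hn : forall k, 2 <= n k).
{ intros k; unfold n; rewrite plus_INR; simpl (INR 2); assert (H := pos_INR k); lra. }
set (D := fun k => (RtoC (n k) * (Clog (1 + z * RtoC (/ n k)) - z * RtoC (/ n k)))%C).
(* The exponent z ln N + l(n) - l(z + n) rewritten with Clog (z + n) = ln n + Clog (1 + z / n). As D
   k = n Clog (1 + z / n) - z, the pieces can be seen to tend to 0 separately. *)
set (E := fun k => (z * RtoC (ln (INR (k + 1)) - ln (n k)) - D k - (z - 1 / 2) * RtoC (/ n k) * (D k + z)
   + binetM (RtoC (n k)) - binetM (z + RtoC (n k)))%C).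
assert (HE : Clim E 0).
{ replace (RtoC 0) with (z * RtoC 0 - 0 - (z - 1 / 2) * 0 * (0 + z) + 0 - 0)%C by ring.
  assert (HDl : Clim D 0) by (apply Clim_log1p, Hz).
  apply Clim_minus; [apply Clim_plus; [apply Clim_minus; [apply Clim_minus|]|]|].
  - apply Clim_scal, Clim_RtoC.
    apply is_lim_seq_ext with (fun k => - ln (1 + / INR (k + 1))).
    + intros k; unfold n; assert (H := pos_INR k).
      rewrite <- ln_div by (rewrite plus_INR; simpl; lra).
      rewrite <- ln_Rinv by (assert (0 < / INR (k + 1)); [apply Rinv_0_lt_compat; rewrite plus_INR; simpl; lra|lra]).
      f_equal; rewrite !plus_INR; simpl; field; lra.
    + replace (Finite 0) with (Finite (- ln (1 + 0))) by (rewrite Rplus_0_r, ln_1; f_equal; ring).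
      apply (is_lim_seq_opp _ (ln (1 + 0))).
      apply (is_lim_seq_continuous ln); [apply derivable_continuous_pt; exists (/ (1 + 0)); apply derivable_pt_lim_ln; lra|].
      apply is_lim_seq_plus'; [apply is_lim_seq_const|].
      apply (is_lim_seq_incr_n (fun k => / INR k)).
      apply (is_lim_seq_inv INR p_infty); [apply is_lim_seq_INR|discriminate].
  - exact HDl.
  - apply Clim_mult; [apply Clim_scal, Clim_inv_INR|].
    apply Clim_plus; [exact HDl|apply Clim_const].
  - apply (proj2 (Clim_incr_n (fun k => binetM (RtoC (INR k))) _ 2)), Clim_binetM_INR.
  - apply (proj2 (Clim_incr_n (fun k => binetM (z + INR k)%C) _ 2)), binetM_shift_lim, Hz. }
replace (Cexp (lgam z)) with (Cexp (0 + lgam z)) by (f_equal; ring).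
apply Clim_ext with (fun k => Cexp (E k + lgam z)).
2: { apply Clim_Cexp, Clim_plus; [exact HE|apply Clim_const]. }
intros k.
assert (Hk : 0 < INR (k + 1)) by (apply lt_0_INR; lia).
assert (Hz2 : 0 < Re (z + RtoC (n k))) by (change (0 < Re z + n k); specialize (Hn k); lra).
assert (EE : E k = (z * RtoC (ln (INR (k + 1))) + lgam (RtoC (n k)) + - lgam (z + RtoC (n k)))%C).
{ unfold E, D, lgam.
  assert (Hnk := Hn k).
  assert (Hinv : 0 < / n k) by (apply Rinv_0_lt_compat; lra).
  assert (HnC : RtoC (n k) <> 0%C) by (intros F; apply RtoC_inj in F; lra).
  replace (Clog (z + RtoC (n k))) with (RtoC (ln (n k)) + Clog (1 + z * RtoC (/ n k)))%C.
  2: { rewrite <- Clog_scal; [f_equal; rewrite RtoC_inv by lra; field; assumption|lra|].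
       change (0 < 1 + Re (z * RtoC (/ n k))); rewrite re_scal_r; nra. }
  rewrite (Clog_RtoC (n k)) by lra.
  rewrite RtoC_minus, RtoC_inv by lra; field; Cnz. }
rewrite EE, !Cexp_plus, Cexp_opp.
unfold n; replace (k + 2)%nat with (S (k + 1)) by lia.
rewrite Cexp_lgam_fact, Cexp_lgam_shift by assumption.
unfold Rpow_C; field; split; [now apply rising_neq0|apply Cexp_neq_0].
Qed.

Lemma Cder_lgam (z : C) : 0 < Re z -> exists l, Cder lgam z l.
Proof.
intros Hz; eexists; unfold lgam.
apply Cder_plus; [|apply (derive_n_Cder binetM (fun z _ => eq_refl) 0 z Hz)].
apply Cder_plus; [|apply Cder_const].
apply Cder_ext with (fun x => (x + - (1 / 2)) * Clog x + - (1) * x)%C; [intros; Cring|].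
apply Cder_plus; [|apply Cder_scal, Cder_id].
apply Cder_mult; [apply Cder_plus; [apply Cder_id|apply Cder_const]|now apply Cder_Clog].
Qed.

Lemma is_logGamma_lgam : is_logGamma lgam.
Proof.
split; [|intros x Hx; now apply lgam_real].
intros z Hz; split.
- destruct (Cder_lgam z Hz) as [l Hl]; now apply Cder_ex with l.
- symmetry; apply CGamma_of_limit, gauss_limit; assumption.
Qed.

(** * Uniqueness of log Gamma and the final formula *)

Lemma ex_C_derive_Cder (f : C -> C) (z : C) : ex_C_derive f z -> exists l, Cder f z l.
Proof.
intros [l [_ H]]; exists l; intros eps Heps.
destruct (H z (fun P HP => HP) (mkposreal eps Heps)) as [d Hd].
exists d; split; [apply cond_pos|]; intros h Hh.
assert (Hz : Cmod ((z + h)%C - z) < d) by (replace ((z + h)%C - z)%C with h by ring; exact Hh).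
assert (HH : Cmod (f (z + h) - f z - ((z + h)%C - z) * l)%C <= eps * Cmod ((z + h)%C - z)) by exact (Hd (z + h)%C Hz).
replace ((z + h)%C - z)%C with h in HH by ring; exact HH.
Qed.

Lemma cos_lt_1 (v : R) : 0 < v <= PI -> cos v < 1.
Proof.
intros Hv; replace v with (2 * (v / 2)) by field; rewrite cos_2a_sin.
assert (H : 0 < sin (v / 2)) by (apply sin_gt_0; lra); nra.
Qed.

(* Two logarithms of the same function differ by a continuous function with
   values in 2 pi i Z, which vanishes on the positive axis. *)
Lemma is_logGamma_unique (L : C -> C) (z : C) : is_logGamma L -> 0 < Re z -> L z = lgam z.
Proof.
intros [HL HLr] Hz.
set (D := fun w => (L w - lgam w)%C).
assert (HD : forall w, 0 < Re w -> Re (D w) = 0 /\ cos (Im (D w)) = 1).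
{ intros w Hw; assert (E : Cexp (D w) = 1%C).
  { unfold D, Cminus; rewrite Cexp_plus, Cexp_opp, (proj2 (HL w Hw)), (proj2 (proj1 is_logGamma_lgam w Hw)).
    rewrite Cinv_r; [reflexivity|].
    rewrite <- (proj2 (proj1 is_logGamma_lgam w Hw)); apply Cexp_neq_0. }
  assert (E1 : exp (Re (D w)) = 1) by (rewrite <- Cmod_Cexp, E; apply Cmod_1).
  assert (E2 : Re (D w) = 0) by (apply exp_inv; rewrite exp_0; exact E1).
  split; [exact E2|].
  assert (E3 : exp (Re (D w)) * cos (Im (D w)) = 1) by exact (f_equal Re E).
  rewrite E1, Rmult_1_l in E3; exact E3. }
(* The vertical segment leads from the real point Re z, where D vanishes, to z. *)
set (f := fun s : R => Im (D (Re z, s * Im z))).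
assert (Hf : continuity f).
{ intros s; unfold f; set (w := ((Re z, s * Im z) : C)).
  destruct (ex_C_derive_Cder L w) as [l1 H1]; [apply HL; exact Hz|].
  destruct (Cder_lgam w) as [l2 H2]; [exact Hz|].
  assert (HDw : Cder D w (l1 + - (1) * l2)%C).
  { apply Cder_ext with (fun x => L x + - (1) * lgam x)%C; [intros; unfold D; Cring|].
    apply Cder_plus; [exact H1|apply Cder_scal, H2]. }
  intros eps Heps; destruct (Cder_continuous _ _ _ HDw eps Heps) as (d & Hd & HC).
  exists (d / (Rabs (Im z) + 1)); assert (Hp := Rabs_pos (Im z)).
  split; [apply Rdiv_lt_0_compat; lra|]; intros y [_ Hy].
  change (Rabs (y - s) < d / (Rabs (Im z) + 1)) in Hy.
  change (Rabs (Im (D (Re z, y * Im z)) - Im (D w)) < eps).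
  set (h := ((0, (y - s) * Im z) : C)).
  assert (Hh : Cmod h < d).
  { eapply Rle_lt_trans; [apply Cmod_le_Re_Im|]; simpl; rewrite Rabs_R0, Rabs_mult, Rplus_0_l.
    apply Rle_lt_trans with (Rabs (y - s) * (Rabs (Im z) + 1)).
    - apply Rmult_le_compat_l; [apply Rabs_pos|lra].
    - apply Rmult_lt_compat_r with (r := Rabs (Im z) + 1) in Hy; [|lra].
      unfold Rdiv in Hy; rewrite Rmult_assoc, Rinv_l, Rmult_1_r in Hy by lra; exact Hy. }
  specialize (HC h Hh).
  replace (w + h)%C with ((Re z, y * Im z) : C) in HC.
  2: { unfold w, h, Cplus; simpl; f_equal; ring. }
  eapply Rle_lt_trans; [apply (im_le_Cmod (D (Re z, (y * Im z)%R) - D w)%C)|exact HC]. }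
assert (Hf0 : f 0 = 0).
{ unfold f; rewrite Rmult_0_l; change (Re z, 0) with (RtoC (Re z)); unfold D.
  change (Im (L (RtoC (Re z))) + - Im (lgam (RtoC (Re z))) = 0).
  rewrite HLr, lgam_real by assumption; ring. }
assert (Hcos : forall s, cos (f s) = 1) by (intros s; apply HD; exact Hz).
assert (HP := PI_RGT_0).
assert (Hf1 : f 1 = 0).
{ destruct (Rtotal_order (f 1) 0) as [Hlt|[He|Hgt]]; [exfalso|exact He|exfalso].
  (* The chosen value is attained and lies in [- pi, 0), where the cosine is less than 1; the other
     case is symmetric. *)
  - destruct (IVT_gen f 0 1 (Rmax (f 1) (- PI)) Hf) as [s [_ Hs]].
    { rewrite Hf0, (Rmin_right 0 (f 1)), (Rmax_left 0 (f 1)) by lra; split; [apply Rmax_l|apply Rmax_lub; lra]. }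
    assert (H1 := Hcos s); rewrite Hs, <- cos_neg in H1.
    assert (H2 : 0 < - Rmax (f 1) (- PI) <= PI).
    { split; [|assert (H3 := Rmax_r (f 1) (- PI)); lra].
      assert (H3 : Rmax (f 1) (- PI) < 0) by (apply Rmax_lub_lt; lra); lra. }
    apply cos_lt_1 in H2; lra.
  - destruct (IVT_gen f 0 1 (Rmin (f 1) PI) Hf) as [s [_ Hs]].
    { rewrite Hf0, (Rmin_left 0 (f 1)), (Rmax_right 0 (f 1)) by lra; split; [apply Rmin_glb; lra|apply Rmin_l]. }
    assert (H1 := Hcos s); rewrite Hs in H1.
    assert (H2 : 0 < Rmin (f 1) PI <= PI) by (split; [apply Rmin_glb_lt; lra|apply Rmin_r]).
    apply cos_lt_1 in H2; lra. }
assert (Hz' : ((Re z, 1 * Im z) : C) = z) by (rewrite Rmult_1_l; symmetry; apply surjective_pairing).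
unfold f in Hf1; rewrite Hz' in Hf1.
apply Ceq_minus; change (D z = 0%C); rewrite (surjective_pairing (D z)).
change (fst (D z)) with (Re (D z)); change (snd (D z)) with (Im (D z)).
now rewrite (proj1 (HD z Hz)), Hf1.
Qed.

(** [epsilon] meets its specification once some function does; [lgam] is such a function, and
    uniqueness identifies the choice on the right half-plane. *)
Lemma binet_binetM (z : C) : 0 < Re z -> binet z = binetM z.
Proof.
intros Hz; unfold binet.
assert (H : is_logGamma logGamma) by (unfold logGamma; apply epsilon_spec; exists lgam; apply is_logGamma_lgam).
rewrite (is_logGamma_unique _ _ H Hz); unfold lgam; Cring.
Qed.

Theorem corollary1 (n : nat) (z alpha : C)
    (Hz : 0 < Re z) (Halpha : - Re z < Re alpha) :
  (forall k : nat, (k < n)%nat -> ex_C_derive (C_derive_n binet k) z) /\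
  exists s : C,
    @is_series C_AbsRing C_NormedModule
      (fun j : nat =>
         (C_derive_n (binet_poly (n + j)) n alpha
          / Cprod (fun k : nat => z + alpha + INR k) (n + j))%C) s /\
    C_derive_n binet n z = ((- (1)) ^ n * s)%C.
Proof.
split.
- intros k _; eapply Cder_ex, (derive_n_Cder binet binet_binetM k z Hz).
- destruct (derive_n_series binet binet_binetM n z alpha Hz Halpha) as (s & Hs & E).
  exists s; split; [|exact E].
  apply (Csum_tail _ s n) in Hs; [exact Hs|].
  intros k Hk; rewrite (Cpoly_derive_n_0 n k _ alpha (Cpoly_binet_poly k) Hk).
  unfold Cdiv; Cring.
Qed.
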